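(* Let $n\in\mathbb{N}$, $\ell\in\{0,1,\dots,2n\}$, let $p$ be a prime, and let $P\subset\mathbb{R}^{2n}$ be a full-dimensional lattice polytope with $c_\ell(P)\neq0$. Writing $t=p^{-s}$, we have (as formal power series in $t$) $$(\psi_{n,\ell}\circ\Phi)\big(\mathrm{HS}^{\mathrm{pr}}_{n,p}(\boldsymbol X,\boldsymbol Y)\big)=\psi_{n,\ell}\big(R^{\mathrm{pr}}_{n,p}(\boldsymbol x,X)\big)=\mathcal{Z}^{\mathsf C}_{n,\ell,p}(s)\,\big(1-p^{\ell-ns}\big)\Big(1-p^{\binom{n+1}{2}-ns}\Big).$$
   Context: Groups and lattices. $J=\begin{pmatrix}0&I_n\\-I_n&0\end{pmatrix}$; for a ring $K$, $\mathrm{GSp}_{2n}(K)=\{A\in\mathrm{GL}_{2n}(K):AJA^{\mathrm t}=\mu(A)J,\ \mu(A)\in K^\times\}$; $\Gamma_n=\mathrm{GSp}_{2n}(\mathbb{Z}_p)$; $G_n^+=\mathrm{GSp}_{2n}(\mathbb{Q}_p)\cap\mathrm{Mat}_{2n}(\mathbb{Z}_p)$. For $g\in\mathrm{GL}_{2n}(\mathbb{Q}_p)$, $\Lambda_g$ is the $\mathbb{Z}_p$-lattice generated by the rows of $g$. Ehrhart–Hecke zeta function. For a lattice polytope $P\subset\mathbb{R}^{2n}$ (vertices in $\mathbb{Z}^{2n}$) and a lattice $\mathbb{Z}^{2n}\subseteq\Lambda\subseteq\mathbb{Q}^{2n}$, $E^\Lambda(P)=\sum_{\ell=0}^{2n}c_\ell^\Lambda(P)T^\ell$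 is the Ehrhart polynomial, with value $\#(mP\cap\Lambda)$ at $m\in\mathbb{N}$; $c_\ell(P)=c_\ell^{\mathbb{Z}^{2n}}(P)$. A $\mathbb{Z}_p$-lattice $\mathbb{Z}_p^{2n}\subseteq\Lambda\subseteq\mathbb{Q}_p^{2n}$ is identified with $\Lambda\cap\mathbb{Z}[1/p]^{2n}$. Then $$\mathcal{Z}^{\mathsf C}_{n,\ell,p}(s)=\sum_{g\in G_n^+/\Gamma_n}\frac{c_\ell^{\Lambda_{g^{-1}}}(P)}{c_\ell(P)}\,|\Lambda_{g^{-1}}:\mathbb{Z}_p^{2n}|^{-s}.$$ Satake generating function. For $m\in\mathbb{N}$ let $D_n^{\mathsf C}(m)=\{A\in G_n^+:AJA^{\mathrm t}=mJ\}$ and let $T_n^{\mathsf C}(m)$ be the sum of the distinct double cosets $\Gamma_ng\Gamma_n$, $g\in D_n^{\mathsf C}(m)$, in the spherical Hecke algebra of $(G_n^+,\Gamma_n)$. $\Omega$ is the Satake isomorphism into $\mathbb{C}[x_0^{\pm1},\dots,x_n^{\pm1}]$ in Andrianov's normalization: if $\Gamma_ng\Gamma_n=\bigsqcup_i\Gamma_nM_i$ with $M_i=\begin{pmatrix}p^{\delta_i}(D_i^{\mathrm t})^{-1}&B_i\\0&D_i\end{pmatrix}$, $D_i$ upper triangular with diagonal $(p^{d_{i1}},\dots,p^{d_{in}})$, then $\Omega(\Gamma_ng\Gamma_n)=\sum_ix_0^{\delta_i}\prod_{j=1}^n(p^{-j}x_j)^{d_{ij}}$. With $\boldsymbol x=(x_0,\dots,x_n)$,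 $$R_{n,p}(\boldsymbol x,X)=\sum_{\alpha\ge0}\Omega(T_n^{\mathsf C}(p^\alpha))X^\alpha,\qquad R^{\mathrm{pr}}_{n,p}(\boldsymbol x,X)=(1-x_0X)(1-x_0x_1\cdots x_nX)R_{n,p}(\boldsymbol x,X).$$ Hermite–Smith generating function. For a finite-index sublattice $\Lambda\le\mathbb{Z}_p^n$ let $\nu_1\le\cdots\le\nu_n$ be given by $\mathbb{Z}_p^n/\Lambda\cong\bigoplus_i\mathbb{Z}/p^{\nu_i}$, set $\nu_0=0$ and $\mu_i(\Lambda)=\nu_{n-i+1}-\nu_{n-i}$ for $1\le i\le n$. Let $(\delta_1(\Lambda),\dots,\delta_n(\Lambda))$ be the exponents such that the Hermite normal form of $\Lambda$ (upper triangular matrix whose rows generate $\Lambda$) has diagonal $(p^{\delta_1},\dots,p^{\delta_n})$. With $\boldsymbol X=(X_1,\dots,X_n)$, $\boldsymbol Y=(Y_1,\dots,Y_n)$, $$\mathrm{HS}_{n,p}(\boldsymbol X,\boldsymbol Y)=\sum_{\Lambda\le\mathbb{Z}_p^n}\prod_{i=1}^nX_i^{\mu_i(\Lambda)}Y_i^{\delta_i(\Lambda)}\ (\text{sum over finite-index sublattices}),\qquad\mathrm{HS}^{\mathrm{pr}}_{n,p}(\boldsymbol X,\boldsymbol Y)=(1-X_nY_1\cdots Y_n)\mathrm{HS}_{n,p}(\boldsymbol X,\boldsymbol Y).$$ Substitutions. $\Phi$ is the ring homomorphism with $X_i\mapsto p^{\binom{i+1}{2}}x_0X$ and $Y_i\mapsto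 p^{-i}x_i$. $\psi_{n,\ell}$ is the substitution with $X\mapsto t^n$, $x_0\mapsto p^\ell$, $x_i\mapsto p^i$ for $1\le i\le n-1$, and $x_n\mapsto p^{n-\ell}$, applied to power series in $X$ with coefficients in $\mathbb{C}[x_0^{\pm1},\dots,x_n^{\pm1}]$. *)

(* Defs.v *)
From HB Require Import structures.
From mathcomp Require Import all_boot all_order all_algebra.
From mathcomp Require Import finmap.
From mathcomp Require Import mathcomp_extra boolp classical_sets functions.
From mathcomp Require Import cardinality fsbigop reals.
From mathcomp Require Import complex.
From mathcomp.multinomials Require Import monalg.
Set Implicit Arguments.
Unset Strict Implicit.
Unset Printing Implicit Defensive.
Import Order.TTheory GRing.Theory Num.Theory.
Local Open Scope classical_set_scope.
Local Open Scope ring_scope.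

(* Z_p as the inverse limit of the rings Z/p^k: an element is the sequence of
   its canonical residues x_k in [0, p^k). *)
Section PadicInt.
Variable p : nat.

Definition padic_coherent : {pred nat -> int} :=
  fun x => `[< forall k, x k = (x k.+1 %% p%:Z ^+ k)%Z >].

(* The primality proof is a parameter of the type so that the integral domain
   structure can be inferred from it. *)
Record padic_int (p_pr : prime p) := PadicInt {
  padic_res :> nat -> int;
  padic_resP : padic_res \in padic_coherent }.

Variable p_pr : prime p.
Local Notation Zp := (padic_int p_pr).

HB.instance Definition _ := [isSub for @padic_res p_pr].
HB.instance Definition _ := [Choice of Zp by <:].

Lemma padic_coh (x : Zp) k : x k = (x k.+1 %% p%:Z ^+ k)%Z.
Proof. by have /asboolP := padic_resP x. Qed.

Lemma padic_mod (x : Zp) k : (x k %% p%:Z ^+ k)%Z = x k.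
Proof. by rewrite [in RHS]padic_coh [x k]padic_coh modz_mod. Qed.

Lemma padicP (x y : Zp) : (forall k, x k = y k) -> x = y.
Proof. by move=> xy; apply/val_inj/funext. Qed.

Lemma modz_expS m k :
  ((m %% p%:Z ^+ k.+1)%Z = m %[mod p%:Z ^+ k])%Z.
Proof.
rewrite [in RHS](divz_eq m (p%:Z ^+ k.+1)) exprS mulrA.
by rewrite modzMDl.
Qed.

Fact padic_ofP (f : nat -> int) : (forall k, (f k.+1 = f k %[mod p%:Z ^+ k])%Z) ->
  (fun k => (f k %% p%:Z ^+ k)%Z) \in padic_coherent.
Proof. by move=> fP; apply/asboolP => k; rewrite modz_expS fP. Qed.

Definition padic_of f fP := PadicInt p_pr (@padic_ofP f fP).

Lemma padic_coh_eq (x : Zp) k : (x k.+1 = x k %[mod p%:Z ^+ k])%Z.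
Proof. by rewrite padic_mod -padic_coh. Qed.

Definition padic_zero := @padic_of (fun=> 0) (fun=> erefl).
Definition padic_one := @padic_of (fun=> 1) (fun=> erefl).

Fact padic_opp_subproof (x : Zp) k :
  (- x k.+1 = - x k %[mod p%:Z ^+ k])%Z.
Proof. by rewrite -modzNm padic_coh_eq modzNm. Qed.
Definition padic_opp x := padic_of (padic_opp_subproof x).

Fact padic_add_subproof (x y : Zp) k :
  (x k.+1 + y k.+1 = x k + y k %[mod p%:Z ^+ k])%Z.
Proof. by rewrite -modzDm !padic_coh_eq modzDm. Qed.
Definition padic_add x y := padic_of (padic_add_subproof x y).

Fact padic_mul_subproof (x y : Zp) k :
  (x k.+1 * y k.+1 = x k * y k %[mod p%:Z ^+ k])%Z.
Proof. by rewrite -modzMm !padic_coh_eq modzMm. Qed.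
Definition padic_mul x y := padic_of (padic_mul_subproof x y).

Fact padic_addA : associative padic_add.
Proof. by move=> x y z; apply/padicP => k /=; rewrite modzDml modzDmr addrA. Qed.
Fact padic_addC : commutative padic_add.
Proof. by move=> x y; apply/padicP => k /=; rewrite addrC. Qed.
Fact padic_add0 : left_id padic_zero padic_add.
Proof. by move=> x; apply/padicP => k /=; rewrite modzDml add0r padic_mod. Qed.
Fact padic_addN : left_inverse padic_zero padic_opp padic_add.
Proof. by move=> x; apply/padicP => k /=; rewrite modzDml addNr. Qed.

HB.instance Definition _ := GRing.isZmodule.Build Zp
  padic_addA padic_addC padic_add0 padic_addN.

Fact padic_mulA : associative padic_mul.
Proof. by move=> x y z; apply/padicP => k /=; rewrite modzMml modzMmr mulrA. Qed.
Fact padic_mulC : commutative padic_mul.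
Proof. by move=> x y; apply/padicP => k /=; rewrite mulrC. Qed.
Fact padic_mul1 : left_id padic_one padic_mul.
Proof. by move=> x; apply/padicP => k /=; rewrite modzMml mul1r padic_mod. Qed.
Fact padic_mulD : left_distributive padic_mul padic_add.
Proof.
move=> x y z; apply/padicP => k /=.
by rewrite modzMml modzDml modzDmr mulrDl.
Qed.
Fact padic_1neq0 : padic_one != padic_zero.
Proof.
apply/eqP => /(congr1 (fun x : Zp => x 1%N)) /=.
by rewrite expr1 !modz_nat mod0n modn_small ?prime_gt1.
Qed.

HB.instance Definition _ := GRing.Zmodule_isComNzRing.Build Zp
  padic_mulA padic_mulC padic_mul1 padic_mulD padic_1neq0.

Definition padic_unit : {pred Zp} := fun x => `[< exists y, y * x = 1 >].
Definition padic_inv (x : Zp) : Zp :=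
  if pselect (exists y, y * x = 1) is left ex then sval (cid ex) else x.

Fact padic_mulV : {in padic_unit, left_inverse 1 padic_inv *%R}.
Proof.
move=> x /asboolP xU; rewrite /padic_inv; case: pselect => // ex.
by case: cid.
Qed.
Fact padic_unitP (x y : Zp) : y * x = 1 -> padic_unit x.
Proof. by move=> yx; apply/asboolP; exists y. Qed.
Fact padic_inv_out : {in [predC padic_unit], padic_inv =1 id}.
Proof.
move=> x /asboolPn xNU; rewrite /padic_inv; case: pselect => //.
Qed.

HB.instance Definition _ := GRing.ComNzRing_hasMulInverse.Build Zp
  padic_mulV padic_unitP padic_inv_out.

Lemma padic_neq0 (x : Zp) : x != 0 -> exists k, ~~ (p%:Z ^+ k %| x k)%Z.
Proof.
apply: contra_neqP => xN; apply/padicP => k.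
rewrite /= mod0z -padic_mod; apply/dvdz_mod0P.
by apply: contrapT => /negP h; apply: xN; exists k.
Qed.

Lemma padic_dvd (x : Zp) i j : (i <= j)%N ->
  (x j = x i %[mod p%:Z ^+ i])%Z.
Proof.
move=> /subnKC <-; elim: (j - i)%N => [|d IHd]; first by rewrite addn0.
rewrite addnS -IHd; have := padic_coh_eq x (i + d)%N => /eqP.
rewrite !eqz_mod_dvd => h; apply/eqP; rewrite eqz_mod_dvd.
by apply: dvdz_trans h; rewrite dvdz_exp2l ?leq_addr.
Qed.

Fact Zpegral : GRing.integral_domain_axiom Zp.
Proof.
move=> x y xy0; apply/norP => -[/padic_neq0[i xi] /padic_neq0[j yj]].
have := congr1 (fun z : Zp => z (i + j)%N) xy0 => /=.
rewrite mod0z => /dvdz_mod0P.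
have {}xi : ~~ (p%:Z ^+ i %| x (i + j)%N)%Z.
  apply: contra xi => /dvdz_mod0P h; apply/dvdz_mod0P.
  by rewrite -(padic_dvd x (leq_addr j i)).
have {}yj : ~~ (p%:Z ^+ j %| y (i + j)%N)%Z.
  apply: contra yj => /dvdz_mod0P h; apply/dvdz_mod0P.
  by rewrite -(padic_dvd y (leq_addl i j)).
move: xi yj; rewrite !dvdzE !abszX abszM !absz_nat; move: `|x _|%N `|y _|%N => a b.
move=> ai bj abij.
have a0 : (0 < a)%N by case: a ai {abij} => //; rewrite dvdn0.
have b0 : (0 < b)%N by case: b bj {abij} => //; rewrite dvdn0.
move: abij; rewrite pfactor_dvdn ?muln_gt0 ?a0// lognM//.
move: ai bj; rewrite !pfactor_dvdn// -!ltnNge => ai bj.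
by rewrite leqNgt (leq_trans _ (leq_add ai bj))// addnS ltnS addSn leqnSn.
Qed.

HB.instance Definition _ := GRing.ComUnitRing_isIntegral.Build Zp
  Zpegral.

End PadicInt.
Section Series.
Variables (I : finType) (S : comNzRingType).

(* Formal power series in variables indexed by I: f m is the coefficient of the
   monomial with exponent m. *)
Definition series := {ffun I -> nat} -> S.
HB.instance Definition _ := GRing.Zmodule.on series.

Implicit Types (f g h : series) (m : {ffun I -> nat}).

Definition series_mono (c : S) m : series := fun m' => c *+ (m' == m).
Definition series_one : series := series_mono 1 0.
Definition series_mul f g : series := fun m =>
  \sum_(uv \in [set uv : {ffun I -> nat} * {ffun I -> nat} | uv.1 + uv.2 = m])
    f uv.1 * g uv.2.

Let box m : seq {ffun I -> nat} :=
  [seq [ffun i => val (u i)] | u : {ffun I -> 'I_(\sum_i m i).+1}].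

Let box_uniq m : uniq (box m).
Proof.
rewrite map_inj_uniq ?enum_uniq// => u v /ffunP uv.
by apply/ffunP => i; apply/val_inj; have := uv i; rewrite !ffunE.
Qed.

Let ffun_natD (u v : {ffun I -> nat}) i : (u + v) i = (u i + v i)%N.
Proof. by rewrite ffunE. Qed.

Let mem_box m (u : {ffun I -> nat}) : (forall i, u i <= m i)%N -> u \in box m.
Proof.
move=> um; have ltm i : (u i < (\sum_i m i).+1)%N.
  by rewrite ltnS (leq_trans (um i))// (bigD1 i)//= leq_addr.
apply/mapP; exists [ffun i => Ordinal (ltm i)]; first by rewrite mem_enum.
by apply/ffunP => i; rewrite !ffunE.
Qed.

Let mem_boxl m (u v : {ffun I -> nat}) : u + v = m -> u \in box m.
Proof. by move=> <-; apply: mem_box => i; rewrite ffun_natD leq_addr. Qed.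
Let mem_boxr m (u v : {ffun I -> nat}) : u + v = m -> v \in box m.
Proof. by rewrite addrC; exact: mem_boxl. Qed.

Let series_mulE f g m (B : seq {ffun I -> nat}) : uniq B ->
    (forall u v, u + v = m -> u \in B) ->
  series_mul f g m =
  \sum_(u <- B) \sum_(v <- B) (if u + v == m then f u * g v else 0).
Proof.
move=> uB Bm; pose r := [seq uv <- [seq (u, v) | u <- B, v <- B] | uv.1 + uv.2 == m].
have rE : [set uv : {ffun I -> nat} * {ffun I -> nat} | uv.1 + uv.2 = m] = [set` r].
  apply/seteqP; split=> -[u v] /=; rewrite mem_filter /=.
    move=> uvm; rewrite uvm eqxx /=; apply/allpairsP; exists (u, v) => /=.
    by split=> //; [exact: Bm uvm | apply: (Bm v u); rewrite addrC].
  by move=> /andP[/eqP].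
rewrite /series_mul rE -fsbig_seq ?filter_uniq ?allpairs_uniq//; last first.
  by move=> [? ?] [? ?].
rewrite big_filter big_mkcond/=.
by rewrite big_allpairs.
Qed.

Let series_mulC : commutative series_mul.
Proof.
move=> f g; apply/funext => m.
rewrite !(series_mulE _ _ (box_uniq m) (@mem_boxl m)) exchange_big/=.
by apply: eq_bigr => u _; apply: eq_bigr => v _; rewrite addrC mulrC.
Qed.

Let series_mul3 f g h m :
  series_mul f (series_mul g h) m =
  \sum_(a <- box m) \sum_(c <- box m) \sum_(d <- box m)
     (if a + (c + d) == m then f a * (g c * h d) else 0).
Proof.
rewrite (series_mulE _ _ (box_uniq m) (@mem_boxl m)).
apply: eq_bigr => a _.
transitivity (\sum_(v <- box m) \sum_(c <- box m) \sum_(d <- box m)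
   (if c + d == v then if a + v == m then f a * (g c * h d) else 0 else 0)).
  apply: eq_bigr => v _; case: eqP => [avm|_]; last first.
    by rewrite big1// => c _; rewrite big1// => d _; rewrite if_same.
  rewrite (@series_mulE _ _ v (box m))//; last first.
    move=> u w uw; apply: (@mem_boxl _ _ (w + a)).
    by rewrite addrA uw addrC.
  rewrite mulr_sumr; apply: eq_bigr => c _.
  rewrite mulr_sumr; apply: eq_bigr => d _.
  by case: ifP => // _; rewrite mulr0.
rewrite exchange_big/=; apply: eq_bigr => c _.
rewrite exchange_big/=; apply: eq_bigr => d _.
case: (eqVneq (a + (c + d)) m) => [acd|acd].
  rewrite (bigD1_seq (c + d))//=; last exact: (@mem_boxr _ a).
  rewrite eqxx acd eqxx big1 ?addr0// => v.
  by rewrite eq_sym => /negPf ->.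
by rewrite big1// => v _; case: eqP => // <-; rewrite (negPf acd).
Qed.

Let series_mulA : associative series_mul.
Proof.
move=> f g h; rewrite [RHS]series_mulC; apply/funext => m; rewrite !series_mul3.
rewrite [RHS]exchange_big/=; apply: eq_bigr => a _.
rewrite [RHS]exchange_big/=; apply: eq_bigr => b _.
apply: eq_bigr => c _; rewrite (addrC c) -addrA; case: ifP => // _.
by rewrite (mulrC (h c)) mulrA.
Qed.

Let series_mul1 : left_id series_one series_mul.
Proof.
move=> f; apply/funext => m; rewrite (series_mulE _ _ (box_uniq m) (@mem_boxl m)).
have box0 : 0 \in box m by apply: (@mem_boxl _ _ m); rewrite add0r.
have boxm : m \in box m by apply: (@mem_boxl _ _ 0); rewrite addr0.
rewrite (bigD1_seq 0)//= [X in _ + X]big1 => [|u u0]; last first.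
  rewrite big1// => v _; case: ifP => //.
  by rewrite /series_one /series_mono (negPf u0) mulr0n mul0r.
rewrite addr0 (bigD1_seq m)//= add0r eqxx big1 => [|v vm]; last first.
  by rewrite add0r (negPf vm).
by rewrite /series_one /series_mono eqxx mulr1n mul1r addr0.
Qed.

Let series_mulD : left_distributive series_mul +%R.
Proof.
move=> f g h; apply/funext => m.
rewrite [RHS]/GRing.add/= !(series_mulE _ _ (box_uniq m) (@mem_boxl m)).
rewrite -big_split/=; apply: eq_bigr => u _.
rewrite -big_split/=; apply: eq_bigr => v _.
by case: ifP; rewrite ?addr0// mulrDl.
Qed.

Let series_1neq0 : series_one != 0.
Proof.
apply/eqP => /(congr1 (fun f : series => f 0)); rewrite /series_one /series_mono.
by rewrite eqxx => /eqP; rewrite oner_eq0.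
Qed.

HB.instance Definition _ := GRing.Zmodule_isComNzRing.Build series
  series_mulA series_mulC series_mul1 series_mulD series_1neq0.

Definition series_const (c : S) : series := series_mono c 0.
Definition series_var (i : I) : series :=
  series_mono 1 [ffun j => nat_of_bool (j == i)].

(* Coefficientwise sum of a family of power series; intended for families in
   which each coefficient is nonzero for finitely many members only (otherwise
   \sum_( _ \in _ ) returns 0 in that coefficient). *)
Definition formal_sum (T : choiceType) (A : set T) (F : T -> series) : series :=
  fun m => \sum_(a \in A) F a m.
End Series.
Arguments series_const {I S} c.
Arguments series_var {I} S i.

(* Apply phi to the coefficients and replace the i-th variable by v i. *)
Definition series_subst (I J : finType) (S S' : comNzRingType) (phi : S -> S')
    (v : I -> series J S') (f : series I S) : series J S' :=
  formal_sum setT (fun m : {ffun I -> nat} =>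
    series_const (phi (f m)) * \prod_i v i ^+ m i).

Section GroupAlgebra.
Variables (K : zmodType) (S : comNzRingType).


(* The group algebra S[K]; << c *g k >> is c times the basis element k. *)
Definition galg := {malg S[K]}.
HB.instance Definition _ := GRing.Lmodule.on galg.

Implicit Types (g : galg) (k : K).

Definition galg_one : galg := << 0 >>.
Definition galg_mul g1 g2 : galg :=
  \sum_(k1 <- msupp g1) \sum_(k2 <- msupp g2) << g1@_k1 * g2@_k2 *g (k1 + k2)%R >>.

Let mulEw (d1 d2 : {fset K}) g1 g2 :
    (msupp g1 `<=` d1)%fset -> (msupp g2 `<=` d2)%fset ->
  galg_mul g1 g2 =
  \sum_(k1 <- d1) \sum_(k2 <- d2) << g1@_k1 * g2@_k2 *g (k1 + k2)%R >>.
Proof.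
move=> le1 le2; rewrite /galg_mul (big_fset_incl _ le1) /=; last first.
  move=> k _ /mcoeff_outdom g1k.
  by rewrite big1 // => k' _; rewrite g1k mul0r monalgU0.
apply: eq_bigr => k1 _; apply/big_fset_incl => // k _ /mcoeff_outdom ->.
by rewrite mulr0 monalgU0.
Qed.

Let galg_mulC : commutative galg_mul.
Proof.
move=> g1 g2; rewrite /galg_mul exchange_big/=.
by apply: eq_bigr => k2 _; apply: eq_bigr => k1 _; rewrite mulrC addrC.
Qed.

Let galg_mulD : left_distributive galg_mul +%R.
Proof.
move=> g1 g2 g.
rewrite (mulEw (msuppD_le _ _) (fsubset_refl _)).
rewrite (mulEw (fsubsetUl _ (msupp g2)) (fsubset_refl _)).
rewrite (mulEw (fsubsetUr (msupp g1) _) (fsubset_refl _)).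
rewrite -big_split /=; apply/eq_bigr=> k1 _.
rewrite -big_split /=; apply/eq_bigr=> k2 _.
by rewrite mcoeffD mulrDl monalgUD.
Qed.

Let galg_mul0 : left_zero 0 galg_mul.
Proof. by move=> g; rewrite /galg_mul msupp0 big_seq_fset0. Qed.

Let galg_mulUU c1 c2 k1 k2 :
  galg_mul << c1 *g k1 >> << c2 *g k2 >> = << c1 * c2 *g (k1 + k2)%R >>.
Proof. by rewrite (mulEw msuppU_le msuppU_le) !big_seq_fset1 !mcoeffUU. Qed.

Let galg_sumE g : g = \sum_(k <- msupp g) << g@_k *g k >>.
Proof. exact: monalgE. Qed.

Let galg_mul_suml (r : seq K) (F : K -> galg) g :
  galg_mul (\sum_(k <- r) F k) g = \sum_(k <- r) galg_mul (F k) g.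
Proof. exact: (big_morph (galg_mul^~ g) (fun _ _ => galg_mulD _ _ _) (galg_mul0 g)). Qed.
Let galg_mul_sumr (r : seq K) (F : K -> galg) g :
  galg_mul g (\sum_(k <- r) F k) = \sum_(k <- r) galg_mul g (F k).
Proof.
by rewrite galg_mulC galg_mul_suml; apply: eq_bigr => k _; rewrite galg_mulC.
Qed.

Let galg_mul1 : left_id galg_one galg_mul.
Proof.
move=> g; rewrite [g]galg_sumE galg_mul_sumr; apply: eq_bigr => k _.
by rewrite galg_mulUU mul1r add0r.
Qed.

Let galg_mulA : associative galg_mul.
Proof.
move=> g1 g2 g3; rewrite [g1]galg_sumE [g2]galg_sumE [g3]galg_sumE.
pose U g k : galg := << g@_k *g k >>; rewrite -!/(U _ _).
rewrite !(galg_mul_suml _ (U g1)) (galg_mul_suml _ (fun k => galg_mul (U g1 k) _)).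
apply: eq_bigr => k1 _.
rewrite (galg_mul_suml _ (U g2)) (galg_mul_sumr _ (U g2)).
rewrite galg_mul_sumr galg_mul_suml; apply: eq_bigr => k2 _.
rewrite !(galg_mul_sumr _ (U g3)) galg_mul_sumr; apply: eq_bigr => k3 _.
by rewrite /U !galg_mulUU mulrA addrA.
Qed.

Let galg_1neq0 : galg_one != 0.
Proof. by apply/eqP/malgP=> /(_ 0) /eqP; rewrite !mcoeffsE oner_eq0. Qed.

HB.instance Definition _ := GRing.Zmodule_isComNzRing.Build galg
  galg_mulA galg_mulC galg_mul1 galg_mulD galg_1neq0.
End GroupAlgebra.

Section Laurent.
Variables (N : nat) (S : fieldType).

Definition laurent := galg {ffun 'I_N -> int} S.
HB.instance Definition _ := GRing.ComNzRing.on laurent.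

Definition laurent_const (c : S) : laurent := << c *g 0 >>.
Definition laurent_var (i : 'I_N) : laurent :=
  << [ffun j => (j == i)%:Z] >>.
Definition laurent_eval (a : 'I_N -> S) : laurent -> S :=
  mmap idfun (fun k : {ffun 'I_N -> int} => \prod_i a i ^ k i).
End Laurent.
Arguments laurent_const N {S} c.
Arguments laurent_var {N} S i.

Section Polytopes.
Variables (R : realType) (d : nat).
Implicit Types (P A : set 'rV[R]_d) (L : set 'rV[rat]_d).

Definition affine_hull A : set 'rV[R]_d :=
  [set x | exists k (a : 'I_k -> R) (v : 'I_k -> 'rV[R]_d),
     [/\ \sum_i a i = 1, forall i, A (v i) & x = \sum_i a i *: v i]].

Definition convex_hull A : set 'rV[R]_d :=
  [set x | exists k (a : 'I_k -> R) (v : 'I_k -> 'rV[R]_d),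
     [/\ forall i, 0 <= a i, \sum_i a i = 1, forall i, A (v i)
       & x = \sum_i a i *: v i]].

Definition lattice_polytope P :=
  exists V : seq 'rV[int]_d, P = convex_hull [set map_mx intr v | v in [set` V]].

Definition full_dimensional P := affine_hull P = setT.

Definition integer_lattice : set 'rV[rat]_d := range (map_mx intr).

Definition lattice_point_count P L : nat :=
  #|` fset_set (P `&` [set map_mx ratr x | x in L])|.

Definition ehrhart_poly L P : {poly R} :=
  xget 0 [set E : {poly R} | (size E <= d.+1)%N /\
    forall m : nat, (0 < m)%N ->
      E.[m%:R] = (lattice_point_count [set m%:R *: x | x in P] L)%:R].

Definition ehrhart_coef L P (l : nat) : R := (ehrhart_poly L P)`_l.
End Polytopes.
Arguments integer_lattice d : clear implicits.

Definition cosets (V : zmodType) (L M : set V) : set (set V) :=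
  [set [set v + w | w in M] | v in L].

Definition lattice_index (V : zmodType) (L M : set V) : nat :=
  #|` fset_set (cosets L M)|.

Section Symplectic.
Variables (n : nat) (K : comUnitRingType).

Definition Jmx : 'M[K]_(n + n) := block_mx 0 1%:M (- 1%:M) 0.

Definition GSp : set 'M[K]_(n + n) :=
  [set A | A \in unitmx /\
     exists2 mu, mu \is a GRing.unit & A *m Jmx *m A^T = mu *: Jmx].
End Symplectic.
Arguments Jmx n K : clear implicits.
Arguments GSp n K : clear implicits.

Definition upper_triangular (K : nmodType) n (A : 'M[K]_n) :=
  forall i j : 'I_n, (j < i)%N -> A i j = 0.

Section Padic.
Variables (p : nat) (p_pr : prime p).
Local Notation Zp := (padic_int p_pr).

Definition padic := {fraction Zp}.
HB.instance Definition _ := GRing.Field.on padic.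
Definition padic_of_int : Zp -> padic := @tofrac Zp.

Section Lattices.
Variable d : nat.

Definition row_lattice (g : 'M[padic]_d) : set 'rV[padic]_d :=
  [set map_mx padic_of_int v *m g | v in [set: 'rV[Zp]_d]].

Definition std_lattice : set 'rV[padic]_d := range (map_mx padic_of_int).

(* The intersection of a Z_p-lattice with Z[1/p]^d. *)
Definition rational_lattice (L : set 'rV[padic]_d) : set 'rV[rat]_d :=
  [set x : 'rV[rat]_d | (forall j, exists (a : int) (k : nat), x 0 j = a%:~R / p%:R ^+ k) /\
           L (map_mx ratr x)].
End Lattices.
Arguments std_lattice d : clear implicits.

Section HermiteSmith.
Variable n : nat.
Implicit Types L : set 'rV[Zp]_n.

Definition finite_index_sublattice L :=
  [/\ L 0, forall (a : Zp) u v, L u -> L v -> L (a *: u + v)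
    & finite_set (cosets setT L)].

(* 'I_k.-1.+1 is the additive group Z/kZ for k > 0, k = 1 included. The
   isomorphism of Z_p^n / L with the sum of the Z/p^nu_i is given by its
   components on Z_p^n. *)
Definition quotient_type L (nu : n.-tuple nat) :=
  sorted leq nu /\
  exists phi : forall i : 'I_n, {additive 'rV[Zp]_n -> 'I_(p ^ tnth nu i).-1.+1},
    (forall u, L u <-> forall i, phi i u = 0) /\
    (forall c : forall i : 'I_n, 'I_(p ^ tnth nu i).-1.+1,
       exists u, forall i, phi i u = c i).

Definition smith_type L : n.-tuple nat :=
  xget [tuple of nseq n 0%N] [set nu | quotient_type L nu].

(* mu_(i+1), for the index i counted from 0. *)
Definition smith_mu L (i : 'I_n) : nat :=
  let nu := nth 0%N (0%N :: smith_type L) in (nu (n - i) - nu (n - i.+1))%N.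

(* The diagonal does not depend on the choice of an upper triangular basis, so
   the entries above it need not be reduced. *)
Definition hermite_delta L : {ffun 'I_n -> nat} :=
  xget [ffun=> 0%N] [set e : {ffun 'I_n -> nat} | exists A : 'M[Zp]_n,
    [/\ upper_triangular A, forall i, A i i = p%:R ^+ e i
      & L = range (fun v : 'rV[Zp]_n => v *m A)]].

Variable R : realType.
Local Notation C := R[i].

(* inl i is the variable X_(i+1) and inr i the variable Y_(i+1). *)
Definition hs_X (i : 'I_n) : series ('I_n + 'I_n)%type C :=
  series_var C (inl i).
Definition hs_Y (i : 'I_n) : series ('I_n + 'I_n)%type C :=
  series_var C (inr i).

Definition HS : series ('I_n + 'I_n)%type C :=
  formal_sum [set L | finite_index_sublattice L] (fun L =>
    \prod_i (hs_X i ^+ smith_mu L i * hs_Y i ^+ hermite_delta L i)).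

(* The first product has the single factor X_n. *)
Definition HSpr : series ('I_n + 'I_n)%type C :=
  (1 - (\prod_(i < n | i.+1 == n) hs_X i) * \prod_i hs_Y i) * HS.
End HermiteSmith.

Section Hecke.
Variable n : nat.
Local Notation M := 'M[padic]_(n + n).

Definition Gamma : set M := [set map_mx padic_of_int A | A in GSp n Zp].

Definition Gplus : set M :=
  GSp n padic `&` range (map_mx padic_of_int : 'M[Zp]_(n + n) -> M).

Definition left_coset (g : M) : set M := [set g *m a | a in Gamma].
Definition right_coset (g : M) : set M := [set a *m g | a in Gamma].
Definition double_coset (g : M) : set M :=
  [set a.1 *m g *m a.2 | a in Gamma `*` Gamma].

Variable R : realType.
Local Notation C := R[i].

(* The underlying vector space of the Hecke algebra of (G_n^+, Gamma_n): formal
   linear combinations of double cosets. Its product is not needed. *)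
Definition hecke := {malg C[set M]}.

Definition hecke_D (m : nat) : set M :=
  Gplus `&` [set A | A *m Jmx n padic *m A^T = m%:R *: Jmx n padic].

Definition hecke_T (m : nat) : hecke :=
  \sum_(Y \in [set double_coset g | g in hecke_D m]) (<< Y >> : hecke).

Local Notation laur := (laurent n.+1 C).
Local Notation x0 := (laurent_var C (ord0 : 'I_n.+1)).
Local Notation x_ j := (laurent_var C (lift (ord0 : 'I_n.+1) j)).

(* The exponents (delta, (d_1, ..., d_n)) of a block triangular representative
   of a right coset. *)
Definition coset_exponents (X : set M) : nat * {ffun 'I_n -> nat} :=
  xget (0%N, [ffun=> 0%N]) [set e : nat * {ffun 'I_n -> nat} |
    exists D B : 'M[padic]_n,
    [/\ upper_triangular D, forall j, D j j = p%:R ^+ e.2 j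
      & X (block_mx (p%:R ^+ e.1 *: invmx D^T) B 0 D)]].

Definition satake_coset (X : set M) : laur :=
  let e := coset_exponents X in
  x0 ^+ e.1 * \prod_(j < n) (laurent_const n.+1 (p%:R ^- j.+1) * x_ j) ^+ e.2 j.

Definition satake : hecke -> laur :=
  mmap (laurent_const n.+1)
    (fun Y => \sum_(X \in [set right_coset g | g in Y]) satake_coset X).

Local Notation cst := (@series_const unit _).
Local Notation X := (series_var laur tt).

Definition hecke_series : series unit laur :=
  formal_sum setT (fun a : nat => cst (satake (hecke_T (p ^ a))) * X ^+ a).

Definition hecke_series_pr : series unit laur :=
  (1 - cst x0 * X) * (1 - cst (x0 * \prod_(j < n) x_ j) * X) * hecke_series.

Definition Phi : series ('I_n + 'I_n)%type C -> series unit laur :=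
  series_subst (laurent_const n.+1) (fun v : ('I_n + 'I_n)%type => match v with
    | inl i => cst (laurent_const n.+1 (p%:R ^+ 'C(i.+2, 2)) * x0) * X
    | inr i => cst (laurent_const n.+1 (p%:R ^- i.+1) * x_ i)
    end).

Definition psi_point (l : nat) (i : 'I_n.+1) : C :=
  if i == 0%N :> nat then p%:R ^+ l
  else if (i < n)%N then p%:R ^+ i else p%:R ^ (n%:Z - l%:Z).

Definition psi (l : nat) : series unit laur -> series unit C :=
  series_subst (laurent_eval (psi_point l)) (fun=> series_var C tt ^+ n).

(* Z(s) as a power series in t = p^-s: the indices are powers of p, and
   (p^k)^-s = t^k. *)
Definition ehrhart_hecke_zeta (l : nat) (P : set 'rV[R]_(n + n)) :
    series unit C :=
  formal_sum [set left_coset g | g in Gplus] (fun X =>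
    let L := row_lattice (invmx (xget 1%:M X)) in
    series_const (ehrhart_coef (rational_lattice L) P l /
                       ehrhart_coef (integer_lattice _) P l)%:C%C *
    series_var C tt ^+ logn p (lattice_index L (std_lattice (n + n)))).
End Hecke.
End Padic.
Arguments HS {p} p_pr n R.
Arguments HSpr {p} p_pr n R.
Arguments hecke_series {p} p_pr n R.
Arguments hecke_series_pr {p} p_pr n R.
Arguments Phi p {n R} f : rename.
Arguments psi p {n R} l f : rename.
Arguments ehrhart_hecke_zeta {p} p_pr {n R} l P.

(* Main.v *)
Require Import Defs.
From HB Require Import structures.
From mathcomp Require Import all_boot all_order all_algebra.
From mathcomp Require Import finmap.
From mathcomp Require Import mathcomp_extra boolp classical_sets functions.
From mathcomp Require Import cardinality fsbigop reals.
From mathcomp Require Import complex.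
From mathcomp.multinomials Require Import monalg.
From mathcomp Require Import perm.
From mathcomp Require Import ring lra zify.
Set Implicit Arguments.
Unset Strict Implicit.
Unset Printing Implicit Defensive.
Import Order.TTheory GRing.Theory Num.Theory.
Local Open Scope classical_set_scope.
Local Open Scope ring_scope.


(** Both equalities are proved coefficient by coefficient, by sorting cosets of
    Gamma = GSp_2n(Z_p) according to lattices.

    The first one holds before psi is applied ([Phi_HSpr]).  A right coset of
    Gamma in G_n^+ whose multiplier has valuation a contains block triangular
    matrices, and the rows of their lower diagonal block D span a sublattice L of
    Z_p^n that contains p^a Z_p^n.  This L determines the Satake monomial
    x_0^a prod_j (p^-j x_j)^delta_j(L) of the coset.  Once D is fixed, the upper
    left block is determined and the upper right one counts modulo symmetric
    shears; by Smith form p^(sum_i (n - i + 1) nu_i) cosets lie over L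
    ([right_cosets_fibre], [card_shear_code]).  So the coefficient of X^a in the
    Hecke series is x_0^a times a weighted sum over the L containing p^a Z_p^n,
    and the factor 1 - x_0 X keeps those for which a is the largest elementary
    divisor exponent nu_n.  These are the L that Phi sends to degree a in X, with
    the same weight: by Abel summation the constants p^binom(i+1,2) multiply to
    the number of cosets over L.  The other primitive factors correspond under
    Phi.

    For the second equality, g |-> p^a g^-1 exchanges left and right cosets of
    multiplier p^a ([coset_inv_bij]).  The lattices attached to the left cosets
    all lie between Z^2n and p^-a Z^2n, and Gamma permutes them.  Since the
    symplectic group is transitive on primitive vectors
    ([symplectic_transitive]), the number of these lattices that contain a vector
    x depends on the denominator p^j of x only, and can be computed with p^-j
    times the last basis vector.  If K(X) is the largest exponent j for which that
    vector lies in the lattice of X, it follows that on average the lattice of X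
    behaves as p^-K(X) Z^2n ([left_cosets_average]); counting the points of m P
    and comparing coefficients of polynomials in m gives

      sum_X c_l(P, lattice of X) = c_l(P) sum_X p^(l K(X))

    ([ehrhart_average]).  In terms of the right coset that corresponds to X one
    has K(X) = a - delta_n(L) ([coset_depthP]).  But p^(l (a - delta_n(L))) is the
    value of the Satake monomial at the point where psi evaluates, because there
    p^-j x_j is 1 for j < n and p^-l for j = n ([satake_coset_eval]).  The lattice
    of X contains Z_p^2n with index p^(n a) ([left_coset_index]), so that psi maps
    the Hecke series to the zeta function ([psi_hecke_series]); it remains to
    evaluate x_0 and x_0 x_1 ... x_n.

    The existence of the Ehrhart polynomials ([ehrhart_exists]) is proved with
    lexicographically minimal nonnegative representations in terms of the
    vertices, whose supports triangulate the polytope. *)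


(** * Finitely supported sums and formal power series *)

Section FsBig.
Context {R : Type} {idx : R} (op : Monoid.com_law idx).

Lemma fsbig_partition (I J : choiceType) (h : I -> J) (A : set I) (B : set J)
    (F : I -> R) : finite_set A -> finite_set B -> (forall i, A i -> B (h i)) ->
  \big[op/idx]_(i \in A) F i =
  \big[op/idx]_(j \in B) \big[op/idx]_(i \in A `&` [set i | h i = j]) F i.
Proof.
move=> finA finB hAB.
transitivity (\big[op/idx]_(j \in B) \big[op/idx]_(i \in A)
    (if i \in [set i | h i = j] then F i else idx)); last first.
  by apply: eq_fsbigr => j _; rewrite fsbig_mkcondr.
rewrite exchange_fsbig//; apply: eq_fsbigr => i; rewrite inE => Ai.
rewrite -(@fsbig_widen _ _ _ _ [set h i])//.
- by rewrite fsbig_set1 mem_set.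
- by move=> j ->; exact: hAB.
- by move=> j /= [_ nj]; rewrite memNset//= => hij; exact: nj.
Qed.

Lemma fsbig_single (T : choiceType) (x : T) (A : set T) (F : T -> R) :
  A x -> (forall y, A y -> y <> x -> F y = idx) -> \big[op/idx]_(y \in A) F y = F x.
Proof.
move=> Ax F0; rewrite -(@fsbig_widen _ _ _ _ [set x]) ?fsbig_set1//.
  by move=> y ->.
by move=> y /= [Ay yx]; exact: F0.
Qed.
End FsBig.

Lemma fsbig_const_bij (V : nmodType) (T : finType) (J : choiceType) (f : T -> J) Q (w : V) :
  set_bij setT Q f -> \sum_(j \in Q) w = w *+ #|T|.
Proof.
move=> fQ; rewrite (reindex_fsbig f setT Q)//.
rewrite (fsbigE (enum T)) ?enum_uniq//; last by move=> i _; rewrite mem_enum.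
rewrite big_mkcond/= (eq_bigr (fun=> w)) => [|i _]; last by rewrite mem_set.
by rewrite big_enum sumr_const.
Qed.

Section SeriesTheory.
Variables (I : finType) (S : comNzRingType).
Local Notation ser := (series I S).
Implicit Types (f g : ser) (u v m : {ffun I -> nat}) (c d : S).

Lemma series_mulE f g m : (f * g) m =
  \sum_(uv \in [set uv : {ffun I -> nat} * {ffun I -> nat} | uv.1 + uv.2 = m])
    f uv.1 * g uv.2.
Proof. by []. Qed.

Lemma ffun_addI u v v' : u + v = u + v' -> v = v'.
Proof.
move=> /ffunP uvv'; apply/ffunP => i; have := uvv' i.
by rewrite !ffunE => /addnI.
Qed.

Lemma series_mono_mulD c u f m : (series_mono c u * f : ser) (u + m) = c * f m.
Proof.
rewrite series_mulE (@fsbig_single _ _ _ _ (u, m))//=.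
  by rewrite /series_mono eqxx mulr1n.
move=> [a b] /= abm /eqP abn; rewrite /series_mono; case: eqP => [au|_].
  by move: abm abn; rewrite au => /ffun_addI ->; rewrite eqxx.
by rewrite mulr0n mul0r.
Qed.

Lemma series_mono_mul0 c u f m : (forall v, u + v <> m) ->
  (series_mono c u * f : ser) m = 0.
Proof.
move=> um; rewrite series_mulE fsbig1// => -[a b] /= abm.
rewrite /series_mono; case: eqP => [au|_]; last by rewrite mulr0n mul0r.
by case: (um b); rewrite -au.
Qed.

Lemma series_mono_mul c d u v :
  series_mono c u * series_mono d v = series_mono (c * d) (u + v) :> ser.
Proof.
apply/funext => m; have [[w <-]|uw] := pselect (exists w, u + w = m).
  rewrite series_mono_mulD /series_mono mulrnAr; congr (_ *+ _); congr nat_of_bool.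
  by apply/eqP/eqP => [->//|/ffun_addI].
rewrite series_mono_mul0; last by move=> w uwm; apply: uw; exists w.
rewrite /series_mono; case: eqP => // muv; case: uw; exists v; exact/esym.
Qed.

Lemma series_mono_exp c u k :
  series_mono c u ^+ k = series_mono (c ^+ k) (u *+ k) :> ser.
Proof.
elim: k => [|k IHk]; first by rewrite !expr0 mulr0n.
by rewrite !exprS IHk series_mono_mul mulrS.
Qed.

Lemma series_mono_prod (T : Type) (r : seq T) (P : pred T) (c : T -> S)
    (u : T -> {ffun I -> nat}) :
  \prod_(i <- r | P i) series_mono (c i) (u i) =
  series_mono (\prod_(i <- r | P i) c i) (\sum_(i <- r | P i) u i) :> ser.
Proof.
elim/big_rec3: _ => [|i c' u' s _ ->]; first by [].
by rewrite series_mono_mul.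
Qed.

Lemma series_constE c : series_const c = series_mono c 0 :> ser.
Proof. by []. Qed.

Lemma series_varE i : series_var S i = series_mono 1 [ffun j => nat_of_bool (j == i)] :> ser.
Proof. by []. Qed.

Lemma seriesD f g m : (f + g) m = f m + g m. Proof. by []. Qed.
Lemma seriesN f m : (- f) m = - f m. Proof. by []. Qed.

End SeriesTheory.

Notation deg1 k := ([ffun=> k] : {ffun unit -> nat}).

Section OneVariable.
Variable S : comNzRingType.
Implicit Types (f g : series unit S) (c : S).

Lemma deg1E (m : {ffun unit -> nat}) : m = deg1 (m tt).
Proof. by apply/ffunP => -[]; rewrite ffunE. Qed.

Lemma deg1D a b : deg1 a + deg1 b = deg1 (a + b)%N.
Proof. by apply/ffunP => x; rewrite !ffunE. Qed.

Lemma deg1_inj a b : deg1 a = deg1 b -> a = b.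
Proof. by move=> /ffunP/(_ tt); rewrite !ffunE. Qed.

Lemma deg1_eq a b : (deg1 a == deg1 b) = (a == b).
Proof. by apply/eqP/eqP => [/deg1_inj|->]. Qed.

Lemma series1P f g : (forall k, f (deg1 k) = g (deg1 k)) -> f = g.
Proof. by move=> fg; apply/funext => m; rewrite [m]deg1E. Qed.

Lemma series1_exp c k :
  series_const c * series_var S tt ^+ k = series_mono c (deg1 k).
Proof.
rewrite series_varE series_constE series_mono_exp series_mono_mul expr1n mulr1.
congr (series_mono _ _); rewrite add0r; apply/ffunP => -[].
rewrite ffunE; elim: k => [|k IHk]; first by rewrite mulr0n ffunE.
by rewrite mulrS ffunE IHk ffunE eqxx.
Qed.

Lemma series1_mono c k j : series_mono c (deg1 k) (deg1 j) = c *+ (j == k).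
Proof. by rewrite /series_mono deg1_eq. Qed.

Lemma series1_mul c k f j : (series_mono c (deg1 k) * f) (deg1 j) =
  if (k <= j)%N then c * f (deg1 (j - k)%N) else 0.
Proof.
case: ifP => kj; first by rewrite -{1}(subnKC kj) -deg1D series_mono_mulD.
apply: series_mono_mul0 => v; rewrite [v]deg1E deg1D => /deg1_inj jE.
by move: kj; rewrite -jE leq_addr.
Qed.

Lemma series1_linear_mul c f j :
  ((1 - series_const c * series_var S tt) * f) (deg1 j) =
  f (deg1 j) - (if j is j'.+1 then c * f (deg1 j') else 0).
Proof.
rewrite mulrBl mul1r -[series_var S tt]expr1 series1_exp seriesD seriesN series1_mul.
by case: j => [|j] //; rewrite ltnS leq0n subSS subn0.
Qed.

Lemma series1_linear_mul2 c d f :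
  (1 - series_const c * series_var S tt) * (1 - series_const d * series_var S tt) * f =
  (1 - series_const d * series_var S tt) * ((1 - series_const c * series_var S tt) * f).
Proof. by rewrite mulrAC mulrC. Qed.
End OneVariable.

Section LaurentEval.
Variables (N : nat) (S : fieldType) (a : 'I_N -> S).
Hypothesis a_neq0 : forall i, a i != 0.
Local Notation L := (laurent N S).
Local Notation ev := (laurent_eval a).
Local Notation mon k := (\prod_i a i ^ (k : {ffun 'I_N -> int}) i).

Lemma laurent_eval_is_additive : {morph ev : x y / x + y >-> x + y}.
Proof. by move=> x y; rewrite /laurent_eval raddfD. Qed.

Lemma laurent_eval0 : ev 0 = 0.
Proof. exact: mmap0. Qed.

Lemma laurent_evalN x : ev (- x) = - ev x.
Proof. by rewrite /laurent_eval raddfN. Qed.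

Lemma laurent_evalU c k : ev << c *g k >> = c * mon k.
Proof. by rewrite /laurent_eval mmapU. Qed.

Lemma laurent_mulE (x y : L) : x * y = \sum_(k1 <- msupp x) \sum_(k2 <- msupp y)
  << x@_k1 * y@_k2 *g (k1 + k2)%R >>.
Proof. by []. Qed.

Lemma laurent_evalM : {morph ev : x y / x * y >-> x * y}.
Proof.
move=> x y; rewrite laurent_mulE.
rewrite (big_morph ev laurent_eval_is_additive laurent_eval0).
rewrite {2}/laurent_eval mmapE mulr_suml; apply: eq_bigr => k1 _.
rewrite (big_morph ev laurent_eval_is_additive laurent_eval0).
rewrite /laurent_eval mmapE mulr_sumr; apply: eq_bigr => k2 _.
rewrite mmapU /= mulrACA; congr (_ * _); rewrite -big_split/=.
by apply: eq_bigr => i _; rewrite ffunE expfzDr.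
Qed.

Lemma laurent_eval_const (c : S) : ev (laurent_const N c) = c.
Proof.
by rewrite laurent_evalU big1 ?mulr1// => i _; rewrite ffunE expr0z.
Qed.

Lemma laurent_eval1 : ev 1 = 1.
Proof. exact: laurent_eval_const. Qed.

Lemma laurent_eval_var i : ev (laurent_var S i) = a i.
Proof.
rewrite laurent_evalU mul1r (bigD1 i)//= ffunE eqxx expr1z.
by rewrite big1 ?mulr1// => j /negPf ji; rewrite ffunE ji expr0z.
Qed.

Lemma laurent_evalX x k : ev (x ^+ k) = ev x ^+ k.
Proof.
by elim: k => [|k IHk]; rewrite ?laurent_eval1// !exprS laurent_evalM IHk.
Qed.

Lemma laurent_eval_prod (T : Type) (r : seq T) (P : pred T) (F : T -> L) :
  ev (\prod_(i <- r | P i) F i) = \prod_(i <- r | P i) ev (F i).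
Proof. exact: (big_morph ev laurent_evalM laurent_eval1). Qed.

Lemma laurent_eval_sum (T : Type) (r : seq T) (P : pred T) (F : T -> L) :
  ev (\sum_(i <- r | P i) F i) = \sum_(i <- r | P i) ev (F i).
Proof. exact: (big_morph ev laurent_eval_is_additive laurent_eval0). Qed.

Lemma laurent_constM (c d : S) :
  laurent_const N (c * d) = laurent_const N c * laurent_const N d.
Proof.
rewrite laurent_mulE /laurent_const.
have [->|c0] := eqVneq c 0; first by rewrite mul0r monalgU0 msupp0 big_seq_fset0.
have [->|d0] := eqVneq d 0.
  rewrite mulr0 monalgU0 big1// => k _; rewrite msupp0 big_seq_fset0//.
by rewrite !msuppU (negPf c0) (negPf d0) !big_seq_fset1 !mcoeffUU addr0.
Qed.

Lemma laurent_constX (c : S) k : laurent_const N (c ^+ k) = laurent_const N c ^+ k.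
Proof. by elim: k => // k IHk; rewrite !exprS laurent_constM IHk. Qed.

End LaurentEval.

Section Psi.
Variables (p : nat) (p_gt0 : (0 < p)%N) (R : realType) (n : nat) (l : nat).
Hypothesis n_gt0 : (0 < n)%N.
Local Notation C := R[i].
Local Notation L := (laurent n.+1 C).
Local Notation ev := (laurent_eval (@psi_point p n R l)).
Implicit Types f g : series unit L.

Lemma psi_point_neq0 (i : 'I_n.+1) : psi_point p R l i != 0.
Proof.
have p0 : p%:R != 0 :> C by rewrite pnatr_eq0 -lt0n.
by rewrite /psi_point; do 2?case: ifP => _; rewrite ?expf_neq0 ?expfz_neq0.
Qed.

Lemma psiE f k : psi p l f (deg1 k) = \sum_(j \in [set: nat]) ev (f (deg1 j)) *+ (k == n * j)%N.
Proof.
rewrite /psi /series_subst /formal_sum.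
rewrite (@reindex_fsbigT _ _ _ nat _ (fun j => deg1 j)).
  apply: eq_fsbigr => j _; rewrite (bigD1 tt)//= big1 ?mulr1; last by case.
  by rewrite ffunE -exprM series1_exp series1_mono.
exists (fun m : {ffun unit -> nat} => m tt) => [j|m]; first by rewrite ffunE.
by rewrite -deg1E.
Qed.

Lemma psi_coef f k : psi p l f (deg1 (n * k)%N) = ev (f (deg1 k)).
Proof.
rewrite psiE (@fsbig_single _ _ _ _ k)//= ?eqxx ?mulr1n// => j _ jk.
by rewrite eqn_mul2l -[_ == 0]negbK -lt0n n_gt0/=; case: eqP => // kj; case: jk.
Qed.

Lemma psi_coef0 f k : ~~ (n %| k)%N -> psi p l f (deg1 k) = 0.
Proof.
move=> nk; rewrite psiE fsbig1// => j _; case: eqP => // kE.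
by move: nk; rewrite kE dvdn_mulr.
Qed.

Lemma psiD f g : psi p l (f + g) = psi p l f + psi p l g.
Proof.
apply: series1P => k; rewrite seriesD; have [/dvdnP[j ->]|nk] := boolP (n %| k)%N.
  by rewrite mulnC !psi_coef seriesD laurent_eval_is_additive.
by rewrite !psi_coef0 ?addr0.
Qed.

Lemma psiN f : psi p l (- f) = - psi p l f.
Proof.
apply: series1P => k; rewrite seriesN; have [/dvdnP[j ->]|nk] := boolP (n %| k)%N.
  by rewrite mulnC !psi_coef seriesN laurent_evalN.
by rewrite !psi_coef0 ?oppr0.
Qed.

Lemma psi_mono_mul c k f :
  psi p l (series_mono c (deg1 k) * f) = series_mono (ev c) (deg1 (n * k)%N) * psi p l f.
Proof.
apply: series1P => j; rewrite series1_mul.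
have [/dvdnP[i ->]|nk] := boolP (n %| j)%N.
  rewrite mulnC psi_coef series1_mul leq_pmul2l// -mulnBr psi_coef.
  by case: ifP => _; rewrite ?laurent_eval0// (laurent_evalM psi_point_neq0).
rewrite psi_coef0//; case: ifP => // kj; rewrite psi_coef0 ?mulr0//.
by apply: contra nk => nk; rewrite -(subnK kj) dvdn_add// dvdn_mulr.
Qed.
End Psi.

(** * The ring of p-adic integers *)

Lemma Posz_exp (a k : nat) : (a ^ k)%N%:Z = a%:Z ^+ k.
Proof. by rewrite -!natz natrX. Qed.

Section PadicInt.
Variables (p : nat) (p_pr : prime p).
Local Notation Zp := (padic_int p_pr).
Implicit Types x y z : Zp.
Local Notation pp := (p%:R : Zp).

Let p_gt0 : (0 < p)%N. Proof. exact: prime_gt0. Qed.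
Let pk_neq0 k : p%:Z ^+ k != 0.
Proof. by rewrite expf_neq0//= eqz_nat -lt0n. Qed.

Lemma padic_addE x y k : (x + y) k = ((x k + y k) %% p%:Z ^+ k)%Z.
Proof. by []. Qed.
Lemma padic_oppE x k : (- x) k = ((- x k) %% p%:Z ^+ k)%Z.
Proof. by []. Qed.
Lemma padic_mulE x y k : (x * y) k = ((x k * y k) %% p%:Z ^+ k)%Z.
Proof. by []. Qed.

Lemma padic_0E k : (0 : Zp) k = 0.
Proof. exact: mod0z. Qed.

Lemma padic_natE m k : (m%:R : Zp) k = (m%:Z %% p%:Z ^+ k)%Z.
Proof.
elim: m => [|m IHm]; first by [].
by rewrite mulrS padic_addE IHm modzDmr -modzDml modz_mod modzDml.
Qed.

Lemma padic_intE (a : int) k : (a%:~R : Zp) k = (a %% p%:Z ^+ k)%Z.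
Proof.
case: a => m; first exact: padic_natE.
by rewrite NegzE mulrNz padic_oppE -[m.+1%:~R]/(m.+1%:R) padic_natE modzNm.
Qed.

Lemma padic_res_ge0 x k : 0 <= x k.
Proof. by rewrite -padic_mod modz_ge0. Qed.
Lemma padic_res_lt x k : x k < p%:Z ^+ k.
Proof. by rewrite -padic_mod ltz_pmod// exprn_gt0// ltz_nat. Qed.

Lemma padic_dvd_sub x i j : (i <= j)%N -> (p%:Z ^+ i %| x j - x i)%Z.
Proof. by move=> ij; rewrite -eqz_mod_dvd (padic_dvd x ij). Qed.

(** Division by p^k shifts the sequence of residues. *)
Lemma padic_dvd_pk x k : x k = 0 -> exists y, x = y * pp ^+ k.
Proof.
move=> xk0.
have dvk j : (p%:Z ^+ k %| x (j + k)%N)%Z.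
  by rewrite -[x _]subr0 -xk0 padic_dvd_sub ?leq_addl.
pose f j := (x (j + k)%N %/ p%:Z ^+ k)%Z.
have fE j : x (j + k)%N = f j * p%:Z ^+ k by rewrite divzK.
have fP j : (f j.+1 = f j %[mod p%:Z ^+ j])%Z.
  apply/eqP; rewrite eqz_mod_dvd -(@dvdz_mul2r (p%:Z ^+ k)) ?pk_neq0 // mulrBl -!fE -exprD.
  by rewrite addSn padic_dvd_sub.
exists (padic_of p_pr fP); apply/padicP => j.
rewrite padic_mulE -natrX padic_natE /= modzMmr modzMml Posz_exp -fE.
by rewrite (padic_dvd x (leq_addr k j)) padic_mod.
Qed.

Lemma padic_pkE x k : (x * pp ^+ k) k = 0.
Proof. by rewrite padic_mulE -natrX padic_natE modzMmr Posz_exp modzMl. Qed.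

Lemma padic_pk_dvd x k : (exists y, x = y * pp ^+ k) <-> x k = 0.
Proof. by split=> [[y ->]|]; [exact: padic_pkE|exact: padic_dvd_pk]. Qed.

Lemma padic_unitE x : (x \is a GRing.unit) = (x 1%N != 0).
Proof.
apply/idP/idP => [/mulrV xU|/eqP x1].
  apply/eqP => x0.
  have := congr1 (fun y : Zp => y 1%N) xU; rewrite padic_mulE x0 mul0r mod0z.
  rewrite -[1%R]/(1%:R) padic_natE expr1 modz_nat modn_small//.
  exact: prime_gt1.
have cop k : coprimez (x k) (p%:Z ^+ k).
  case: k => [|k]; first by rewrite expr0 coprimezE coprimen1.
  rewrite coprimezE abszX coprime_sym coprimeXl//= prime_coprime//.
  apply/negP => /= dvp; apply: x1; rewrite -padic_mod -(padic_dvd x (_ : 1 <= k.+1)%N)//.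
  by apply/dvdz_mod0P; rewrite expr1.
pose u k := (egcdz (x k) (p%:Z ^+ k)).1.
have uE k : (p%:Z ^+ k %| u k * x k - 1)%Z.
  have := cop k; rewrite /coprimez /u; case: egcdzP => a b <- _ /eqP ab.
  by apply/dvdzP; exists (- b); rewrite -ab /=; ring.
have uP k : (u k.+1 = u k %[mod p%:Z ^+ k])%Z.
  apply/eqP; rewrite eqz_mod_dvd.
  have -> : u k.+1 - u k = - (u k.+1 * (u k * x k - 1)) +
     (u k * ((u k.+1 * x k.+1 - 1) - u k.+1 * (x k.+1 - x k))) by ring.
  rewrite rpredD ?rpredN ?dvdz_mull// rpredB ?dvdz_mull ?padic_dvd_sub//.
  by apply: dvdz_trans (uE _); rewrite dvdz_exp2l.
apply/unitrP; exists (padic_of p_pr uP).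
suff h : padic_of p_pr uP * x = 1 by split=> //; rewrite mulrC.
apply/padicP => k; rewrite padic_mulE modzMml -[1]/(1%:R) padic_natE.
by apply/eqP; rewrite eqz_mod_dvd.
Qed.

Lemma padic_p_neq0 : pp != 0.
Proof.
apply/eqP => /(congr1 (fun y : Zp => y 2%N)).
rewrite padic_natE padic_0E -Posz_exp modz_nat modn_small; last first.
  by rewrite -[X in (X < _)%N]expn1 ltn_exp2l// prime_gt1.
by move=> [p0]; move: p_gt0; rewrite p0.
Qed.

Lemma padic_pk_neq0 k : pp ^+ k != 0.
Proof. by rewrite expf_neq0 ?padic_p_neq0. Qed.

Lemma padic_unit_pk_neq0 u k : u \is a GRing.unit -> u * pp ^+ k != 0.
Proof.
move=> uU; rewrite mulf_neq0 ?padic_pk_neq0//.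
by apply: contraTneq uU => ->; rewrite unitr0.
Qed.

Lemma padic_p_nonunit : (pp \is a GRing.unit) = false.
Proof. by rewrite padic_unitE padic_natE expr1 modzz eqxx. Qed.

Lemma padic_pk_unit k : (pp ^+ k \is a GRing.unit) = (k == 0%N).
Proof.
by case: k => [|k]; rewrite ?unitr1// unitrX_pos ?padic_p_nonunit.
Qed.

(** The exponent is the last index at which the residue of x vanishes. *)
Lemma padic_unit_pk x : x != 0 ->
  exists k u, u \is a GRing.unit /\ x = u * pp ^+ k.
Proof.
move=> x0; have xk : exists k, x k != 0.
  have [k xk] := padic_neq0 x0; exists k.
  by apply: contraNneq xk => ->; exact: dvdz0.
have [[|k] xk1 kmin] := ex_minnP xk.
  by move: xk1; rewrite -padic_mod expr0 modz1 eqxx.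
have xk0 : x k = 0.
  by apply/eqP; apply/negPn/negP => /kmin; rewrite ltnn.
have [u xE] := padic_dvd_pk xk0; exists k, u; split=> //.
rewrite padic_unitE; apply/negP => /eqP u1.
have [v uE] := padic_dvd_pk u1; move: xk1.
by rewrite xE uE -mulrA -exprD add1n padic_pkE eqxx.
Qed.

Lemma padic_unit_pk_inj u v i j : u \is a GRing.unit -> v \is a GRing.unit ->
  u * pp ^+ i = v * pp ^+ j -> i = j.
Proof.
wlog ij : u v i j / (i <= j)%N => [h uU vU e|uU vU].
  have /orP[ij|ji] := leq_total i j; first exact: (h u v).
  by apply/esym; apply: (h v u).
rewrite -(subnK ij) exprD mulrA => /(mulIf (padic_pk_neq0 i)) uE.
move: uU; rewrite uE unitrM => /andP[_]; rewrite padic_pk_unit => /eqP ->.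
by rewrite add0n.
Qed.

Lemma padic_pk_dvd_unit u i j : u \is a GRing.unit ->
  (exists y, u * pp ^+ i = y * pp ^+ j) -> (j <= i)%N.
Proof.
move=> uU [y e]; rewrite leqNgt; apply/negP => ij.
move: e; rewrite -(subnK (ltnW ij)) exprD mulrA => /(mulIf (padic_pk_neq0 i)) uE.
move: uU; rewrite uE unitrM padic_pk_unit subn_eq0 leqNgt ij.
by rewrite andbF.
Qed.

Lemma padic_int_dvd (a : int) k :
  (exists y, a%:~R = y * pp ^+ k) <-> (p%:Z ^+ k %| a)%Z.
Proof.
rewrite padic_pk_dvd padic_intE; split=> [/dvdz_mod0P//|h].
exact/dvdz_mod0P.
Qed.

Lemma padic_nat_eq (a b : nat) k : (a < p ^ k)%N -> (b < p ^ k)%N ->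
  (exists y, a%:R - b%:R = y * pp ^+ k) -> a = b.
Proof.
move=> ak bk; rewrite -[_ - _]/((a%:~R - b%:~R) : Zp) -rmorphB/= => /padic_int_dvd.
by rewrite -eqz_mod_dvd -Posz_exp !modz_nat !modn_small// => /eqP[].
Qed.

Definition padic_resn x k : nat := `|x k|%N.

Lemma padic_resn_lt x k : (padic_resn x k < p ^ k)%N.
Proof.
by rewrite -ltz_nat gez0_abs ?padic_res_ge0// Posz_exp padic_res_lt.
Qed.

Lemma padic_resnP x k : exists y, x = (padic_resn x k)%:R + y * pp ^+ k.
Proof.
have [y yE] : exists y, x - (padic_resn x k)%:R = y * pp ^+ k.
  apply/padic_pk_dvd; rewrite padic_addE padic_oppE padic_natE.
  rewrite gez0_abs ?padic_res_ge0// modzDmr.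
  by rewrite -modzDmr modzNm modzDmr subrr mod0z.
by exists y; rewrite -yE addrC subrK.
Qed.

Lemma padic_unitD x y : x \is a GRing.unit -> y \isn't a GRing.unit ->
  x + y \is a GRing.unit.
Proof.
rewrite !padic_unitE negbK => x1 /eqP y1.
by rewrite padic_addE y1 addr0 padic_mod.
Qed.

Lemma padic_int_eq0 (a : int) : ((a%:~R : Zp) == 0) = (a == 0).
Proof.
apply/eqP/eqP => [a0|->//]; apply/eqP; rewrite -absz_eq0; apply/negPn/negP => an0.
have : (p%:Z ^+ `|a|%N %| a)%Z by apply/padic_int_dvd; exists 0; rewrite a0 mul0r.
rewrite dvdzE abszX /= => /dvdn_leq; rewrite lt0n => /(_ an0).
by rewrite leqNgt ltn_expl// prime_gt1.
Qed.

End PadicInt.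

(** * Matrices and lattices over the p-adic integers *)

Lemma block_mx_congr (T : Type) m1 m2 n1 n2 (A A' : 'M[T]_(m1, n1))
    (B B' : 'M[T]_(m1, n2)) (C C' : 'M[T]_(m2, n1)) (D D' : 'M[T]_(m2, n2)) :
  A = A' -> B = B' -> C = C' -> D = D' -> block_mx A B C D = block_mx A' B' C' D'.
Proof. by move=> -> -> -> ->. Qed.

(** The inverse of one step of elimination with pivot a: the entries of the first
    row and column are multiples of the pivot, and D is what remains after division
    by it. *)
Lemma smith_step (K : comUnitRingType) m n (a b : K) (r : 'M[K]_(1, n))
    (c : 'M[K]_(m, 1)) (L : 'M[K]_m) (R : 'M[K]_n) (D : 'M[K]_(m, n)) :
  block_mx b%:M 0 c L *m block_mx a%:M 0 0 (a *: D) *m block_mx 1%:M r 0 R =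
  a *: block_mx b%:M (b *: r) c (c *m r + L *m D *m R).
Proof.
rewrite !mulmx_block !(mulmx0, mul0mx, addr0, add0r) scale_block_mx.
apply: block_mx_congr.
- by rewrite mulmx1 -scalar_mxM mulrC scale_scalar_mx.
- by rewrite -scalar_mxM mul_scalar_mx scalerA mulrC.
- by rewrite mulmx1 mul_mx_scalar.
- by rewrite mul_mx_scalar -scalemxAl -scalemxAr -scalemxAl scalerDr.
Qed.

Section Smith.
Variables (p : nat) (p_pr : prime p).
Local Notation Zp := (padic_int p_pr).
Local Notation pp := (p%:R : Zp).

Definition diag_rect m n (d : nat -> Zp) : 'M[Zp]_(m, n) :=
  \matrix_(i, j) (d i *+ (i == j :> nat)).

Definition smith_form m n (A : 'M[Zp]_(m, n)) (L : 'M[Zp]_m) (R : 'M[Zp]_n) (d : nat -> Zp) :=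
  [/\ L \in unitmx, R \in unitmx, A = L *m diag_rect m n d *m R &
   forall i, (d i = 0 \/ exists k, d i = pp ^+ k) /\ exists z, d i.+1 = z * d i].

Lemma smith_form_mul m n (A : 'M[Zp]_(m, n)) U V L R d :
  U \in unitmx -> V \in unitmx -> smith_form A L R d ->
  smith_form (U *m A *m V) (U *m L) (R *m V) d.
Proof.
move=> uU uV [uL uR -> dP]; split=> //; first by rewrite unitmx_mul uU.
  by rewrite unitmx_mul uR.
by rewrite !mulmxA.
Qed.

(** An entry of least valuation divides all the others. *)
Lemma padic_pivot m n (A : 'M[Zp]_(m, n)) : A != 0 ->
  exists k B i j, A = pp ^+ k *: B /\ B i j \is a GRing.unit.
Proof.
move=> A0; pose P k := `[< exists i j u, u \is a GRing.unit /\ A i j = u * pp ^+ k >].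
have /ex_minnP[k /asboolP[i [j [u [uU Aij]]]] kmin] : exists k, P k.
  have [i [j Aij]] : exists i j, A i j != 0.
    apply: contrapT => h; move: A0; apply/negP/negPn/eqP/matrixP => i j.
    by rewrite mxE; apply/eqP/negPn/negP => Aij; apply: h; exists i, j.
  have [k [u [uU uE]]] := padic_unit_pk Aij.
  by exists k; apply/asboolP; exists i, j, u.
have dv i' j' : exists b, A i' j' = b * pp ^+ k.
  have [->|/padic_unit_pk[k' [u' [uU' AE]]]] := eqVneq (A i' j') 0.
    by exists 0; rewrite mul0r.
  have kk' : (k <= k')%N by apply: kmin; apply/asboolP; exists i', j', u'.
  by exists (u' * pp ^+ (k' - k)); rewrite -mulrA -exprD subnK.
have dv' (ij : 'I_m * 'I_n) : exists b, A ij.1 ij.2 = b * pp ^+ k by exact: dv.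
have [b bE] := choice dv'.
exists k, (\matrix_(i, j) b (i, j)), i, j; split.
  by apply/matrixP => i' j'; rewrite !mxE (bE (i', j')) mulrC.
rewrite mxE; have := bE (i, j); rewrite /= Aij => /(mulIf (padic_pk_neq0 p_pr k)).
by move=> <-.
Qed.

(** Elimination with a pivot of least valuation.  The pivot is divided out of the
    remaining block, which makes each diagonal entry divide the next one. *)
Lemma padic_smith m n (A : 'M[Zp]_(m, n)) : exists L R d, smith_form A L R d.
Proof.
elim: m n A => [|m IHm] n A.
  exists 1%:M, 1%:M, (fun=> 0); split; rewrite ?unitmx1//.
    by apply/matrixP => -[].
  by move=> i; split; [left|exists 0; rewrite mul0r].
have [->|/padic_pivot[k [B [i [j [-> Bij]]]]]] := eqVneq A 0.
  exists 1%:M, 1%:M, (fun=> 0); split; rewrite ?unitmx1//.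
    rewrite mulmx1 mul1mx; apply/matrixP => i j.
    by rewrite !mxE mul0rn.
  by move=> i; split; [left|exists 0; rewrite mul0r].
case: n B j Bij {A} => [|n] B j Bij; first by case: j {Bij}.
(* Exchanging rows and columns brings the pivot to the corner. *)
wlog [i0 j0] : B i j Bij / i = 0 /\ j = 0 => [IH|].
  have /(_ _)[|//|L [R [d LRd]]] := IH (xrow i 0 (xcol j 0 B)) 0 0.
    by rewrite !mxE !tpermR.
  have -> : pp ^+ k *: B =
      tperm_mx i 0 *m (pp ^+ k *: xrow i 0 (xcol j 0 B)) *m tperm_mx j 0.
    rewrite -scalemxAr -scalemxAl xrowE xcolE !mulmxA -!perm_mxM tperm2 perm_mx1 mul1mx.
    by rewrite -mulmxA -perm_mxM tperm2 perm_mx1 mulmx1.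
  have LRd' := smith_form_mul (unitmx_perm _ (tperm i 0)) (unitmx_perm _ (tperm j 0)) LRd.
  by do 3!eexists; exact: LRd'.
rewrite {}i0 {}j0 in Bij.
pose b := B 0 0.
pose r : 'M[Zp]_(1, n) := b^-1 *: @ursubmx _ 1 m 1 n B.
pose c : 'M[Zp]_(m, 1) := @dlsubmx _ 1 m 1 n B.
pose B' : 'M[Zp]_(m, n) := @drsubmx _ 1 m 1 n B - c *m r.
have [L [R [d [uL uR B'E dP]]]] := IHm n B'.
pose U : 'M[Zp]_(1 + m) := block_mx b%:M 0 c L.
pose V : 'M[Zp]_(1 + n) := block_mx 1%:M r 0 R.
pose d' i := if i is i'.+1 then pp ^+ k * d i' else pp ^+ k.
have DE : diag_rect (1 + m) (1 + n) d' = block_mx (pp ^+ k)%:M 0 0 (pp ^+ k *: diag_rect m n d).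
  rewrite -[LHS]submxK; congr (block_mx _ _ _ _); apply/matrixP => x y;
    rewrite !mxE ?ord1//= ?mulr1n//.
  by rewrite mulrnAr.
have BE : B = block_mx b%:M (b *: r) c (@drsubmx _ 1 m 1 n B).
  apply: (etrans (esym (@submxK Zp 1 m 1 n B))); apply: block_mx_congr => //.
    apply/matrixP => x y; rewrite !ord1 !mxE eqxx mulr1n /b.
    by congr (B _ _); apply/val_inj.
  by rewrite /r scalerA mulrV// scale1r.
exists U, V, d'; split.
- have dU : \det U = \det (b%:M : 'M_1) * \det L by exact: det_lblock.
  by rewrite unitmxE [\det _]dU det_scalar1 unitrM Bij -unitmxE.
- have dV : \det V = \det (1%:M : 'M_1) * \det R by exact: det_ublock.
  by rewrite unitmxE [\det _]dV det1 mul1r -unitmxE.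
- transitivity (U *m diag_rect (1 + m) (1 + n) d' *m V); last by [].
  rewrite DE /U /V smith_step -B'E /B' [c *m r + _]addrC subrK.
  by congr (_ *: _); exact: BE.
- case=> [|i1] /=.
    split; first by right; exists k.
    by exists (d 0%N); rewrite mulrC.
  have [dk [z zE]] := dP i1; split; last by exists z; rewrite zE mulrCA.
  by case: dk => [->|[k' ->]]; [left; rewrite mulr0|right; exists (k + k')%N; rewrite exprD].
Qed.

(** The last rows of L^-1, for a Smith form Q = L S R, kill Q; they span a direct
    summand because L^-1 is invertible. *)
Lemma padic_left_kernel m n (Q : 'M[Zp]_(n + m, n)) :
  exists (W : 'M[Zp]_(m, n + m)) (X : 'M[Zp]_(n + m, m)), W *m Q = 0 /\ W *m X = 1%:M.
Proof.
have [L [R [d [uL uR QE _]]]] := padic_smith Q.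
exists (dsubmx (invmx L)), (rsubmx L); split.
  rewrite mul_dsub_mx QE !mulmxA mulVmx// mul1mx -mul_dsub_mx.
  rewrite (_ : dsubmx _ = 0) ?mul0mx//; apply/matrixP => i j.
  rewrite !mxE /=; case: eqP => // e; have := ltn_ord j.
  by rewrite -e ltnNge leq_addr.
have : col_mx (usubmx (invmx L)) (dsubmx (invmx L)) *m row_mx (lsubmx L) (rsubmx L) = 1%:M.
  by rewrite vsubmxK hsubmxK mulVmx.
by rewrite mul_col_row scalar_mx_block => /eq_block_mx[].
Qed.

(** No diagonal entry vanishes, and divisibility of consecutive entries sorts the
    exponents. *)
Lemma padic_smith_square n (D : 'M[Zp]_n) : \det D != 0 ->
  exists L R (nu : n.-tuple nat), [/\ L \in unitmx, R \in unitmx, sorted leq nu &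
    D = L *m diag_mx (\row_i pp ^+ tnth nu i) *m R].
Proof.
have [L [R [d [uL uR DE dP]]]] := padic_smith D => D0.
have DdE : diag_rect n n d = diag_mx (\row_i d i).
  by apply/matrixP => i j; rewrite !mxE.
have d0 (i : 'I_n) : d i != 0.
  apply: contraNneq D0 => di; rewrite DE !det_mulmx DdE det_diag (bigD1 i)//=.
  by rewrite mxE di mul0r mulr0 mul0r.
have /choice[nu nuE] (i : 'I_n) : exists k, d i = pp ^+ k.
  have [[di|//]] := dP i; by move: (d0 i); rewrite di eqxx.
exists L, R, [tuple nu i | i < n]; split=> //; last first.
  rewrite DE DdE; congr (_ *m _ *m _); congr diag_mx; apply/rowP => i.
  by rewrite !mxE tnth_mktuple nuE.
have nuS (i : nat) (i1 : (i.+1 < n)%N) : (nu (Ordinal (ltnW i1)) <= nu (Ordinal i1))%N.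
  have [_ [z]] := dP i; rewrite (nuE (Ordinal i1)) (nuE (Ordinal (ltnW i1))) => e.
  apply: (@padic_pk_dvd_unit _ p_pr 1); first exact: unitr1.
  by exists z; rewrite mul1r.
apply/(sortedP 0%N) => i; rewrite size_tuple => i1.
have nthE j (j1 : (j < n)%N) : nth 0%N [tuple nu i | i < n] j = nu (Ordinal j1).
  by rewrite -[j]/(nat_of_ord (Ordinal j1)) -tnth_nth tnth_mktuple.
by rewrite (nthE _ i1) (nthE _ (ltnW i1)) nuS.
Qed.
End Smith.

Section Sublattices.
Variables (p : nat) (p_pr : prime p).
Local Notation Zp := (padic_int p_pr).
Local Notation pp := (p%:R : Zp).
Variable n : nat.
Implicit Types L : set 'rV[Zp]_n.

Definition submodule L := L 0 /\ forall (a : Zp) u v, L u -> L v -> L (a *: u + v).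

Definition row_span (A : 'M[Zp]_n) : set 'rV[Zp]_n :=
  range (fun v : 'rV[Zp]_n => v *m A).

Lemma submoduleZ L a u : submodule L -> L u -> L (a *: u).
Proof. by move=> [L0 LS] Lu; have := LS a u 0 Lu L0; rewrite addr0. Qed.

Lemma submoduleD L u v : submodule L -> L u -> L v -> L (u + v).
Proof. by move=> [L0 LS] Lu Lv; have := LS 1 u v Lu Lv; rewrite scale1r. Qed.

Lemma submoduleB L u v : submodule L -> L u -> L v -> L (u - v).
Proof.
by move=> LS Lu Lv; rewrite addrC -scaleN1r; case: LS => _; apply.
Qed.

Lemma submodule_sum L (I : Type) (r : seq I) (P : pred I) (F : I -> 'rV[Zp]_n) :
  submodule L -> (forall i, P i -> L (F i)) -> L (\sum_(i <- r | P i) F i).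
Proof.
move=> LS LF; elim/big_ind: _ => //; first by case: LS.
by move=> u v; exact: submoduleD.
Qed.

Lemma row_span_submodule A : submodule (row_span A).
Proof.
split; first by exists 0; rewrite ?mul0mx.
move=> a _ _ [u _ <-] [v _ <-]; exists (a *: u + v) => //.
by rewrite mulmxDl scalemxAl.
Qed.

Lemma row_span_sub A B : row_span A `<=` row_span B -> exists U, A = U *m B.
Proof.
move=> AB; have rowAB i : exists u : 'rV_n, row i A = u *m B.
  have /AB[u _ uE] : row_span A (row i A) by exists (delta_mx 0 i); rewrite -?rowE.
  by exists u.
have [U UE] := choice rowAB; exists (\matrix_i U i).
by apply/row_matrixP => i; rewrite UE row_mul rowK.
Qed.

Lemma row_span_eq A B : \det A != 0 -> row_span A = row_span B ->
  exists2 U, U \in unitmx & A = U *m B.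
Proof.
move=> A0 AB; have [U UE] : exists U, A = U *m B by apply: row_span_sub; rewrite AB.
have [V VE] : exists V, B = V *m A by apply: row_span_sub; rewrite AB.
exists U => //; have := congr1 determinant UE; rewrite VE !det_mulmx mulrA => e.
have {}e : \det U * \det V = 1 by apply: (mulIf A0); rewrite mul1r -e.
by rewrite unitmxE; apply/unitrPr; exists (\det V).
Qed.

Lemma finite_index_submodule L : finite_index_sublattice L -> submodule L.
Proof. by case. Qed.

(** By the pigeonhole principle p^a e and p^b e lie in one coset for some a < b, and
    1 - p^(b - a) is a unit. *)
Lemma finite_index_pk L : finite_index_sublattice L ->
  exists k, forall v, L (pp ^+ k *: v).
Proof.
move=> Lfin; have LS := finite_index_submodule Lfin; case: Lfin => L0 _ Lfin.
have ki (i : 'I_n) : exists k, L (pp ^+ k *: delta_mx 0 i).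
  pose e : 'rV[Zp]_n := delta_mx 0 i.
  pose f k : set 'rV[Zp]_n := [set pp ^+ k *: e + w | w in L].
  (* Otherwise the cosets of the p^k e would be pairwise different. *)
  have [a [b [ab fab]]] : exists a b, (a < b)%N /\ f a = f b.
    apply: contrapT => fN; have finj : injective f.
      move=> a b fab; case: (ltngtP a b) => // ab; case: fN.
        by exists a, b.
      by exists b, a.
    apply: infinite_nat; rewrite -(@preimage_range _ _ f).
    apply: finite_preimage; first by move=> x y _ _; exact: finj.
    by apply: sub_finite_set Lfin => _ [k _ <-]; exists (pp ^+ k *: e).
  exists a; have : f a (pp ^+ a *: e) by exists 0; rewrite ?addr0.
  rewrite fab => -[w Lw wE].
  have uU : 1 - pp ^+ (b - a) \is a GRing.unit.
    by rewrite padic_unitD ?unitr1// unitrN padic_pk_unit subn_eq0 -ltnNge.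
  have {}wE : w = (1 - pp ^+ (b - a)) *: (pp ^+ a *: e).
    rewrite scalerA mulrBl mul1r -exprD subnK ?(ltnW ab)// scalerBl -wE.
    by rewrite addrC addKr.
  have -> : pp ^+ a *: e = (1 - pp ^+ (b - a))^-1 *: w.
    by rewrite wE scalerA mulVr// scale1r.
  exact: submoduleZ.
have [k kP] := choice ki; exists (\max_i k i)%N => v.
rewrite [v]row_sum_delta scaler_sumr; apply: submodule_sum => [//|i _].
rewrite scalerA mulrC -scalerA; apply: submoduleZ => //.
by rewrite -(subnK (leq_bigmax i)) exprD -scalerA; apply: submoduleZ.
Qed.

(** Choosing in the i-th row a vector of L with i leading zeros and i-th entry of
    least valuation gives a triangular basis. *)
Lemma triangular_basis L : submodule L -> (exists k, forall v, L (pp ^+ k *: v)) ->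
  exists (A : 'M[Zp]_n) (e : {ffun 'I_n -> nat}),
  [/\ upper_triangular A, forall i, A i i = pp ^+ e i & L = row_span A].
Proof.
move=> LS [k0 Lk0].
pose lead (i : 'I_n) k := `[< exists v : 'rV[Zp]_n,
  [/\ L v, forall j : 'I_n, (j < i)%N -> v 0 j = 0 & v 0 i = pp ^+ k] >].
have leadP (i : 'I_n) : exists k v, [/\ L v, forall j : 'I_n, (j < i)%N -> v 0 j = 0,
    v 0 i = pp ^+ k & forall k', lead i k' -> (k <= k')%N].
  have /ex_minnP[k /asboolP[v [Lv v0 vi]] kmin] : exists k, lead i k.
    exists k0; apply/asboolP; exists (pp ^+ k0 *: delta_mx 0 i); split=> //.
      by move=> j ji; rewrite !mxE eqxx/= -val_eqE/= ltn_eqF// mulr0.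
    by rewrite !mxE !eqxx mulr1.
  by exists k, v.
have [e eP] := choice leadP; have [w wP] := choice eP.
exists (\matrix_i w i), (finfun e); split.
- by move=> i j ji; rewrite mxE; have [_ w0 _ _] := wP i; exact: w0.
- by move=> i; rewrite mxE ffunE; have [] := wP i.
apply/seteqP; split; last first.
  move=> _ [v _ <-]; rewrite mulmx_sum_row; apply: submodule_sum => // i _.
  by apply: submoduleZ => //; rewrite rowK; have [] := wP i.
(* Induction on the number of columns that are not yet known to vanish. *)
suff H r : (r <= n)%N -> forall u : 'rV[Zp]_n, L u ->
    (forall j : 'I_n, (j < n - r)%N -> u 0 j = 0) -> row_span (\matrix_i w i) u.
  by move=> u Lu; apply: (H n) => // j; rewrite subnn.
elim: r => [|r IHr] rn u Lu u0.
  suff -> : u = 0 by exists 0; rewrite ?mul0mx.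
  by apply/rowP => j; rewrite u0 ?mxE// subn0.
have iP : (n - r.+1 < n)%N by rewrite ltn_subrL; case: (n) rn.
pose i := Ordinal iP.
have [c cE] : exists c, u 0 i = c * pp ^+ e i.
  have [->|/padic_unit_pk[k [b [bU ui]]]] := eqVneq (u 0 i) 0.
    by exists 0; rewrite mul0r.
  have ek : (e i <= k)%N.
    have [_ _ _] := wP i; apply; apply/asboolP; exists (b^-1 *: u); split.
    - exact: submoduleZ.
    - by move=> j ji; rewrite mxE u0// mulr0.
    - by rewrite mxE ui mulKr.
  by exists (b * pp ^+ (k - e i)); rewrite -mulrA -exprD subnK.
have [Lw w0 wi _] := wP i.
have -> : u = c *: w i + (u - c *: w i) by rewrite addrC subrK.
apply: submoduleD (row_span_submodule _) _ _.
  apply: submoduleZ (row_span_submodule _) _; exists (delta_mx 0 i) => //.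
  by rewrite -rowE rowK.
apply: IHr => [|| j jnr]; first exact: ltnW.
  by apply: submoduleB => //; exact: submoduleZ.
rewrite !mxE; have [ji|ij|/val_inj ->] := ltngtP j i.
- by rewrite u0// w0// mulr0 subr0.
- by move: ij; rewrite /= ltnNge -ltnS -subSn// subSS jnr.
- by rewrite cE wi subrr.
Qed.

Lemma upper_triangular_det (K : comNzRingType) m (A : 'M[K]_m) :
  upper_triangular A -> \det A = \prod_i A i i.
Proof.
move=> At; rewrite -det_tr det_trig; first by apply: eq_bigr => i _; rewrite mxE.
by apply/is_trig_mxP => i j ij; rewrite mxE At.
Qed.

Lemma triangular_basis_det (A : 'M[Zp]_n) (e : {ffun 'I_n -> nat}) :
  upper_triangular A -> (forall i, A i i = pp ^+ e i) ->
  \det A = pp ^+ (\sum_i e i).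
Proof.
move=> At Ae; rewrite upper_triangular_det// -prodrXr; apply: eq_bigr => i _.
exact: Ae.
Qed.

(** The coefficients of v on the earlier rows vanish one after the other, so that only
    the pivot contributes to the entry in column i. *)
Lemma triangular_leading (B : 'M[Zp]_n) (f : {ffun 'I_n -> nat}) v (i : 'I_n) :
    upper_triangular B -> (forall i, B i i = pp ^+ f i) -> row_span B v ->
    (forall j : 'I_n, (j < i)%N -> v 0 j = 0) ->
  exists c, v 0 i = c * pp ^+ f i.
Proof.
move=> Bt Bf [c _ cE] v0.
have c0 r : forall j : 'I_n, (j < r)%N -> (j < i)%N -> c 0 j = 0.
  elim: r => // r IHr j; rewrite ltnS => jr ji.
  have := congr1 (fun v : 'rV_n => v 0 j) cE.
  rewrite v0// mxE (bigD1 j)//= big1.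
    move=> /eqP; rewrite addr0 mulf_eq0 Bf (negPf (padic_pk_neq0 _ _)) orbF => /eqP//.
  move=> k kj; have [jk|] := ltnP j k; first by rewrite Bt// mulr0.
  rewrite leq_eqVlt => /orP[/eqP/val_inj e0|kj']; first by rewrite e0 eqxx in kj.
  by rewrite IHr ?mul0r//; [exact: leq_trans kj' jr|exact: ltn_trans kj' ji].
exists (c 0 i); rewrite -cE mxE (bigD1 i)//= big1 ?addr0 ?Bf//.
move=> k ki; have [ik|] := ltnP i k; first by rewrite Bt// mulr0.
rewrite leq_eqVlt => /orP[/eqP/val_inj e0|ki']; first by rewrite e0 eqxx in ki.
by rewrite (c0 n)// mul0r.
Qed.

Lemma triangular_basis_le (A B : 'M[Zp]_n) (e f : {ffun 'I_n -> nat}) :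
    upper_triangular A -> (forall i, A i i = pp ^+ e i) ->
    upper_triangular B -> (forall i, B i i = pp ^+ f i) ->
  row_span A `<=` row_span B -> forall i, (f i <= e i)%N.
Proof.
move=> At Ae Bt Bf AB i; apply: (@padic_pk_dvd_unit _ p_pr 1); first exact: unitr1.
rewrite mul1r -Ae; have /AB Bi : row_span A (row i A) by exists (delta_mx 0 i); rewrite -?rowE.
have := triangular_leading (i := i) Bt Bf Bi; rewrite mxE; apply=> j ji.
by rewrite mxE At.
Qed.

(** Comparing two triangular bases of the same lattice in both directions. *)
Lemma hermite_deltaE (A : 'M[Zp]_n) (e : {ffun 'I_n -> nat}) :
  upper_triangular A -> (forall i, A i i = pp ^+ e i) ->
  hermite_delta (row_span A) = e.
Proof.
move=> At Ae; rewrite /hermite_delta; case: xgetP => [f _ [B [Bt Bf AB]]|/(_ e)[]]; last first.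
  by exists A.
apply/ffunP => i; apply/eqP; rewrite eqn_leq.
by rewrite (triangular_basis_le At Ae Bt Bf) ?(triangular_basis_le Bt Bf At Ae) ?AB.
Qed.

End Sublattices.

(** * Elementary divisors *)

Section Residue.
Variables (p : nat) (p_pr : prime p).
Local Notation Zp := (padic_int p_pr).
Local Notation pp := (p%:R : Zp).

Let pk_gt0 k : (0 < p ^ k)%N. Proof. by rewrite expn_gt0 prime_gt0. Qed.

Lemma ord_pk_lt k (c : 'I_(p ^ k).-1.+1) : (c < p ^ k)%N.
Proof. by apply: leq_trans (ltn_ord c) _; rewrite prednK. Qed.

Lemma ord_pk_add k (x y : 'I_(p ^ k).-1.+1) : (x + y)%R = ((x + y) %% p ^ k)%N :> nat.
Proof. by congr (_ %% _)%N; rewrite prednK. Qed.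

Definition padic_red k (x : Zp) : 'I_(p ^ k).-1.+1 := inord (padic_resn x k).

Lemma val_padic_red k x : padic_red k x = padic_resn x k :> nat.
Proof. by rewrite inordK// prednK// padic_resn_lt. Qed.

Lemma padic_redP k x (c : 'I_(p ^ k).-1.+1) :
  (exists z, x - (c : nat)%:R = z * pp ^+ k) <-> padic_red k x = c.
Proof.
have [a aE] := padic_resnP x k; split=> [[z zE]|<-]; last first.
  by exists a; rewrite val_padic_red {1}aE addrC addKr.
apply/val_inj; rewrite /= val_padic_red; apply: (@padic_nat_eq _ p_pr _ _ k).
- exact: padic_resn_lt.
- exact: ord_pk_lt.
- exists (z - a); rewrite mulrBl -zE; apply/eqP.
  by rewrite -subr_eq0 {2}aE; apply/eqP; ring.
Qed.

Fact padic_red_is_zmod k : {morph padic_red k : x y / x - y}.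
Proof.
move=> x y; apply/padic_redP.
have [a aE] : exists a, x - (padic_red k x : nat)%:R = a * pp ^+ k by apply/padic_redP.
have [b bE] : exists a, y - (padic_red k y : nat)%:R = a * pp ^+ k by apply/padic_redP.
pose u : nat := padic_red k x; pose v : nat := padic_red k y.
have ltv : (v < p ^ k)%N by exact: ord_pk_lt.
have -> : (padic_red k x - padic_red k y : 'I_(p ^ k).-1.+1) = ((u + (p ^ k - v)) %% p ^ k)%N :> nat.
  by rewrite /= -/u -/v prednK// modnDmr.
have := divn_eq (u + (p ^ k - v)) (p ^ k).
set q := (_ %/ _)%N; set r := (_ %% _)%N => e.
exists (a - b - 1 + q%:R).
have {}e : (u%:R + (pp ^+ k - v%:R) = q%:R * pp ^+ k + r%:R :> Zp).
  by rewrite -natrX -natrB ?(ltnW ltv)// -natrD e natrD natrM.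
rewrite !mulrDl !mulNr -aE -bE -/u -/v mul1r.
have -> : r%:R = u%:R + (pp ^+ k - v%:R) - q%:R * pp ^+ k :> Zp by rewrite e addrC addKr.
ring.
Qed.

HB.instance Definition _ k := GRing.isZmodMorphism.Build Zp 'I_(p ^ k).-1.+1
  (padic_red k) (padic_red_is_zmod k).

Lemma padic_red_nat k c : (c < p ^ k)%N -> padic_red k c%:R = c :> nat.
Proof.
move=> ck; have cP : (c < (p ^ k).-1.+1)%N by rewrite prednK.
have -> : padic_red k c%:R = Ordinal cP; last by [].
by apply/padic_redP; exists 0; rewrite subrr mul0r.
Qed.

Lemma padic_red0 k x : padic_red k x = 0 <-> exists z, x = z * pp ^+ k.
Proof. by rewrite -padic_redP subr0. Qed.

Lemma ord_mulrn_eq0 k m (x : 'I_(p ^ k).-1.+1) : (x *+ m == 0) = (p ^ k %| x * m)%N.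
Proof.
rewrite -val_eqE; suff -> : val (x *+ m) = (x * m %% p ^ k)%N by [].
elim: m => [|m IHm]; first by rewrite mulr0n muln0 mod0n.
by rewrite mulrS [LHS]ord_pk_add IHm modnDmr mulnS.
Qed.

Lemma card_ord_torsion k j :
  #|[set x : 'I_(p ^ k).-1.+1 | x *+ (p ^ j) == 0]%SET| = (p ^ minn j k)%N.
Proof.
have [kj|/ltnW jk] := leqP k j.
  rewrite (_ : [set x | _]%SET = [set: 'I_(p ^ k).-1.+1]%SET) ?cardsT ?card_ord ?prednK//.
  by apply/setP => x; rewrite !inE ord_mulrn_eq0 dvdn_mull// dvdn_exp2l.
pose h (y : 'I_(p ^ j)) : 'I_(p ^ k).-1.+1 := inord (y * p ^ (k - j))%N.
have hE y : h y = (y * p ^ (k - j))%N :> nat.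
  by rewrite inordK// prednK// -[X in (_ < p ^ X)%N](subnK jk) expnD mulnC ltn_pmul2l.
rewrite -[RHS]card_ord -[RHS]cardsT -(@card_imset _ _ h); last first.
  move=> y z /(congr1 (fun x : 'I__ => x : nat)); rewrite !hE => /eqP.
  by rewrite eqn_pmul2r// => /eqP/val_inj.
congr #|pred_of_set _|; apply/setP => x; rewrite inE ord_mulrn_eq0.
rewrite -[X in (p ^ X %| _)%N](subnK jk) expnD dvdn_pmul2r//.
apply/dvdnP/imsetP => [[c cE]|[y _ ->]]; last by exists y; rewrite hE.
have cj : (c < p ^ j)%N.
  rewrite -(@ltn_pmul2r (p ^ (k - j)))// -cE -expnD subnKC//.
  exact: ord_pk_lt.
by exists (Ordinal cj) => //; apply/val_inj; rewrite /= hE.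
Qed.
End Residue.

Section QuotientType.
Variables (p : nat) (p_pr : prime p) (n : nat).
Local Notation Zp := (padic_int p_pr).
Local Notation pp := (p%:R : Zp).
Implicit Types (L : set 'rV[Zp]_n) (nu : n.-tuple nat).

Lemma count_minn (s : seq nat) j : (\sum_(k <- s) minn j.+1 k =
  \sum_(k <- s) minn j k + count (fun k => j < k) s)%N.
Proof.
elim: s => [|k s IHs]; rewrite ?big_nil//= !big_cons IHs addnACA; congr (_ + _)%N.
by rewrite /minn; case: (ltnP j k) => jk; case: (ltnP j.+1 k) => /= jk'; lia.
Qed.

(** The increments of these sums in j count the entries greater than j. *)
Lemma sorted_eq_minn (s t : seq nat) : sorted leq s -> sorted leq t -> size s = size t ->
  (forall j, \sum_(k <- s) minn j k = \sum_(k <- t) minn j k)%N -> s = t.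
Proof.
move=> ss st sz st_min; apply: (sorted_eq leq_trans anti_leq) => //.
have cnt j : count (fun k => j < k)%N s = count (fun k => j < k)%N t.
  by have := st_min j.+1; rewrite !count_minn st_min => /addnI.
have cnt_mem (u : seq nat) j :
    (count_mem j u + count (fun k => j < k)%N u = count (fun k => j <= k)%N u)%N.
  elim: u => //= k u <-; rewrite addnACA; congr (_ + _)%N.
  by rewrite /=; case: (ltngtP j k).
have cntle j : count (fun k => j <= k)%N s = count (fun k => j <= k)%N t.
  by case: j => [|j]; [rewrite !(@eq_count _ (fun k => 0 <= k)%N predT)// !count_predT|exact: cnt].
apply/allP => j _ /=; apply/eqP.
by apply: (@addIn (count (fun k => j < k)%N s)); rewrite cnt_mem [in RHS]cnt cnt_mem.
Qed.

Local Notation quot nu := {dffun forall i : 'I_n, 'I_(p ^ tnth nu i).-1.+1}.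

Lemma card_quot_torsion nu j :
  #|[set c : quot nu | [forall i, c i *+ (p ^ j) == 0]]%SET| =
  (p ^ \sum_(k <- nu) minn j k)%N.
Proof.
transitivity #|(family (fun i : 'I_n => [pred x : 'I_(p ^ tnth nu i).-1.+1 | x *+ (p ^ j) == 0]) : {pred quot nu})|.
  apply: eq_card => c; rewrite !inE; exact/forallP/familyP.
rewrite card_family foldrE big_map big_enum/= big_tuple expn_sum.
by apply: eq_bigr => i _; rewrite -(card_ord_torsion p_pr) cardsE.
Qed.

(** The number of p^j-torsion elements of the quotient is p to the power of the sum
    of the min(j, nu_i), which determines nu. *)
Lemma quotient_type_inj L nu nu' : quotient_type L nu -> quotient_type L nu' -> nu = nu'.
Proof.
move=> [snu [phi [phiL phis]]] [snu' [phi' [phiL' phis']]].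
apply/val_inj/sorted_eq_minn; rewrite ?size_tuple// => j.
(* By symmetry it suffices to embed the torsion of one quotient in that of the other. *)
suff card_le (mu mu' : n.-tuple nat)
    (f : forall i : 'I_n, {additive 'rV[Zp]_n -> 'I_(p ^ tnth mu i).-1.+1})
    (f' : forall i : 'I_n, {additive 'rV[Zp]_n -> 'I_(p ^ tnth mu' i).-1.+1}) :
    (forall u, (forall i, f i u = 0) <-> (forall i, f' i u = 0)) ->
    (forall c : forall i : 'I_n, 'I_(p ^ tnth mu i).-1.+1, exists u, forall i, f i u = c i) ->
    (\sum_(k <- mu) minn j k <= \sum_(k <- mu') minn j k)%N.
  apply/eqP; rewrite eqn_leq (card_le _ _ phi phi')// ?(card_le _ _ phi' phi)//.
    by move=> u; rewrite -phiL -phiL'.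
  by move=> u; rewrite -phiL -phiL'.
move=> ff' fs; rewrite -(@leq_exp2l p) ?prime_gt1// -!card_quot_torsion.
have [r rE] := choice (fun c : quot mu => fs c).
pose h c : quot mu' := [ffun i => f' i (r c)].
have finj c d : h c = h d -> c = d.
  move=> /ffunP hcd; apply/ffunP => i.
  have : f i (r c - r d) = 0.
    by apply: (ff' _).2 => k; have := hcd k; rewrite !ffunE raddfB => ->; rewrite subrr.
  by rewrite raddfB !rE => /subr0_eq.
rewrite -(card_imset _ finj); apply/subset_leq_card/fintype.subsetP => _ /imsetP[c + ->].
rewrite !inE => /forallP c0; apply/forallP => i; rewrite ffunE -raddfMn.
apply/eqP; apply: (ff' _).1 => k; rewrite raddfMn rE; exact/eqP.
Qed.

Lemma smith_typeE L nu : quotient_type L nu -> smith_type L = nu.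
Proof.
move=> Lnu; rewrite /smith_type; case: xgetP => [mu _ Lmu|/(_ nu)//].
exact: quotient_type_inj Lmu Lnu.
Qed.

Lemma quotient_type_finite L nu : submodule L -> quotient_type L nu ->
  finite_index_sublattice L.
Proof.
move=> LS [_ [phi [phiL phis]]]; split; [by case: LS|by case: LS|].
have [r rE] := choice (fun c : quot nu => phis c).
apply: (@sub_finite_set _ _ [set [set r c + w | w in L] | c in [set: quot nu]]).
  move=> _ [v _ <-]; exists [ffun i => phi i v] => //.
  have Lv : L (v - r [ffun i => phi i v]).
    by apply/phiL => i; rewrite raddfB rE ffunE subrr.
  apply/seteqP; split=> _ [w Lw <-].
    exists ((r [ffun i => phi i v] - v) + w); last by rewrite addrCA addrA subrK.
    by apply: submoduleD => //; rewrite -opprB -scaleN1r; apply: submoduleZ.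
  exists ((v - r [ffun i => phi i v]) + w); first exact: submoduleD.
  by rewrite addrCA addrA subrK.
exact/finite_image/finite_finset.
Qed.

Lemma quotient_type_pk L nu a : quotient_type L nu ->
  (forall v, L (pp ^+ a *: v)) <-> (forall i, tnth nu i <= a)%N.
Proof.
move=> [_ [phi [phiL phis]]]; split=> [Lp i|nua v]; last first.
  apply/phiL => i; rewrite -natrX scaler_nat raddfMn; apply/eqP.
  by rewrite ord_mulrn_eq0// dvdn_mull// dvdn_exp2l.
have [u uE] := phis (fun i => inord 1).
have /phiL/(_ i) := Lp u; rewrite -natrX scaler_nat raddfMn uE => /eqP.
rewrite ord_mulrn_eq0//; have [->//|nu0] := posnP (tnth nu i).
rewrite inordK ?mul1n ?dvdn_Pexp2l ?(prime_gt1 p_pr)//.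
rewrite prednK ?expn_gt0 ?prime_gt0//; apply: leq_trans (prime_gt1 p_pr) _.
by rewrite -{1}(expn1 p) leq_exp2l ?prime_gt1.
Qed.

Lemma quotient_type_smith (U V : 'M[Zp]_n) nu :
    U \in unitmx -> V \in unitmx -> sorted leq nu ->
  quotient_type (row_span (U *m diag_mx (\row_i pp ^+ tnth nu i) *m V)) nu.
Proof.
move=> uU uV snu; split=> //.
pose f (i : 'I_n) (u : 'rV[Zp]_n) := padic_red (tnth nu i) ((u *m invmx V) 0 i).
have f_add i : {morph f i : x y / x - y}.
  by move=> x y; rewrite /f mulmxBl !mxE raddfB.
pose F i : {additive 'rV[Zp]_n -> 'I_(p ^ tnth nu i).-1.+1} :=
  HB.pack (f i) (GRing.isZmodMorphism.Build _ _ (f i) (f_add i)).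
exists F; split=> [u|c]; last first.
  exists ((\row_i (c i : nat)%:R) *m V) => i; rewrite /F/= /f mulmxK// mxE.
  apply/val_inj; rewrite /= padic_red_nat//.
  exact: ord_pk_lt.
split=> [[v _ <-] i|Fu].
  apply/padic_red0; exists ((v *m U) 0 i).
  by rewrite !mulmxA mulmxK// mul_mx_diag !mxE.
have /choice[z zE] i : exists z, (u *m invmx V) 0 i = z * pp ^+ tnth nu i.
  by apply/padic_red0; exact: Fu.
exists ((\row_i z i) *m invmx U) => //.
rewrite !mulmxA mulmxKV//; rewrite -[RHS](mulmxKV uV); congr (_ *m _); apply/rowP => i.
by rewrite zE mul_mx_diag !mxE.
Qed.

Lemma row_span_finite_index (D : 'M[Zp]_n) : \det D != 0 ->
  finite_index_sublattice (row_span D).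
Proof.
move=> /(padic_smith_square)[U [V [nu [uU uV snu DE]]]].
apply: (@quotient_type_finite _ nu); first exact: row_span_submodule.
by rewrite DE; apply: quotient_type_smith.
Qed.

End QuotientType.

(** * Symplectic similitudes *)

Section SymplecticRing.
Variables (K : comUnitRingType) (n : nat).
Local Notation J := (Jmx n K).
Implicit Types (A : 'M[K]_(n + n)) (c : K).

Definition similitude A c := A *m J *m A^T = c *: J.

Lemma Jmx_sqr : J *m J = - 1%:M.
Proof.
rewrite /Jmx mulmx_block !(mulmx0, mul0mx, mulmx1, mul1mx, mulmxN, mulNmx) !(addr0, add0r).
by rewrite scalar_mx_block opp_block_mx oppr0.
Qed.

Lemma Jmx_tr : J^T = - J.
Proof. by rewrite /Jmx tr_block_mx opp_block_mx !linearN/= !linear0 !trmx1 opprK. Qed.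

Lemma Jmx_unit : J \in unitmx.
Proof.
have h : J *m - J = 1%:M by rewrite mulmxN Jmx_sqr opprK.
exact: (mulmx1_unit h).1.
Qed.

Lemma Jmx_alt (u : 'rV[K]_(n + n)) : u *m J *m u^T = 0.
Proof.
rewrite -[u]hsubmxK /Jmx mul_row_block tr_row_mx mul_row_col.
rewrite !(mulmx0, mulmx1, mulmxN, add0r, addr0) mulNmx.
have -> : rsubmx u *m (lsubmx u)^T = (lsubmx u *m (rsubmx u)^T)^T.
  by rewrite trmx_mul trmxK.
by apply/matrixP => i j; rewrite !ord1 !mxE addNr.
Qed.

Lemma Jmx_ur i : J (lshift n i) (rshift n i) = 1.
Proof. by rewrite /Jmx block_mxEur mxE eqxx. Qed.

Lemma similitude_inj A c d : (0 < n)%N -> similitude A c -> similitude A d -> c = d.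
Proof.
move=> n0; rewrite /similitude => -> /matrixP/(_ (lshift n (Ordinal n0)) (rshift n (Ordinal n0))).
by rewrite mxE [in X in _ = X -> _]mxE Jmx_ur !mulr1.
Qed.

Lemma similitudeM A B c d : similitude A c -> similitude B d -> similitude (A *m B) (c * d).
Proof.
rewrite /similitude => hA hB; rewrite trmx_mul !mulmxA -(mulmxA A) -(mulmxA A) hB.
by rewrite -scalemxAr -scalemxAl hA scalerA mulrC.
Qed.

Lemma similitude1 : similitude 1%:M 1.
Proof. by rewrite /similitude mul1mx trmx1 mulmx1 scale1r. Qed.

(** The adjoint of A for the symplectic form. *)
Definition symp_adj A : 'M[K]_(n + n) := - (J *m A^T *m J).

Lemma symp_adjP A c : similitude A c -> A *m symp_adj A = c%:M.
Proof.
rewrite /similitude /symp_adj => hA; rewrite mulmxN !mulmxA hA -scalemxAl Jmx_sqr.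
by rewrite scalerN opprK scalemx1.
Qed.

Lemma similitude_unit A c : similitude A c -> c \is a GRing.unit -> A \in unitmx.
Proof.
move=> /symp_adjP AA cU; have h : A *m (c^-1 *: symp_adj A) = 1%:M.
  by rewrite -scalemxAr AA scale_scalar_mx mulVr.
exact: (mulmx1_unit h).1.
Qed.

Lemma Gsp_similitude A : GSp n K A <-> exists2 c, c \is a GRing.unit & similitude A c.
Proof.
split=> [[_ [c cU h]]|[c cU h]]; first by exists c.
by split; [exact: similitude_unit h cU|exists c].
Qed.

Lemma similitude_inv A c : similitude A c -> c \is a GRing.unit ->
  similitude (invmx A) c^-1.
Proof.
move=> h cU; have AU := similitude_unit h cU.
rewrite /similitude; have e := congr1 (fun B => invmx A *m B *m (invmx A)^T) h.
move: e; rewrite /similitude !mulmxA mulVmx// mul1mx -mulmxA -trmx_mul mulVmx//.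
rewrite trmx1 mulmx1 -scalemxAr -scalemxAl => e.
by rewrite [in RHS]e scalerA mulVr// scale1r.
Qed.

Lemma similitude_block (E B D : 'M[K]_n) c :
  similitude (block_mx E B 0 D) c <-> E *m D^T = c%:M /\ E *m B^T = B *m E^T.
Proof.
rewrite /similitude /Jmx tr_block_mx !mulmx_block scale_block_mx.
rewrite !(mulmx0, mul0mx, mulmx1, mul1mx, mulmxN, mulNmx, trmx0, addr0, scaler0, scalemx1).
rewrite !add0r ?mulNmx; split.
  move=> /eq_block_mx[h1 h2 _ _]; split=> //.
  by apply/eqP; rewrite -subr_eq0 addrC h1.
move=> [h1 h2]; rewrite h1 h2 addNr; congr block_mx.
have := congr1 trmx h1; rewrite trmx_mul trmxK tr_scalar_mx => ->.
by rewrite scalerN scalemx1.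
Qed.

Lemma similitude_diag (U : 'M[K]_n) c : U \in unitmx ->
  similitude (block_mx (c *: (invmx U)^T) 0 0 U) c.
Proof.
move=> uU; apply/similitude_block; split; last by rewrite trmx0 mulmx0 mul0mx.
by rewrite -scalemxAl -trmx_mul mulmxV// trmx1 scalemx1.
Qed.

(** An isotropic submodule with a complement extends to a symplectic basis: a dual
   family made isotropic by subtracting the strictly upper half of its Gram matrix. *)
Lemma symplectic_completion (W : 'M[K]_(n, n + n)) (X : 'M[K]_(n + n, n)) :
  W *m X = 1%:M -> W *m J *m W^T = 0 ->
  exists U : 'M[K]_(n, n + n), similitude (col_mx U W) 1.
Proof.
move=> WX W0; pose U0 := - (X^T *m J).
have U0W : U0 *m J *m W^T = 1%:M.
  by rewrite /U0 !mulNmx -!mulmxA (mulmxA J) Jmx_sqr mulNmx mul1mx mulmxN opprK -trmx_mul WX trmx1.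
have WU0 : W *m J *m U0^T = - 1%:M.
  have := congr1 trmx U0W.
  rewrite !trmx_mul trmxK trmx1 Jmx_tr => e; rewrite -e.
  by rewrite mulNmx mulmxN mulmxA opprK.
clearbody U0; pose T := U0 *m J *m U0^T.
have Talt i j : T i j = - T j i.
  have : T^T = - T by rewrite /T !trmx_mul trmxK Jmx_tr mulNmx mulmxN mulmxA.
  by move=> /matrixP/(_ j i); rewrite !mxE.
have Tdiag i : T i i = 0.
  have /matrixP/(_ 0 0) := Jmx_alt (row i U0); rewrite -row_mul tr_row mxE [in RHS]mxE => e.
  by rewrite /T mxE -[RHS]e; apply: eq_bigr => k _; rewrite !mxE.
have TE : U0 *m J *m U0^T = T by [].
clearbody T; pose Y : 'M[K]_n := \matrix_(i, j) if (i < j)%N then T i j else 0.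
have YT : Y - Y^T = T.
  apply/matrixP => i j; rewrite !mxE; case: (ltngtP i j) => [ij|ji|/val_inj ->].
  - by rewrite subr0.
  - by rewrite sub0r Talt opprK.
  - by rewrite subr0 Tdiag.
(* U0 is dual to W; adding Y W cancels its Gram matrix T = Y - Y^T. *)
exists (U0 + Y *m W); rewrite /similitude.
have UW : (U0 + Y *m W) *m J *m W^T = 1%:M.
  by rewrite !mulmxDl U0W -!mulmxA (mulmxA W) W0 mulmx0 addr0.
rewrite mul_col_mx tr_col_mx mul_col_row /Jmx scale1r W0 UW; apply: block_mx_congr => //.
- rewrite linearD/= mulmxDr trmx_mul [_ *m (W^T *m _)]mulmxA UW mul1mx.
  rewrite !mulmxDl TE -!mulmxA (mulmxA W) WU0 mulmxN mulmx1 -YT.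
  by rewrite addrAC subrK subrr.
- rewrite linearD/= mulmxDr WU0 trmx_mul [_ *m (W^T *m _)]mulmxA W0 mul0mx addr0 //.
Qed.

End SymplecticRing.

Section SymplecticPadic.
Variables (p : nat) (p_pr : prime p) (n : nat).
Hypothesis n_gt0 : (0 < n)%N.
Local Notation Zp := (padic_int p_pr).
Local Notation pp := (p%:R : Zp).
Implicit Types (A : 'M[Zp]_(n + n)) (E B D : 'M[Zp]_n).

Lemma mulmx_scalarC m (X Y : 'M[Zp]_m) c : c != 0 -> X *m Y = c%:M -> Y *m X = c%:M.
Proof.
move=> c0 XY; have X0 : \det X != 0.
  apply/eqP => X0; have := congr1 determinant XY.
  rewrite det_mulmx X0 mul0r det_scalar => /eqP; rewrite eq_sym expf_eq0.
  by rewrite (negPf c0) andbF.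
have : X *m (Y *m X - c%:M) = 0.
  by rewrite mulmxBr mulmxA XY mul_scalar_mx mul_mx_scalar subrr.
move=> /(congr1 (mulmx (\adj X))); rewrite mulmxA mul_adj_mx mulmx0 mul_scalar_mx.
move=> /matrixP h; apply/matrixP => i j; have := h i j; rewrite !mxE => /eqP.
by rewrite mulf_eq0 (negPf X0)/= subr_eq0 => /eqP.
Qed.

Lemma mulmx_scalar_det m (X Y : 'M[Zp]_m) c : c != 0 -> X *m Y = c%:M -> \det X != 0.
Proof.
move=> c0 XY; apply/eqP => X0; have := congr1 determinant XY.
rewrite det_mulmx X0 mul0r det_scalar => /eqP; rewrite eq_sym expf_eq0.
by rewrite (negPf c0) andbF.
Qed.

(** For a block triangular A this is the span of the lower diagonal block; being
    defined by the row lattice of A, it is an invariant of the coset of A. *)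
Definition low_lattice A : set 'rV[Zp]_n :=
  [set v | exists u : 'rV[Zp]_(n + n), u *m A = row_mx 0 v].

Lemma low_lattice_unit U A : U \in unitmx -> low_lattice (U *m A) = low_lattice A.
Proof.
move=> uU; apply/seteqP; split=> v [u uE].
  by exists (u *m U); rewrite -mulmxA.
by exists (u *m invmx U); rewrite mulmxA mulmxKV.
Qed.

Lemma low_lattice_block E B D : \det E != 0 ->
  low_lattice (block_mx E B 0 D) = row_span D.
Proof.
move=> E0; apply/seteqP; split=> [v [u]|_ [v _ <-]].
  rewrite -[u]hsubmxK mul_row_block mulmx0 addr0 => /eq_row_mx[uE uD].
  have u0 : lsubmx u = 0.
    have := congr1 (mulmxr (\adj E)) uE; rewrite /= -mulmxA mul_mx_adj mul0mx mul_mx_scalar.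
    move=> /rowP h; apply/rowP => j; have := h j; rewrite !mxE => /eqP.
    by rewrite mulf_eq0 (negPf E0) => /eqP.
  by exists (rsubmx u) => //; rewrite -uD u0 mul0mx add0r.
by exists (row_mx 0 v); rewrite mul_row_block !(mul0mx, mulmx0) !add0r.
Qed.

(** The left kernel of the left half of A is a direct summand.  It is isotropic since
    A is a similitude, so a basis of it is the lower half of a symplectic matrix g. *)
Lemma similitude_upper_block A c : c != 0 -> similitude A c ->
  exists g E B D, similitude g 1 /\ g *m A = block_mx E B 0 D.
Proof.
move=> c0 Ac; have [W [X [W0 WX]]] := padic_left_kernel (lsubmx A).
have WA : W *m A = row_mx 0 (W *m rsubmx A) by rewrite -{1}[A]hsubmxK mul_mx_row W0.
have WJ : W *m Jmx n _ *m W^T = 0.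
  have h : (W *m A) *m Jmx n _ *m (W *m A)^T = c *: (W *m Jmx n _ *m W^T).
    rewrite trmx_mul scalemxAl scalemxAr -Ac !mulmxA; congr (_ *m _).
  move: h; rewrite WA /Jmx mul_row_block tr_row_mx mul_row_col trmx0.
  rewrite !(mulmx0, mul0mx, mulmx1, mulmxN, addr0, add0r, oppr0).
  move=> /matrixP h; apply/matrixP => i j; have := h i j; rewrite !mxE => /esym/eqP.
  by rewrite mulf_eq0 (negPf c0) => /eqP.
have [U Usim] := symplectic_completion WX WJ.
exists (col_mx U W), (U *m lsubmx A), (U *m rsubmx A), (W *m rsubmx A); split=> //.
by rewrite -{1}[A]hsubmxK mul_col_row W0.
Qed.

(** A block diagonal similitude changes the basis of the span of D and removes the
    unit from the multiplier at the same time. *)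
Lemma similitude_block_normalize E B D D' u a : u \is a GRing.unit ->
    similitude (block_mx E B 0 D) (u * pp ^+ a) -> row_span D = row_span D' ->
  exists g c E' B', [/\ c \is a GRing.unit, similitude g c,
    g *m block_mx E B 0 D = block_mx E' B' 0 D' &
    similitude (block_mx E' B' 0 D') (pp ^+ a)].
Proof.
move=> uU Msim DD'.
have c0 := padic_unit_pk_neq0 a uU.
have [ED _] := (similitude_block _ _ _ _).1 Msim.
have D0 : \det D != 0 by rewrite -det_tr (mulmx_scalar_det c0 (mulmx_scalarC c0 ED)).
have [U uU' DE] := row_span_eq D0 DD'.
pose V := invmx U; have uV : V \in unitmx by rewrite unitmx_inv.
pose g := block_mx (u^-1 *: (invmx V)^T) 0 0 V.
have gsim : similitude g u^-1 by exact: similitude_diag.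
exists g, u^-1, (u^-1 *: (invmx V)^T *m E), (u^-1 *: (invmx V)^T *m B).
have gM : g *m block_mx E B 0 D =
    block_mx (u^-1 *: (invmx V)^T *m E) (u^-1 *: (invmx V)^T *m B) 0 D'.
  rewrite /g mulmx_block !(mulmx0, mul0mx, addr0, add0r); congr block_mx.
  by rewrite DE /V mulKmx.
split=> //; first by rewrite unitrV.
rewrite -gM; have := similitudeM gsim Msim.
by rewrite mulrA mulVr// mul1r.
Qed.

Lemma block_cofactor D a : \det D != 0 -> (forall v, row_span D (pp ^+ a *: v)) ->
  exists E, E *m D^T = (pp ^+ a)%:M.
Proof.
move=> D0 Dp; have [V VD] : exists V, (pp ^+ a)%:M = V *m D.
  apply: row_span_sub => _ [v _ <-]; rewrite mul_mx_scalar; exact: Dp.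
exists V^T; apply: mulmx_scalarC; first exact: padic_pk_neq0.
by rewrite -trmx_mul -VD tr_scalar_mx.
Qed.

Lemma block_sym E B D c : c != 0 -> E *m D^T = c%:M ->
  E *m B^T = B *m E^T <-> D^T *m B = B^T *m D.
Proof.
move=> c0 ED; have DE := mulmx_scalarC c0 ED.
have DE' : D *m E^T = c%:M by rewrite -[D]trmxK -trmx_mul ED tr_scalar_mx.
have ED' := mulmx_scalarC c0 DE'.
have cinj m (X Y : 'M[Zp]_m) : c *: X = c *: Y -> X = Y.
  move=> /matrixP h; apply/matrixP => i j; have := h i j; rewrite !mxE.
  exact: mulfI.
split=> h; apply: cinj.
  rewrite -mul_mx_scalar -ED' -mulmxA (mulmxA B) -h.
  by rewrite !mulmxA DE mul_scalar_mx -scalemxAl.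
rewrite -mul_mx_scalar -DE' -[E *m B^T *m _]mulmxA (mulmxA B^T) -h.
by rewrite !mulmxA ED mul_scalar_mx -scalemxAl.
Qed.

(** Since E is nonsingular the lower left block of g vanishes.  If moreover D = D',
    the lower right block is 1 and the multiplier is 1, so that g is a shear. *)
Lemma block_same_coset E B D E' B' D' a a' g c : c \is a GRing.unit -> similitude g c ->
    similitude (block_mx E B 0 D) (pp ^+ a) -> similitude (block_mx E' B' 0 D') (pp ^+ a') ->
    g *m block_mx E B 0 D = block_mx E' B' 0 D' ->
  [/\ a = a', row_span D = row_span D' &
     D = D' -> exists2 T : 'M[Zp]_n, T^T = T & B' = B + T *m D].
Proof.
move=> cU gsim Msim Msim' gM.
have [ED EB] := (similitude_block _ _ _ _).1 Msim.
have [ED' EB'] := (similitude_block _ _ _ _).1 Msim'.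
have pa0 := padic_pk_neq0 p_pr a.
have E0 := mulmx_scalar_det pa0 ED.
have D0 : \det D != 0 by rewrite -det_tr (mulmx_scalar_det pa0 (mulmx_scalarC pa0 ED)).
have gU := similitude_unit gsim cU.
have aa' : c * pp ^+ a = pp ^+ a'.
  by have := similitudeM gsim Msim; rewrite gM => /(similitude_inj n_gt0); apply.
have Eaa' : a = a'.
  by apply: (padic_unit_pk_inj cU (unitr1 _)); rewrite mul1r.
have spanDD' : row_span D = row_span D'.
  rewrite -(low_lattice_block B D E0) -(low_lattice_unit _ gU) gM low_lattice_block//.
  by apply: mulmx_scalar_det (padic_pk_neq0 p_pr a') ED'.
split=> // DD'.
move: gM; rewrite -[g]submxK mulmx_block !mulmx0 !addr0 => /eq_block_mx[gE gB gdl gD].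
have gdl0 : dlsubmx g = 0.
  have := congr1 (mulmxr (\adj E)) gdl; rewrite /= -mulmxA mul_mx_adj mul0mx mul_mx_scalar.
  move=> /matrixP h; apply/matrixP => i j; have := h i j; rewrite !mxE => /eqP.
  by rewrite mulf_eq0 (negPf E0) => /eqP.
have gdr1 : drsubmx g = 1%:M.
  move: gD; rewrite gdl0 mul0mx add0r -DD' => /eqP; rewrite -subr_eq0 -{2}[D]mul1mx -mulmxBl => /eqP.
  move=> /(congr1 (mulmxr (\adj D))); rewrite /= -mulmxA mul_mx_adj mul0mx mul_mx_scalar.
  move=> /matrixP h; apply/matrixP => i j; have := h i j; rewrite !mxE => /eqP.
  by rewrite mulf_eq0 (negPf D0) subr_eq0 => /eqP.
have c1 : c = 1.
  by apply: (mulIf pa0); rewrite mul1r aa' Eaa'.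
move: gsim gE gB; rewrite -{1}[g]submxK gdl0 gdr1 c1 => /similitude_block[].
rewrite trmx1 mulmx1 => ->; rewrite mul1mx trmx1 mulmx1 => gsym _ gB.
by exists (ursubmx g) => //; rewrite -gB mul1mx.
Qed.

Lemma block_shear E B D (T : 'M[Zp]_n) : T^T = T ->
  exists2 g, similitude g 1 & g *m block_mx E B 0 D = block_mx E (B + T *m D) 0 D :> 'M[Zp]_(n + n).
Proof.
move=> TT; exists (block_mx 1%:M T 0 1%:M).
  by apply/similitude_block; split; rewrite !trmx1 ?mulmx1 ?mul1mx ?TT.
by rewrite mulmx_block !(mul1mx, mul0mx, mulmx0, addr0, add0r).
Qed.

(** Representatives of the integral B with D^T B symmetric modulo the T D with T
    symmetric. By Smith form D may be taken diagonal, and then B is determined by its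
    entries on and below the diagonal, those of column j counting modulo p^nu_j. *)
Definition shear_code (nu : n.-tuple nat) :=
  {dffun forall ij : 'I_n * 'I_n, 'I_(if (ij.1 <= ij.2)%N then p ^ tnth nu ij.1 else 1)%N}.

Definition shear_val nu (c : shear_code nu) (i j : 'I_n) : nat := c (i, j).

Lemma shear_val_lt nu (c : shear_code nu) (i j : 'I_n) : (i <= j)%N -> (shear_val c i j < p ^ tnth nu i)%N.
Proof. by move=> ij; apply: leq_trans (ltn_ord _) _; rewrite /= ij. Qed.

Lemma shear_val0 nu (c : shear_code nu) (i j : 'I_n) : (j < i)%N -> shear_val c i j = 0%N.
Proof.
move=> ji; apply/eqP; rewrite -leqn0 -ltnS; apply: leq_trans (ltn_ord _) _.
by rewrite /= [(i <= j)%N]leqNgt ji.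
Qed.

Lemma card_shear_code (nu : n.-tuple nat) :
  #|{: shear_code nu}| = (p ^ \sum_(i < n) tnth nu i * (n - i))%N.
Proof.
rewrite card_dep_ffun foldrE big_map big_enum/=.
rewrite (eq_bigr (fun ij : 'I_n * 'I_n => if (ij.1 <= ij.2)%N then p ^ tnth nu ij.1 else 1)%N); last first.
  by move=> ij _; rewrite card_ord.
rewrite -(pair_bigA _ (fun i j : 'I_n => if (i <= j)%N then p ^ tnth nu i else 1)%N)/=.
rewrite expn_sum; apply: eq_bigr => i _; rewrite -big_mkcond/= prod_nat_const -expnM.
congr (p ^ (_ * _))%N; rewrite -sum1_card.
transitivity (\sum_(i <= j < n) 1)%N; first by rewrite big_geq_mkord.
by rewrite sum_nat_const_nat muln1.
Qed.

(** For diagonal S the condition reads p^nu_i B_ij = p^nu_j B_ji, which determines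
    the entries above the diagonal from those below. *)
Lemma shear_classes_diag (nu : n.-tuple nat) : sorted leq nu ->
  let S := diag_mx (\row_i pp ^+ tnth nu i) in
  exists Bf : shear_code nu -> 'M[Zp]_n,
  [/\ forall c, S *m Bf c = (Bf c)^T *m S,
      forall B, S *m B = B^T *m S -> exists c T, T^T = T /\ B = Bf c + T *m S &
      forall c c' T, T^T = T -> Bf c' = Bf c + T *m S -> c = c'].
Proof.
move=> snu S.
have nu_le (i j : 'I_n) : (i <= j)%N -> (tnth nu i <= tnth nu j)%N.
  by move=> ij; rewrite !(tnth_nth 0%N); apply: (sorted_leq_nth leq_trans leqnn) => //;
    rewrite inE size_tuple.
(* The entry of the code at (i, j), for i <= j, is a residue of B_ji modulo p^nu_i. *)
pose Bf (c : shear_code nu) : 'M[Zp]_n := \matrix_(i, j)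
  if (j <= i)%N then (shear_val c j i)%:R else pp ^+ (tnth nu j - tnth nu i) * (shear_val c i j)%:R.
have symP (B : 'M[Zp]_n) : S *m B = B^T *m S <->
    forall i j, pp ^+ tnth nu i * B i j = pp ^+ tnth nu j * B j i.
  split=> [/matrixP h i j|h].
    by have := h i j; rewrite mul_diag_mx mul_mx_diag !mxE [RHS]mulrC.
  by apply/matrixP => i j; rewrite mul_diag_mx mul_mx_diag !mxE h mulrC.
exists Bf; split.
- move=> c; apply/symP => i j; rewrite !mxE; case: (ltngtP j i) => [ji|ij|/val_inj ->//].
    by rewrite mulrA -exprD subnKC// nu_le// ltnW.
  by rewrite mulrA -exprD subnKC// nu_le// ltnW.
- move=> B /symP Bsym.
  have cP (ij : 'I_n * 'I_n) : exists c : 'I_(if (ij.1 <= ij.2)%N then p ^ tnth nu ij.1 else 1)%N,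
      (ij.1 <= ij.2)%N -> exists t, B ij.2 ij.1 = (c : nat)%:R + t * pp ^+ tnth nu ij.1.
    case: ij => i j /=; case: leqP => ij; last by exists ord0.
    exists (Ordinal (padic_resn_lt (B j i) (tnth nu i))) => _.
    exact: padic_resnP.
  pose c : shear_code nu := [ffun ij => sval (cid (cP ij))].
  have cE (i j : 'I_n) : (i <= j)%N -> exists t, B j i = (shear_val c i j)%:R + t * pp ^+ tnth nu i.
    by move=> ij; rewrite /shear_val ffunE; case: cid => d dP /=; exact: dP.
  have /choice[t tE] (ij : 'I_n * 'I_n) : exists t, (ij.1 <= ij.2)%N ->
      B ij.2 ij.1 = (shear_val c ij.1 ij.2)%:R + t * pp ^+ tnth nu ij.1.
    have [/cE[t ->]|_] := boolP (ij.1 <= ij.2)%N; first by exists t.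
    by exists 0.
  exists c, (\matrix_(i, j) if (j <= i)%N then t (j, i) else t (i, j)); split.
    by apply/matrixP => i j; rewrite !mxE; case: (ltngtP i j) => // /val_inj ->.
  apply/matrixP => i j; rewrite mul_mx_diag !mxE; case: leqP => ij.
    exact: (tE (j, i)).
  apply: (mulfI (padic_pk_neq0 p_pr (tnth nu i))); rewrite Bsym (tE (i, j) (ltnW ij)) /=.
  rewrite [in RHS]mulrDr mulrA -exprD subnKC ?nu_le ?(ltnW ij)// mulrDr; congr (_ + _).
  by rewrite mulrCA [RHS]mulrCA; congr (_ * _); rewrite mulrC.
- move=> c c' T TT /matrixP h; apply/ffunP => -[i j]; apply/val_inj.
  rewrite -[LHS]/(shear_val c i j) -[RHS]/(shear_val c' i j).
  case: (leqP i j) => ij; last by rewrite !shear_val0.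
  apply: (@padic_nat_eq _ p_pr _ _ (tnth nu i)); [exact: shear_val_lt|exact: shear_val_lt|].
  have := h j i; rewrite mul_mx_diag !mxE ij => ->.
  by exists (- T j i); rewrite opprD addNKr mulNr.
Qed.

(** If D = U S V is a Smith form, B |-> U^T B V^-1 transports the problem for D to
    the problem for S. *)
Lemma shear_classes D : \det D != 0 -> exists (nu : n.-tuple nat) (Bf : shear_code nu -> 'M[Zp]_n),
  [/\ quotient_type (row_span D) nu, forall c, D^T *m Bf c = (Bf c)^T *m D,
      forall B, D^T *m B = B^T *m D -> exists c T, T^T = T /\ B = Bf c + T *m D &
      forall c c' T, T^T = T -> Bf c' = Bf c + T *m D -> c = c'].
Proof.
move=> /(padic_smith_square)[U [V [nu [uU uV snu DE]]]].
have [Bf [Bsym Bsur Binj]] := shear_classes_diag snu.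
set S := diag_mx _ in DE Bsym Bsur Binj.
have ST : S^T = S by rewrite tr_diag_mx.
have uUT : U^T \in unitmx by rewrite unitmx_tr.
have uVT : V^T \in unitmx by rewrite unitmx_tr.
exists nu, (fun c => invmx U^T *m Bf c *m V); split.
- by rewrite DE; apply: quotient_type_smith.
- move=> c; rewrite DE !trmx_mul ST !mulmxA mulmxK// -(mulmxA V^T) Bsym.
  by rewrite trmx_inv trmxK !mulmxA mulmxKV.
- move=> B DB; have /Bsur[c [T [TT BE]]] : S *m (U^T *m B *m invmx V) = (U^T *m B *m invmx V)^T *m S.
    apply: (can_inj (mulKmx uVT)); apply: (can_inj (mulmxK uV)).
    move: DB; rewrite DE !trmx_mul ST trmxK trmx_inv !mulmxA => DB.
    by rewrite mulmxKV// mulmxV// mul1mx -DB.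
  exists c, (invmx U^T *m T *m invmx U); split.
    by rewrite !trmx_mul TT !trmx_inv trmxK mulmxA.
  apply: (can_inj (mulKmx uUT)); apply: (can_inj (mulmxK (_ : invmx V \in unitmx))).
    by rewrite unitmx_inv.
  rewrite BE DE mulmxDr mulmxDl !mulmxA !mulmxV// !mul1mx; congr (_ + _).
    by rewrite mulmxK.
  by rewrite mulmxKV// mulmxK.
- move=> c c' T TT cE; apply: (Binj c c' (U^T *m T *m U)).
    by rewrite !trmx_mul trmxK TT mulmxA.
  apply: (can_inj (mulKmx (_ : invmx U^T \in unitmx))); first by rewrite unitmx_inv.
  apply: (can_inj (mulmxK uV)); rewrite cE mulmxDr mulmxDl DE !mulmxA.
  by rewrite mulVmx// mul1mx.
Qed.

End SymplecticPadic.

(** * Cosets of the symplectic similitude group *)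

Section PadicField.
Variables (p : nat) (p_pr : prime p).
Local Notation Zp := (padic_int p_pr).
Local Notation Qp := (padic p_pr).
Local Notation iota := (@padic_of_int p p_pr).

HB.instance Definition _ := GRing.RMorphism.copy (@padic_of_int p p_pr) (@tofrac Zp).

Lemma padic_of_int_inj : injective iota.
Proof. by move=> x y /eqP; rewrite tofrac_eq => /eqP. Qed.

Lemma padic_of_int_eq0 x : (iota x == 0) = (x == 0).
Proof. exact: tofrac_eq0. Qed.

Lemma map_padic_inj m n : injective (map_mx iota : 'M[Zp]_(m, n) -> 'M[Qp]_(m, n)).
Proof.
move=> A B /matrixP AB; apply/matrixP => i j; apply: padic_of_int_inj.
by have := AB i j; rewrite !mxE.
Qed.

Lemma padic_p_pow_neq0 k : (p%:R ^+ k : Qp) != 0.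
Proof.
by rewrite -(rmorph_nat iota) -rmorphXn padic_of_int_eq0 padic_pk_neq0.
Qed.

Lemma iota_unit x : x \is a GRing.unit -> iota x \is a GRing.unit.
Proof. exact: rmorph_unit. Qed.
End PadicField.

Section Cosets.
Variables (p : nat) (p_pr : prime p) (n : nat).
Hypothesis n_gt0 : (0 < n)%N.
Local Notation Zp := (padic_int p_pr).
Local Notation Qp := (padic p_pr).
Local Notation iota := (@padic_of_int p p_pr).
Local Notation pp := (p%:R : Zp).
Local Notation M := 'M[Qp]_(n + n).
Local Notation "A ^i" := (map_mx iota A) (at level 2, format "A ^i").
Local Notation Gam := (@Gamma p p_pr n).
Local Notation Gpl := (@Gplus p p_pr n).
Implicit Types (A : 'M[Zp]_(n + n)) (g h : M) (X Y : set M).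

Lemma map_Jmx : (Jmx n Zp)^i = Jmx n Qp.
Proof. by rewrite /Jmx map_block_mx !map_mx0 map_mxN !map_mx1. Qed.

Lemma similitude_map A c : similitude A^i (iota c) <-> similitude A c.
Proof.
rewrite /similitude -map_Jmx map_trmx -!map_mxM -map_mxZ; split=> [|-> //].
exact: map_padic_inj.
Qed.

Lemma similitude_map_int A (c : Qp) : similitude A^i c -> exists c', c = iota c'.
Proof.
rewrite /similitude -{1}map_Jmx map_trmx -!map_mxM.
move=> /matrixP/(_ (lshift n (Ordinal n_gt0)) (rshift n (Ordinal n_gt0))).
rewrite mxE [in X in _ = X -> _]mxE Jmx_ur mulr1 => <-.
by eexists.
Qed.

Lemma GammaP g : Gam g <-> exists A c, [/\ c \is a GRing.unit, similitude A c & g = A^i].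
Proof.
split=> [[A /Gsp_similitude[c cU h] <-]|[A [c [cU h ->]]]]; first by exists A, c.
by exists A => //; apply/Gsp_similitude; exists c.
Qed.

(** Allowing a unit in the multiplier makes this set stable under Gamma on both
    sides. *)
Definition sim_set a : set M :=
  [set g | exists A u, [/\ u \is a GRing.unit, similitude A (u * pp ^+ a) & g = A^i]].

Lemma GplusP g : Gpl g <-> exists a, sim_set a g.
Proof.
split=> [[/Gsp_similitude[mu muU gmu] [A _ gE]]|[a [A [u [uU h ->]]]]].
  move: gmu; rewrite -gE => gmu; have [c cE] := similitude_map_int gmu.
  have c0 : c != 0.
    by apply: contraTneq muU => c0; rewrite cE c0 rmorph0 unitr0.
  have [k [u [uU cu]]] := padic_unit_pk c0.
  exists k, A, u; split=> //; apply/similitude_map; rewrite -cu -cE//.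
split; last by exists A.
apply/Gsp_similitude; exists (iota (u * pp ^+ a)); last exact/similitude_map.
by rewrite unitfE padic_of_int_eq0 padic_unit_pk_neq0.
Qed.

Lemma hecke_D_sim a : @hecke_D _ p_pr n (p ^ a) `<=` sim_set a.
Proof.
move=> g [[_ [A _ <-]]] gsim; exists A, 1; split; rewrite ?unitr1// mul1r.
apply/similitude_map; have -> : iota (pp ^+ a) = (p ^ a)%:R by rewrite rmorphXn rmorph_nat natrX.
exact: gsim.
Qed.

Lemma Gamma1 : Gam (1%:M : M).
Proof.
apply/GammaP; exists 1%:M, 1; split; [exact: unitr1|exact: similitude1|].
by rewrite map_mx1.
Qed.

Lemma GammaM g h : Gam g -> Gam h -> Gam (g *m h : M).
Proof.
move=> /GammaP[A [c [cU Ac ->]]] /GammaP[B [d [dU Bd ->]]]; apply/GammaP.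
exists (A *m B), (c * d); split; [by rewrite unitrM cU|exact: similitudeM|].
by rewrite map_mxM.
Qed.

Lemma Gamma_unit g : Gam g -> g \in unitmx.
Proof.
move=> /GammaP[A [c [cU Ac ->]]].
by apply: (@similitude_unit _ _ _ (iota c)); [exact/similitude_map|exact: iota_unit].
Qed.

Lemma GammaV g : Gam g -> Gam (invmx g : M).
Proof.
move=> /GammaP[A [c [cU Ac ->]]]; apply/GammaP.
exists (invmx A), c^-1; split; [by rewrite unitrV|exact: similitude_inv|].
have AU := similitude_unit Ac cU; apply: (can_inj (mulKmx (_ : A^i \in unitmx))).
  apply: (@similitude_unit _ _ _ (iota c)); [exact/similitude_map|exact: iota_unit].
rewrite -map_mxM [in RHS]mulmxV// map_mx1 mulmxV//.
by apply: (@similitude_unit _ _ _ (iota c)); [exact/similitude_map|exact: iota_unit].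
Qed.

Lemma right_coset_mull g h : Gam g -> right_coset (g *m h) = right_coset h.
Proof.
move=> gG; apply/seteqP; split=> _ [a aG <-].
  by exists (a *m g); [exact: GammaM|rewrite mulmxA].
exists (a *m invmx g); first by apply: GammaM => //; exact: GammaV.
by rewrite mulmxA mulmxKV// Gamma_unit.
Qed.

Lemma right_coset_refl g : right_coset g g.
Proof. by exists 1%:M; [exact: Gamma1|rewrite mul1mx]. Qed.

Lemma right_coset_eq g h : right_coset g = right_coset h <->
  exists2 a, Gam a & h = a *m g.
Proof.
split=> [gh|[a aG ->]]; last by rewrite right_coset_mull.
by have := right_coset_refl h; rewrite -gh => -[a aG <-]; exists a.
Qed.

Lemma right_coset_eq_int A A' : right_coset A^i = right_coset A'^i <->
  exists (g : 'M[Zp]_(n + n)) c, [/\ c \is a GRing.unit, similitude g c & A' = g *m A].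
Proof.
rewrite right_coset_eq; split=> [[_ /GammaP[g [c [cU gc ->]]]]|[g [c [cU gc ->]]]].
  by rewrite -map_mxM => /map_padic_inj ->; exists g, c.
by exists g^i; rewrite ?map_mxM//; apply/GammaP; exists g, c.
Qed.

Definition right_cosets a : set (set M) := [set right_coset g | g in sim_set a].

(** The lattice of Z_p^n spanned by the lower block of the block triangular
    representatives of a right coset. *)
Definition coset_lattice X : set 'rV[Zp]_n :=
  [set v | exists2 A, X A^i & low_lattice A v].

Lemma coset_lattice_right A : coset_lattice (right_coset A^i) = low_lattice A.
Proof.
apply/seteqP; split=> [v [B BA]|v Av]; last by exists A => //; exact: right_coset_refl.
have [_ /GammaP[g [c [cU gc ->]]]] := BA; rewrite -map_mxM => /map_padic_inj <-.
by rewrite low_lattice_unit// (similitude_unit gc).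
Qed.

(** A block triangular representative is multiplied by a block diagonal element of
    Gamma. *)
Lemma right_coset_block a X (D : 'M[Zp]_n) : right_cosets a X -> coset_lattice X = row_span D ->
  exists E B, similitude (block_mx E B 0 D) (pp ^+ a) /\ X = right_coset (block_mx E B 0 D)^i.
Proof.
move=> [_ [A [u [uU Au ->]]] <-]; rewrite coset_lattice_right => AD.
have c0 := padic_unit_pk_neq0 a uU.
have [g [E [B [D1 [g1 gA]]]]] := similitude_upper_block c0 Au.
have gU := similitude_unit g1 (unitr1 _).
have Msim : similitude (block_mx E B 0 D1) (u * pp ^+ a).
  by rewrite -gA -[u * _]mul1r; exact: similitudeM.
have [ED _] := (similitude_block _ _ _ _).1 Msim.
have DD1 : row_span D1 = row_span D.
  rewrite -AD -(low_lattice_unit _ gU) gA low_lattice_block//.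
  exact: mulmx_scalar_det c0 ED.
have [h [c [E' [B' [cU hc hM Msim']]]]] := similitude_block_normalize uU Msim DD1.
exists E', B'; split=> //; apply/right_coset_eq_int.
exists (h *m g), (c * 1); split; rewrite ?mulr1//; last by rewrite -hM -gA mulmxA.
by rewrite -[c]mulr1; exact: similitudeM.
Qed.

Lemma coset_lattice_block a (E B D : 'M[Zp]_n) : similitude (block_mx E B 0 D) (pp ^+ a) ->
  coset_lattice (right_coset (block_mx E B 0 D)^i) = row_span D.
Proof.
move=> /similitude_block[ED _]; rewrite coset_lattice_right low_lattice_block//.
exact: mulmx_scalar_det (padic_pk_neq0 _ _) ED.
Qed.

Lemma coset_lattice_finite a X : right_cosets a X ->
  finite_index_sublattice (coset_lattice X) /\ forall v, coset_lattice X (pp ^+ a *: v).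
Proof.
move=> [_ [A [u [uU Au ->]]] <-]; rewrite coset_lattice_right.
have c0 := padic_unit_pk_neq0 a uU.
have [g [E [B [D [g1 gA]]]]] := similitude_upper_block c0 Au.
have gU := similitude_unit g1 (unitr1 _).
have Msim : similitude (block_mx E B 0 D) (u * pp ^+ a).
  by rewrite -gA -[u * _]mul1r; exact: similitudeM.
have [ED _] := (similitude_block _ _ _ _).1 Msim.
rewrite -(low_lattice_unit _ gU) gA low_lattice_block; last exact: mulmx_scalar_det c0 ED.
have DE := mulmx_scalarC c0 ED; split.
  by apply: row_span_finite_index; rewrite -det_tr (mulmx_scalar_det c0 DE).
move=> v; exists (u^-1 *: v *m E^T) => //; rewrite -mulmxA.
have -> : E^T *m D = (u * pp ^+ a)%:M.
  by rewrite -[D]trmxK -trmx_mul DE tr_scalar_mx.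
by rewrite mul_mx_scalar scalerA mulrAC mulrV// mul1r.
Qed.

(** With D fixed, the upper left block is p^a (D^T)^-1, and the coset is determined
    by the upper right block modulo symmetric shears. *)
Lemma right_cosets_fibre a (L : set 'rV[Zp]_n) : finite_index_sublattice L ->
  (forall v, L (pp ^+ a *: v)) ->
  exists (nu : n.-tuple nat) (f : shear_code p nu -> set M), quotient_type L nu /\
    set_bij setT (right_cosets a `&` [set X | coset_lattice X = L]) f.
Proof.
move=> Lfin Lp; have LS := finite_index_submodule Lfin.
have [D [e [Dt De LD]]] := triangular_basis LS (ex_intro _ a Lp).
have D0 : \det D != 0 by rewrite (triangular_basis_det Dt De) padic_pk_neq0.
have [E ED] : exists E, E *m D^T = (pp ^+ a)%:M.
  by apply: block_cofactor => // v; rewrite -LD.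
have [nu [Bf [Lnu Bsym Bsur Binj]]] := shear_classes D0.
have pa0 := padic_pk_neq0 p_pr a.
have Msim c : similitude (block_mx E (Bf c) 0 D) (pp ^+ a).
  by apply/similitude_block; split=> //; apply/(block_sym _ pa0 ED).
exists nu, (fun c => right_coset (block_mx E (Bf c) 0 D)^i); split; first by rewrite LD.
split.
- move=> c _; split; last by rewrite /= (coset_lattice_block (Msim c)) LD.
  exists (block_mx E (Bf c) 0 D)^i => //.
  by exists (block_mx E (Bf c) 0 D), 1; rewrite mul1r unitr1.
- move=> c c' _ _ /right_coset_eq_int[g [d [dU gd gM]]].
  have [_ _ /(_ erefl)[T TT cE]] := block_same_coset n_gt0 dU gd (Msim c) (Msim c') (esym gM).
  exact: Binj TT cE.
- move=> X [Xa XL]; have [E' [B [Bsim ->]]] := right_coset_block Xa (etrans XL LD).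
  have [ED' EB'] := (similitude_block _ _ _ _).1 Bsim.
  have EE' : E' = E.
    have DT0 : \det D^T != 0 by rewrite det_tr.
    have := etrans ED' (esym ED) => /(congr1 (mulmxr (\adj D^T))).
    rewrite /= -!mulmxA mul_mx_adj !mul_mx_scalar => /matrixP h.
    by apply/matrixP => i j; have := h i j; rewrite !mxE => /(mulfI DT0).
  rewrite {}EE' in Bsim EB' *.
  have [c [T [TT BE]]] := Bsur B ((block_sym _ pa0 ED).1 EB').
  exists c => //; apply/right_coset_eq_int.
  have [g g1 gM] := block_shear E (Bf c) D TT.
  by exists g, 1; rewrite unitr1 gM -BE.
Qed.

(** A triangular basis D of the lower lattice gives exponents as in the definition,
    and any others come from a representative in the same coset, hence from a
    triangular basis of the same lattice. *)
Lemma coset_exponentsE a X : right_cosets a X ->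
  coset_exponents X = (a, hermite_delta (coset_lattice X)).
Proof.
move=> Xa; have [Lfin Lp] := coset_lattice_finite Xa.
have LS := finite_index_submodule Lfin.
have [D [e [Dt De LD]]] := triangular_basis LS (ex_intro _ a Lp).
rewrite LD (hermite_deltaE Dt De).
have [E [B [Bsim XE]]] := right_coset_block Xa LD.
have [ED _] := (similitude_block _ _ _ _).1 Bsim.
have pa0 := padic_pk_neq0 p_pr a.
have D0 : \det D != 0 by rewrite (triangular_basis_det Dt De) padic_pk_neq0.
rewrite /coset_exponents; case: xgetP => [[b f] _ [D' [B' [Dt' Df' XM]]]|/(_ (a, e))[]]; last first.
  exists D^i, B^i; split=> /=.
  - by move=> i j ij; rewrite mxE Dt ?rmorph0.
  - by move=> j; rewrite mxE De rmorphXn rmorph_nat.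
  have DU : D^i^T \in unitmx.
    by rewrite unitmx_tr unitmxE det_map_mx unitfE padic_of_int_eq0.
  rewrite (_ : _ *: _ = E^i); last first.
    apply: (can_inj (mulmxK DU)); rewrite -scalemxAl mulVmx// map_trmx -map_mxM ED.
    by rewrite map_scalar_mx/= rmorphXn rmorph_nat scalemx1.
  rewrite XE -(map_mx0 iota) -map_block_mx; exact: right_coset_refl.
rewrite /= in Df' XM.
(* The blocks of the given representative are integral, being those of a product. *)
move: XM; rewrite XE => -[_ /GammaP[g [c [cU gc ->]]]]; rewrite -map_mxM.
rewrite -[g *m _]submxK map_block_mx => /eq_block_mx[hE hB h0 hD].
move E1E : (ulsubmx _) hE => E1 hE; move B1E : (ursubmx _) hB => B1 hB.
move D1E : (drsubmx _) hD => D1 hD.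
have gM : g *m block_mx E B 0 D = block_mx E1 B1 0 D1.
  rewrite -[LHS]submxK E1E B1E D1E; congr block_mx.
  by apply: map_padic_inj; rewrite h0 map_mx0.
have D1t : upper_triangular D1.
  move=> i j ij; apply: padic_of_int_inj; rewrite rmorph0.
  by have := Dt' i j ij; rewrite -hD mxE.
have D1f i : D1 i i = pp ^+ f i.
  apply: padic_of_int_inj; rewrite rmorphXn rmorph_nat.
  by have := Df' i; rewrite -hD mxE.
have Msim1 : similitude (block_mx E1 B1 0 D1) (pp ^+ b).
  have D'U : D'^T \in unitmx.
    rewrite unitmx_tr unitmxE upper_triangular_det// unitfE; apply/prodf_neq0 => i _.
    by rewrite Df' padic_p_pow_neq0.
  have := similitudeM gc Bsim; rewrite gM => /similitude_block[h1 h2].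
  apply/similitude_block; split=> //.
  apply: map_padic_inj; rewrite map_mxM -map_trmx hE hD -scalemxAl mulVmx//.
  by rewrite map_scalar_mx/= rmorphXn rmorph_nat scalemx1.
have [ab DD1 _] := block_same_coset n_gt0 cU gc Bsim Msim1 gM.
by rewrite -ab -(hermite_deltaE D1t D1f) -DD1 (hermite_deltaE Dt De).
Qed.

End Cosets.

(** * The Hecke series *)

Section Hecke.
Variables (p : nat) (p_pr : prime p) (n : nat).
Hypothesis n_gt0 : (0 < n)%N.
Variable R : realType.
Local Notation C := R[i].
Local Notation Zp := (padic_int p_pr).
Local Notation Qp := (padic p_pr).
Local Notation pp := (p%:R : Zp).
Local Notation M := 'M[Qp]_(n + n).
Local Notation Gam := (@Gamma p p_pr n).
Local Notation laur := (laurent n.+1 C).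
Local Notation x0 := (laurent_var C (ord0 : 'I_n.+1)).
Local Notation x_ j := (laurent_var C (lift (ord0 : 'I_n.+1) j)).
Local Notation cst := (@laurent_const n.+1 C).
Implicit Types (g h : M) (X Y : set M) (L : set 'rV[Zp]_n).

Definition lattices a : set (set 'rV[Zp]_n) :=
  [set L | finite_index_sublattice L /\ forall v, L (pp ^+ a *: v)].

(** Such a lattice is the preimage of a set of residues modulo p^a. *)
Lemma lattices_finite a : finite_set (lattices a).
Proof.
pose T := {ffun 'I_n -> 'I_(p ^ a).-1.+1}.
pose red (v : 'rV[Zp]_n) : T := [ffun i => padic_red a (v 0 i)].
pose G (S : {set T}) : set 'rV[Zp]_n := [set v | red v \in S].
apply: (@sub_finite_set _ _ (G @` setT)); last exact/finite_image/finite_finset.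
move=> L [/finite_index_submodule LS Lp].
pose lft (c : T) : 'rV[Zp]_n := \row_i (c i : nat)%:R.
have Lred v : L v <-> L (lft (red v)).
  have [w vE] : exists w, v - lft (red v) = pp ^+ a *: w.
    have /choice[z zE] i : exists z, v 0 i - (red v i : nat)%:R = z * pp ^+ a.
      by apply/padic_redP; rewrite ffunE.
    exists (\row_i z i); apply/rowP => i; rewrite !mxE zE mulrC //.
  split=> [Lv|Ll].
    have -> : lft (red v) = v - pp ^+ a *: w by rewrite -vE opprB addrC subrK.
    exact: submoduleB.
  by rewrite -[v](subrK (lft (red v))) vE; apply: submoduleD.
exists [set c : T | `[< L (lft c) >]]%SET => //.
apply/seteqP; split=> v; rewrite /G /=.
  by rewrite inE => /asboolP; exact: (Lred v).2.
by move=> Lv; rewrite inE; apply/asboolP/(Lred v).1.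
Qed.

(** The right cosets of a given multiplier with lower lattice L number
    p^(shear_exp L). *)
Definition shear_exp L : nat := (\sum_(i < n) tnth (smith_type L) i * (n - i))%N.

Lemma right_cosets_fin_fibre a L : lattices a L ->
  finite_set (right_cosets a `&` [set X | coset_lattice X = L]).
Proof.
move=> [Lfin Lp]; have [nu [f [_ [_ _ fsurj]]]] := right_cosets_fibre n_gt0 Lfin Lp.
apply: sub_finite_set fsurj _.
exact/finite_image/finite_finset.
Qed.

Lemma right_cosets_finite a : finite_set (right_cosets a : set (set M)).
Proof.
have -> : (right_cosets a : set (set M)) = \bigcup_(L in lattices a)
    (right_cosets a `&` [set X | coset_lattice X = L]).
  apply/seteqP; split=> [X Xa|X [L _ []//]].
  by exists (coset_lattice X); [exact: coset_lattice_finite|split].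
by apply: bigcup_finite; [exact: lattices_finite|move=> L; exact: right_cosets_fin_fibre].
Qed.

Lemma right_cosets_sum (V : nmodType) a (F : set M -> V) (w : set 'rV[Zp]_n -> V) :
  (forall X, right_cosets a X -> F X = w (coset_lattice X)) ->
  \sum_(X \in right_cosets a) F X =
  \sum_(L \in lattices a) w L *+ (p ^ shear_exp L).
Proof.
move=> Fw; rewrite (@fsbig_partition _ _ _ _ _ (fun X => coset_lattice X) _ (lattices a)).
- apply: eq_fsbigr => L; rewrite inE => -[Lfin Lp].
  have [nu [f [Lnu fbij]]] := right_cosets_fibre n_gt0 Lfin Lp.
  rewrite (eq_fsbigr (fun=> w L)); last first.
    by move=> X; rewrite inE => -[/Fw -> /= ->].
  rewrite (fsbig_const_bij _ fbij) card_shear_code; congr (_ *+ (p ^ _)).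
  by rewrite /shear_exp (smith_typeE Lnu).
- exact: right_cosets_finite.
- exact: lattices_finite.
- by move=> X /coset_lattice_finite.
Qed.

Lemma sim_set_mul a g h : Gam g -> sim_set a h -> sim_set a (g *m h).
Proof.
move=> /GammaP[A [c [cU Ac ->]]] [B [u [uU Bu ->]]].
exists (A *m B), (c * u); split; first by rewrite unitrM cU.
  by rewrite -mulrA; exact: similitudeM.
by rewrite map_mxM.
Qed.

Lemma sim_set_mulr a g h : Gam g -> sim_set a h -> sim_set a (h *m g).
Proof.
move=> /GammaP[A [c [cU Ac ->]]] [B [u [uU Bu ->]]].
exists (B *m A), (u * c); split; first by rewrite unitrM cU andbT.
  by rewrite mulrAC; exact: similitudeM.
by rewrite map_mxM.
Qed.

Lemma sim_set_normalize a h : sim_set a h ->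
  exists2 g, Gam g & @hecke_D _ p_pr n (p ^ a) (g *m h).
Proof.
move=> ha; have [A [u [uU Au hE]]] := ha.
pose B : 'M[Zp]_(n + n) := block_mx (u^-1 *: (invmx 1%:M)^T) 0 0 1%:M.
have Bsim : similitude B u^-1 by apply: similitude_diag; exact: unitmx1.
have BG : Gam (map_mx (@padic_of_int p p_pr) B) by apply/GammaP; exists B, u^-1; rewrite unitrV.
exists (map_mx (@padic_of_int p p_pr) B) => //; split.
  by apply/(GplusP n_gt0); exists a; exact: sim_set_mul.
rewrite hE -map_mxM /=; have := similitudeM Bsim Au; rewrite mulrA mulVr// mul1r.
move=> /similitude_map; rewrite /similitude rmorphXn rmorph_nat natrX //.
Qed.

Lemma double_cosetE g : double_coset g =
  [set x *m b | x in right_coset g & b in Gam].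
Proof.
apply/seteqP; split=> [_ [[a b] [/= aG bG] <-]|_ [_ [a aG <-] [b bG <-]]].
  by exists (a *m g); [exists a|exists b].
by exists (a, b).
Qed.

Lemma double_coset_mul g a b : Gam a -> Gam b ->
  double_coset (a *m g *m b) = double_coset g.
Proof.
move=> aG bG; apply/seteqP; split=> _ [[c d] [/= cG dG] <-].
  exists (c *m a, b *m d) => /=; first by split; exact: GammaM.
  by rewrite !mulmxA.
exists (c *m invmx a, invmx b *m d) => /=.
  by split; apply: GammaM => //; exact: GammaV.
transitivity (c *m (invmx a *m a) *m g *m (b *m invmx b) *m d).
  by rewrite !mulmxA.
by rewrite mulVmx ?mulmxV ?mulmx1// ?Gamma_unit.
Qed.

Lemma double_coset_refl g : double_coset g g.
Proof. by exists (1%:M, 1%:M) => /=; [split; exact: Gamma1|rewrite mul1mx mulmx1]. Qed.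

(** Right multiplication by Gamma makes a double coset of a right coset.  A similitude
    whose multiplier is p^a times a unit can be moved by Gamma to one with multiplier
    p^a, so every right coset is in one of the double cosets of the Hecke operator. *)
Lemma hecke_cosets_partition (V : nmodType) a (F : set M -> V) :
  \sum_(X \in right_cosets a) F X =
  \sum_(Y \in [set double_coset g | g in @hecke_D _ p_pr n (p ^ a)])
    \sum_(X \in [set right_coset g | g in Y]) F X.
Proof.
pose hull X : set M := [set x *m b | x in X & b in Gam].
have hullE g : hull (right_coset g) = double_coset g by rewrite double_cosetE.
have DCE : [set double_coset g | g in @hecke_D _ p_pr n (p ^ a)] = hull @` right_cosets a.
  apply/seteqP; split=> [_ [g gD <-]|_ [_ [g ga <-] <-]].
    by exists (right_coset g) => //; exists g => //; exact: hecke_D_sim.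
  have [b bG bgD] := sim_set_normalize ga; exists (b *m g) => //.
  by rewrite hullE -[b *m g]mulmx1 double_coset_mul//; exact: Gamma1.
rewrite DCE (@fsbig_partition _ _ _ _ _ hull _ (hull @` right_cosets a)).
- apply: eq_fsbigr => Y; rewrite inE => -[_ [g0 g0a <-]]; rewrite hullE => <-.
  apply: eq_fsbigl; apply/seteqP; split=> [_ [[g ga <-] /=]|_ [g + <-]].
    by rewrite hullE => gg0; exists g => //; rewrite -gg0; exact: double_coset_refl.
  move=> [[b c] [/= bG cG] <-]; split=> /=.
    exists (b *m g0 *m c) => //; apply: sim_set_mulr => //; exact: sim_set_mul.
  by rewrite hullE double_coset_mul.
- exact: right_cosets_finite.
- exact/finite_image/right_cosets_finite.
- by move=> X Xa; exists X.
Qed.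

Fact laurent_const_is_zmod : zmod_morphism cst.
Proof. by move=> c d; rewrite /laurent_const monalgUB. Qed.
HB.instance Definition _ := GRing.isZmodMorphism.Build C laur cst laurent_const_is_zmod.

Definition delta_weight L : laur :=
  \prod_(j < n) (cst (p%:R ^- j.+1) * x_ j) ^+ hermite_delta L j.

Definition lattice_weight L : laur := cst (p%:R ^+ shear_exp L) * delta_weight L.

Lemma satake_hecke_T a : satake (@hecke_T _ p_pr n R (p ^ a)) =
  \sum_(X \in (right_cosets a : set (set M))) satake_coset R X.
Proof.
rewrite hecke_cosets_partition /hecke_T /satake.
have DCfin : finite_set [set double_coset g | g in @hecke_D _ p_pr n (p ^ a)].
  apply: (@sub_finite_set _ _ ((fun X : set M => [set x *m b | x in X & b in Gam]) @` right_cosets a)).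
    move=> _ [g gD <-]; exists (right_coset g); last by rewrite double_cosetE.
    by exists g => //; exact: hecke_D_sim.
  exact/finite_image/right_cosets_finite.
rewrite !fsbig_finite// raddf_sum; apply: eq_bigr => Y _.
have h := @mmapU _ _ _ (cst : {additive C -> laur})
  (fun Y => \sum_(X \in [set right_coset g | g in Y]) satake_coset R X) 1 Y.
by rewrite /= h; exact: mul1r.
Qed.

Lemma satake_cosetE a X : right_cosets a X ->
  satake_coset R X = x0 ^+ a * delta_weight (coset_lattice X).
Proof. by move=> Xa; rewrite /satake_coset (coset_exponentsE n_gt0 Xa). Qed.

Lemma laurent_mulrn (y : laur) m : y *+ m = cst m%:R * y.
Proof. by rewrite raddfMn/= -/(1 : laur) -mulr_natl. Qed.

Lemma hecke_series_coef a :
  hecke_series p_pr n R (deg1 a) = satake (@hecke_T _ p_pr n R (p ^ a)).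
Proof.
rewrite /hecke_series /formal_sum (@fsbig_single _ _ _ _ a)//=; last first.
  by move=> b _ ba; rewrite series1_exp series1_mono; case: eqP => // ab; case: ba.
by rewrite series1_exp series1_mono eqxx mulr1n.
Qed.

Lemma hecke_seriesE a : hecke_series p_pr n R (deg1 a) =
  x0 ^+ a * \sum_(L \in lattices a) lattice_weight L.
Proof.
rewrite hecke_series_coef satake_hecke_T.
rewrite (right_cosets_sum (w := fun L => x0 ^+ a * delta_weight L)); last first.
  by move=> X; exact: satake_cosetE.
have Lfin := lattices_finite a.
rewrite !(fsbig_finite _ _ Lfin) /= [RHS]mulr_sumr; apply: eq_bigr => L _.
by rewrite laurent_mulrn natrX /lattice_weight mulrCA.
Qed.

End Hecke.

(** * The Hermite-Smith series *)

Section AbelSummation.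
Variables (n : nat) (f : nat -> nat).
Hypothesis f0 : f 0%N = 0%N.
Hypothesis f_mono : forall j, (j < n)%N -> (f j <= f j.+1)%N.

Lemma sum_differences : (\sum_(j < n) (f j.+1 - f j) = f n)%N.
Proof.
suff H m : (m <= n)%N -> (\sum_(j < m) (f j.+1 - f j) = f m)%N by apply: H.
elim: m => [|m IHm] mn; first by rewrite big_ord0 f0.
by rewrite big_ord_recr/= IHm ?(ltnW mn)// addnC subnK// f_mono.
Qed.

(** Summation by parts, with binom(m + 1, 2) - binom(m, 2) = m. *)
Lemma sum_binomial_differences :
  (\sum_(j < n) 'C((n - j).+1, 2) * (f j.+1 - f j) = \sum_(j < n) f j.+1 * (n - j))%N.
Proof.
suff H m : (m <= n)%N -> (\sum_(j < m) 'C((n - j).+1, 2) * (f j.+1 - f j) =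
    \sum_(j < m) f j.+1 * (n - j) + 'C((n - m).+1, 2) * f m)%N.
  by rewrite H// subnn bin_small// mul0n addn0.
elim: m => [|m IHm] mn; first by rewrite !big_ord0 f0 muln0.
rewrite !big_ord_recr/= IHm ?(ltnW mn)// -!addnA; congr (_ + _)%N.
rewrite -mulnDr addnC subnK ?f_mono// binS bin1 mulnDl addnC; congr (_ + _)%N.
  exact: mulnC.
by rewrite subnSK.
Qed.
End AbelSummation.

Section HermiteSmith.
Variables (p : nat) (p_pr : prime p) (n : nat).
Hypothesis n_gt0 : (0 < n)%N.
Variable R : realType.
Local Notation C := R[i].
Local Notation Zp := (padic_int p_pr).
Local Notation pp := (p%:R : Zp).
Local Notation laur := (laurent n.+1 C).
Local Notation x0 := (laurent_var C (ord0 : 'I_n.+1)).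
Local Notation x_ j := (laurent_var C (lift (ord0 : 'I_n.+1) j)).
Local Notation cst := (@laurent_const n.+1 C).
Local Notation I := ('I_n + 'I_n)%type.
Local Notation expo := {ffun I -> nat}.
Local Notation FI := [set L : set 'rV[Zp]_n | finite_index_sublattice L].
Local Notation lats := (@lattices p p_pr n).
Implicit Types (L : set 'rV[Zp]_n) (m : expo).

Lemma quotient_type_exists L : finite_index_sublattice L -> exists nu, quotient_type L nu.
Proof.
move=> Lfin; have LS := finite_index_submodule Lfin.
have [A [e [At Ae ->]]] := triangular_basis LS (finite_index_pk Lfin).
have A0 : \det A != 0 by rewrite (triangular_basis_det At Ae) padic_pk_neq0.
have [U [V [nu [uU uV snu ->]]]] := padic_smith_square A0.
by exists nu; apply: quotient_type_smith.
Qed.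

Lemma smith_typeP L : finite_index_sublattice L -> quotient_type L (smith_type L).
Proof. by move=> /quotient_type_exists[nu Lnu]; rewrite (smith_typeE Lnu). Qed.

Definition elem_div L (j : nat) : nat := nth 0%N (0%N :: smith_type L) j.

Lemma elem_div_mono L j : finite_index_sublattice L -> (j < n)%N ->
  (elem_div L j <= elem_div L j.+1)%N.
Proof.
move=> /smith_typeP[snu _] jn; case: j jn => [|j] jn //.
rewrite /elem_div /=; move/(sortedP 0%N): snu; apply.
by rewrite size_tuple.
Qed.

Lemma elem_div_le L i j : finite_index_sublattice L -> (i <= j)%N -> (j <= n)%N ->
  (elem_div L i <= elem_div L j)%N.
Proof.
move=> Lfin; elim: j => [|j IHj]; first by rewrite leqn0 => /eqP ->.
rewrite leq_eqVlt => /orP[/eqP -> //|ij jn].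
by apply: leq_trans (elem_div_mono Lfin jn); apply: IHj => //; exact: ltnW.
Qed.

Lemma smith_mu_rev L (i : 'I_n) :
  smith_mu L (rev_ord i) = (elem_div L i.+1 - elem_div L i)%N.
Proof.
by rewrite /smith_mu /= -!/(elem_div L _) subnSK// !subKn// ltnW.
Qed.

Lemma sum_smith_mu L : finite_index_sublattice L -> (\sum_i smith_mu L i = elem_div L n)%N.
Proof.
move=> Lfin; rewrite -(@sum_differences n (elem_div L))//; last by move=> j; exact: elem_div_mono.
rewrite (reindex_inj rev_ord_inj)/=; apply: eq_bigr => i _.
by rewrite smith_mu_rev.
Qed.

Lemma sum_binomial_smith_mu L : finite_index_sublattice L ->
  (\sum_(i < n) 'C(i.+2, 2) * smith_mu L i = shear_exp L)%N.
Proof.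
move=> Lfin; transitivity (\sum_(j < n) elem_div L j.+1 * (n - j))%N; last first.
  by apply: eq_bigr => i _; rewrite /elem_div /= -tnth_nth.
rewrite -sum_binomial_differences//; last by move=> j; exact: elem_div_mono.
rewrite (reindex_inj rev_ord_inj)/=; apply: eq_bigr => i _.
by rewrite smith_mu_rev subnSK.
Qed.

(** The sublattices whose quotient has exponent exactly p^k. *)
Definition layer k : set (set 'rV[Zp]_n) := [set L | finite_index_sublattice L /\ elem_div L n = k].

Lemma latticesE k : lats k = [set L | finite_index_sublattice L /\ (elem_div L n <= k)%N].
Proof.
apply/seteqP; split=> L [Lfin Lk]; split=> //.
  have lt_n : (n.-1 < n)%N by rewrite prednK.
  have := (quotient_type_pk k (smith_typeP Lfin)).1 Lk (Ordinal lt_n).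
  have nthE j (s : seq nat) : (0 < j)%N -> nth 0%N (0%N :: s) j = nth 0%N s j.-1 by case: j.
  by rewrite (tnth_nth 0%N) /elem_div nthE.
apply/(quotient_type_pk k (smith_typeP Lfin)) => i.
rewrite (tnth_nth 0%N) -[nth _ _ _]/(elem_div L i.+1).
by apply: leq_trans Lk; apply: elem_div_le.
Qed.

Lemma layer_finite k : finite_set (layer k).
Proof.
apply: sub_finite_set (@lattices_finite p p_pr n k) => L [Lfin Lk].
by rewrite latticesE; split=> //; rewrite Lk.
Qed.

Lemma lattices0 : lats 0 = layer 0.
Proof.
rewrite latticesE; apply/seteqP; split=> L [Lfin Lk]; split=> //; last by rewrite Lk.
by apply/eqP; rewrite -leqn0.
Qed.

Lemma latticesS (V : nmodType) (F : set 'rV[Zp]_n -> V) k :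
  \sum_(L \in lats k.+1) F L =
  \sum_(L \in lats k) F L + \sum_(L \in layer k.+1) F L.
Proof.
have -> : lats k.+1 = lats k `|` layer k.+1.
  rewrite !latticesE; apply/seteqP; split=> L.
    by move=> [Lfin]; rewrite leq_eqVlt => /orP[/eqP|]; [right|left].
  by move=> [[Lfin Lk]|[Lfin Lk]]; split=> //; [exact: leqW|rewrite Lk].
rewrite fsbigU0//; [exact: lattices_finite|exact: layer_finite|].
by rewrite latticesE => L /= [[_ +] [_ Lk]]; rewrite Lk ltnn.
Qed.

Definition hs_expo L : expo :=
  [ffun s : I => match s with inl i => smith_mu L i | inr i => hermite_delta L i end].

(** The exponent of the monomial X_n Y_1 ... Y_n. *)
Definition hs_shift : expo :=
  [ffun s : I => match s with inl i => nat_of_bool (i.+1 == n) | inr _ => 1%N end].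

Lemma hs_monomial (a b : 'I_n -> nat) :
  \prod_i (hs_X R i ^+ a i * hs_Y R i ^+ b i) =
  series_mono 1 [ffun s : I => match s with inl i => a i | inr i => b i end].
Proof.
rewrite /hs_X /hs_Y; under eq_bigr do
  rewrite !series_varE !series_mono_exp series_mono_mul !expr1n mulr1.
rewrite series_mono_prod big1//; congr (series_mono _ _).
have sumE (F : 'I_n -> expo) s : (\sum_i F i) s = (\sum_i F i s)%N.
  by elim/big_rec2: _ => [|i y1 y2 _ <-]; rewrite ffunE.
have mulE (e : expo) k s : (e *+ k) s = (e s * k)%N.
  by elim: k => [|k IHk]; rewrite ?mulr0n ?mulrS ffunE ?muln0// IHk mulnS.
apply/ffunP => s; rewrite sumE ffunE.
have inlE (i j : 'I_n) : (inl i == inl j :> I) = (i == j).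
  by apply/eqP/eqP => [[]|->].
have inrE (i j : 'I_n) : (inr i == inr j :> I) = (i == j).
  by apply/eqP/eqP => [[]|->].
case: s => i; rewrite (bigD1 i)//= big1 => [|j ji]; rewrite !ffunE !mulE !ffunE/=.
- by rewrite inlE eqxx mul1n -[LHS]/(a i + 0 + 0)%N !addn0.
- by rewrite inlE eq_sym (negPf ji).
- by rewrite inrE eqxx mul1n -[LHS]/(0 + b i + 0)%N addn0.
- by rewrite inrE eq_sym (negPf ji).
Qed.

Lemma hs_shiftE :
  (\prod_(i < n | i.+1 == n) hs_X R i) * \prod_i hs_Y R i = series_mono 1 hs_shift.
Proof.
rewrite -(hs_monomial (fun i => nat_of_bool (i.+1 == n)) (fun=> 1%N)) big_mkcond -big_split/=.
by apply: eq_bigr => i _; case: eqP; rewrite ?expr1 ?expr0 ?mul1r.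
Qed.

Definition lattice_series (e : set 'rV[Zp]_n -> expo) : series I C :=
  formal_sum FI (fun L => series_mono 1 (e L)).

Lemma HSE : HS p_pr n R = lattice_series hs_expo.
Proof.
apply/funext => m; rewrite /HS /lattice_series /formal_sum; apply: eq_fsbigr => L _.
by rewrite hs_monomial.
Qed.

Lemma lattice_series_shift e u :
  series_mono 1 u * lattice_series e = lattice_series (fun L => u + e L).
Proof.
apply/funext => m; have [[v <-]|um] := pselect (exists v, u + v = m).
  rewrite series_mono_mulD mul1r; apply: eq_fsbigr => L _.
  rewrite /series_mono; congr (_ *+ _); congr nat_of_bool.
  by apply/eqP/eqP => [->//|/ffun_addI].
rewrite series_mono_mul0; last by move=> v uv; apply: um; exists v.
rewrite /lattice_series /formal_sum fsbig1// => L _; rewrite /series_mono.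
by case: eqP => // mE; case: um; exists (e L).
Qed.

Lemma HSprE : HSpr p_pr n R =
  lattice_series hs_expo - lattice_series (fun L => hs_shift + hs_expo L).
Proof. by rewrite /HSpr hs_shiftE mulrBl mul1r HSE lattice_series_shift. Qed.

(** Phi sends a monomial of degree k in the X_i to a multiple of X^k. *)
Definition xdeg m : nat := (\sum_i m (inl i))%N.

Definition phi_coef (s : I) : laur :=
  match s with
  | inl i => cst (p%:R ^+ 'C(i.+2, 2)) * x0
  | inr i => cst (p%:R ^- i.+1) * x_ i
  end.

Definition phi_mono m : laur := \prod_s phi_coef s ^+ m s.

Lemma PhiE (f : series I C) k :
  Phi p f (deg1 k) = \sum_(m \in setT) (cst (f m) * phi_mono m) *+ (k == xdeg m).
Proof.
rewrite /Phi /series_subst /formal_sum; apply: eq_fsbigr => m _.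
rewrite -series1_mono; congr (_ _).
rewrite (eq_bigr (fun s : I => series_mono (phi_coef s ^+ m s)
    (deg1 (if s is inl _ then m s else 0%N)))); last first.
  have deg1Mn c k' : deg1 c *+ k' = deg1 (c * k')%N.
    by elim: k' => [|j IHj]; rewrite ?mulr0n ?mulrS ?IHj ?deg1D ?muln0 ?mulnS.
  case=> [i|i] _.
    rewrite -[series_var _ _]expr1 series1_exp series_mono_exp deg1Mn mul1n //.
  by rewrite series_constE series_mono_exp mul0rn.
rewrite series_mono_prod series_constE series_mono_mul add0r; congr (series_mono _ _).
rewrite big_sumType/= [X in _ + X]big1 ?addr0; last first.
  by move=> i _; apply/ffunP => x; rewrite !ffunE.
rewrite /xdeg; elim/big_rec2: _ => [|i y1 y2 _ ->]; first by apply/ffunP => x; rewrite !ffunE.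
by rewrite deg1D.
Qed.

Lemma phi_monoD u v : phi_mono (u + v) = phi_mono u * phi_mono v.
Proof.
rewrite /phi_mono -big_split/=; apply: eq_bigr => s _.
by rewrite ffunE -exprD.
Qed.

Lemma lattice_series_widen (e : set 'rV[Zp]_n -> expo) k m : xdeg m = k ->
  lattice_series e m =
  \sum_(L \in [set L | finite_index_sublattice L /\ xdeg (e L) = k]) (1 *+ (m == e L) : C).
Proof.
move=> mk; rewrite /lattice_series /formal_sum; apply/esym/fsbig_widen; first by move=> L [].
move=> L [Lfin /= Lk]; case: eqP => // me; case: Lk; split=> //; by rewrite -me.
Qed.

(** Summing over monomials first or over sublattices first; the set B leaves room for
    a second family of sublattices. *)
Lemma lattice_series_sum (e : set 'rV[Zp]_n -> expo) k (B : set expo) :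
  let A := [set L | finite_index_sublattice L /\ xdeg (e L) = k] in
  finite_set A -> finite_set B -> e @` A `<=` B -> (forall m, B m -> xdeg m = k) ->
  \sum_(m \in B) (cst (lattice_series e m) * phi_mono m) = \sum_(L \in A) phi_mono (e L).
Proof.
move=> A Afin Bfin eAB Bk; rewrite [RHS](@fsbig_partition _ _ _ _ _ e _ B)//; last first.
  by move=> L AL; apply: eAB; exists L.
apply: eq_fsbigr => m; rewrite inE => /Bk mk; rewrite (lattice_series_widen e mk) -/A.
rewrite fsbig_mkcondr !(fsbig_finite _ _ Afin) raddf_sum mulr_suml; apply: eq_bigr => L _.
case: (eqVneq m (e L)) => [->|meL]; first by rewrite mem_set//= mulr1n mul1r.
rewrite memNset ?mulr0n ?raddf0 ?mul0r// => /= e'; by rewrite e' eqxx in meL.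
Qed.

(** Phi can be applied term by term, since finitely many sublattices contribute to each
    degree in X. *)
Lemma Phi_lattice_seriesB (e1 e2 : set 'rV[Zp]_n -> expo) k :
  let A e := [set L | finite_index_sublattice L /\ xdeg (e L) = k] in
  finite_set (A e1) -> finite_set (A e2) ->
  Phi p (lattice_series e1 - lattice_series e2) (deg1 k) =
  \sum_(L \in A e1) phi_mono (e1 L) - \sum_(L \in A e2) phi_mono (e2 L).
Proof.
move=> A A1 A2; pose B := e1 @` A e1 `|` e2 @` A e2.
have Bfin : finite_set B by rewrite finite_setU; split; exact: finite_image.
have Bk m : B m -> xdeg m = k by case=> -[L [_ <-] <-].
rewrite -(lattice_series_sum A1 Bfin _ Bk); last exact: subsetUl.
rewrite -(lattice_series_sum A2 Bfin _ Bk); last exact: subsetUr.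
rewrite PhiE -(@fsbig_widen _ _ _ _ B setT)//; last first.
  move=> m [_ mB] /=; case: eqP => [km|]; last by rewrite mulr0n.
  have le0 e : (A e : set _) `<=` A e -> ~ (e @` A e) m -> lattice_series e m = 0.
    move=> _ eA; rewrite (lattice_series_widen e (esym km)) fsbig1// => L AL.
    by case: eqP => // me; case: eA; exists L.
  by rewrite seriesD seriesN !le0 ?subr0 ?raddf0 ?mul0r//; move=> h; apply: mB; [right|left].
rewrite [LHS](fsbig_finite _ _ Bfin) [X in _ = X - _](fsbig_finite _ _ Bfin).
rewrite [X in _ = _ - X](fsbig_finite _ _ Bfin) -sumrB; apply: eq_big_seq => m.
rewrite in_fset_set// inE => /Bk ->; rewrite eqxx mulr1n seriesD seriesN.
by rewrite -mulrBl -raddfB.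
Qed.

Lemma xdeg_hs_expo L : finite_index_sublattice L -> xdeg (hs_expo L) = elem_div L n.
Proof.
by move=> Lfin; rewrite -sum_smith_mu//; apply: eq_bigr => i _; rewrite ffunE.
Qed.

Lemma xdegD u v : xdeg (u + v) = (xdeg u + xdeg v)%N.
Proof. by rewrite /xdeg -big_split/=; apply: eq_bigr => i _; rewrite ffunE. Qed.

Lemma xdeg_hs_shift : xdeg hs_shift = 1%N.
Proof.
have lt_n : (n.-1 < n)%N by rewrite prednK.
rewrite /xdeg (bigD1 (Ordinal lt_n))//= ffunE prednK// eqxx big1 ?addn0// => i.
by rewrite ffunE -val_eqE/= -eqSS prednK// => /negPf ->.
Qed.

(** The constants p^binom(i+1,2) coming from the X_i multiply to the number of right
    cosets over L. *)
Lemma phi_mono_expo L : finite_index_sublattice L ->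
  phi_mono (hs_expo L) = x0 ^+ elem_div L n * lattice_weight R L.
Proof.
move=> Lfin; rewrite /phi_mono big_sumType/= /lattice_weight mulrA; congr (_ * _); last first.
  by apply: eq_bigr => i _; rewrite ffunE.
rewrite -sum_smith_mu// -sum_binomial_smith_mu// -!prodrXr.
transitivity (\prod_(i < n) (x0 ^+ smith_mu L i * cst (p%:R ^+ ('C(i.+2, 2) * smith_mu L i)))).
  by apply: eq_bigr => i _; rewrite ffunE exprMn -laurent_constX -exprM mulrC.
rewrite big_split/=; congr (_ * _).
by rewrite (big_morph cst (@laurent_constM _ _) erefl).
Qed.

Lemma phi_mono_shift : phi_mono hs_shift = x0 * \prod_(j < n) x_ j.
Proof.
have lt_n : (n.-1 < n)%N by rewrite prednK.
have nE : (Ordinal lt_n).+1 = n by rewrite /= prednK.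
have shiftl (i : 'I_n) : hs_shift (inl i) = (i.+1 == n) by rewrite ffunE.
have shiftr (i : 'I_n) : hs_shift (inr i) = 1%N by rewrite ffunE.
have A : \prod_(i < n) phi_coef (inl i) ^+ hs_shift (inl i) = cst (p%:R ^+ 'C(n.+1, 2)) * x0.
  rewrite (@bigD1 _ _ _ _ (Ordinal lt_n) xpredT _ isT) big1 => [|i ni]; last first.
    have ni' : (i.+1 == n) = false.
      apply/negbTE; apply: contra ni => /eqP iE.
      by apply/eqP/val_inj/succn_inj; exact: etrans iE (esym nE).
    by rewrite shiftl ni'.
  rewrite [LHS]mulr1 shiftl; have -> : ((Ordinal lt_n).+1 == n) = true by apply/eqP.
  by rewrite expr1 /phi_coef; move: nE => /= ->.
have B : \prod_(i < n) phi_coef (inr i) ^+ hs_shift (inr i) = \prod_(i < n) (cst (p%:R ^- i.+1) * x_ i).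
  apply: eq_bigr => i _.
  rewrite shiftr expr1 /phi_coef; reflexivity.
rewrite /phi_mono big_sumType; apply: (etrans (congr2 (fun a b : laur => a * b) A B)).
rewrite big_split/= -(big_morph cst (@laurent_constM _ _) erefl).
rewrite mulrACA -laurent_constM mulrA; congr (_ * _).
rewrite [X in cst X](_ : _ = 1); first exact: mul1r.
rewrite prodfV prodrXr -bin2_sum big_mkord big_ord_recl/= add0n.
by rewrite divff ?expf_neq0 ?pnatr_eq0 -?lt0n ?prime_gt0.
Qed.

Lemma layer_hs_expo k :
  [set L | finite_index_sublattice L /\ xdeg (hs_expo L) = k] = layer k.
Proof. by apply/seteqP; split=> L [Lfin <-]; split=> //; rewrite xdeg_hs_expo. Qed.

Lemma layer_hs_shift k :
  [set L | finite_index_sublattice L /\ xdeg (hs_shift + hs_expo L) = k] =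
  if k is k'.+1 then layer k' else set0.
Proof.
apply/seteqP; split=> L.
  move=> [Lfin]; rewrite xdegD xdeg_hs_shift xdeg_hs_expo// add1n => <-.
  by split.
case: k => // k [Lfin <-]; split=> //.
by rewrite xdegD xdeg_hs_shift xdeg_hs_expo.
Qed.

(** Multiplying the Hecke series by 1 - x_0 X leaves the sum over the sublattices
    of exact exponent, which is the image of the Hermite-Smith series. *)
Theorem Phi_HSpr : Phi p (HSpr p_pr n R) = hecke_series_pr p_pr n R.
Proof.
pose H k : laur := x0 ^+ k * \sum_(L \in layer k) lattice_weight R L.
pose y : laur := x0 * \prod_(j < n) x_ j.
have fsumM (a : laur) k (F : set 'rV[Zp]_n -> laur) :
    a * \sum_(L \in layer k) F L = \sum_(L \in layer k) a * F L.
  have Lfin := layer_finite k.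
  by rewrite !(fsbig_finite _ _ Lfin) /= [LHS]mulr_sumr.
have HSk k : Phi p (HSpr p_pr n R) (deg1 k) = H k - (if k is k'.+1 then y * H k' else 0).
  rewrite HSprE Phi_lattice_seriesB ?layer_hs_expo ?layer_hs_shift; first last.
  - by case: k => [|k]; [exact: finite_set0|exact: layer_finite].
  - exact: layer_finite.
  congr (_ - _).
    rewrite /H fsumM; apply: eq_fsbigr => L; rewrite inE => -[Lfin Lk].
    rewrite (phi_mono_expo Lfin) Lk; reflexivity.
  case: k => [|k]; first by rewrite fsbig_set0.
  rewrite /H !fsumM; apply: eq_fsbigr => L; rewrite inE => -[Lfin Lk].
  rewrite phi_monoD phi_mono_shift (phi_mono_expo Lfin) Lk; reflexivity.
pose G : series unit laur := (1 - series_const x0 * series_var laur tt) * hecke_series p_pr n R.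
have HE a : hecke_series p_pr n R (deg1 a) = x0 ^+ a * \sum_(L \in lats a) lattice_weight R L.
  exact: hecke_seriesE.
have Gk k : G (deg1 k) = H k.
  rewrite /G series1_linear_mul HE; case: k => [|k].
    rewrite subr0 lattices0; reflexivity.
  rewrite HE latticesS mulrDr mulrA -exprS addrC addrA addNr add0r.
  reflexivity.
have prE : hecke_series_pr p_pr n R = (1 - series_const y * series_var laur tt) * G.
  exact: series1_linear_mul2.
apply: series1P => k; rewrite HSk prE series1_linear_mul Gk.
case: k => [|k]; first by reflexivity.
rewrite Gk; reflexivity.
Qed.

End HermiteSmith.

(** * Ehrhart polynomials of lattice polytopes *)

Section LexMin.
Variables (R : realFieldType) (k D : nat) (W : 'M[R]_(k, D)).
Local Notation rv := 'rV[R]_k.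
Implicit Types (a b : rv) (S : {set 'I_k}).

Definition nonneg a := forall i, 0 <= a 0 i.
Definition supp a : {set 'I_k} := [set i | a 0 i != 0]%SET.
Definition lexneg a := exists2 i, a 0 i < 0 & forall j : 'I_k, (j < i)%N -> a 0 j = 0.

(** The supports of the lexicographically minimal nonnegative solutions of a W = x;
    whether a support is minimal does not depend on x. *)
Definition lex_minimal S :=
  forall a, a *m W = 0 -> (forall i, i \notin S -> 0 <= a 0 i) -> ~ lexneg a.

Definition independent S :=
  forall a, a *m W = 0 -> (forall i, i \notin S -> a 0 i = 0) -> a = 0.

Lemma lexnegD a b : lexneg a -> lexneg b -> lexneg (a + b).
Proof.
move=> [i ai a0] [j bj b0]; case: (ltngtP i j) => ij.
- exists i; first by rewrite mxE (b0 i ij) addr0.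
  by move=> l li; rewrite mxE a0// b0 ?addr0// (ltn_trans li).
- exists j; first by rewrite mxE (a0 j ij) add0r.
  by move=> l lj; rewrite mxE b0// a0 ?addr0// (ltn_trans lj).
- move/val_inj: ij bj b0 => <- bi b0; exists i; first by rewrite mxE; lra.
  by move=> l li; rewrite mxE a0// b0// addr0.
Qed.

Lemma lexnegZ t a : 0 < t -> lexneg a -> lexneg (t *: a).
Proof.
move=> t0 [i ai a0]; exists i; first by rewrite mxE pmulr_rlt0.
by move=> j ji; rewrite mxE a0// mulr0.
Qed.

Lemma lexneg0 : ~ lexneg 0.
Proof. by case=> j; rewrite mxE ltxx. Qed.

Lemma lexneg_total a : a != 0 -> lexneg a \/ lexneg (- a).
Proof.
move=> a0; have [i0 ai0] : exists i, a 0 i != 0.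
  apply: contrapT => h; move: a0; apply/negP/negPn/eqP/rowP => i.
  by rewrite mxE; apply/eqP/negPn/negP => ai; apply: h; exists i.
case: (@arg_minnP _ i0 (fun i => a 0 i != 0) val ai0) => i ai imin.
have a0' (j : 'I_k) : (j < i)%N -> a 0 j = 0.
  by move=> ji; apply/eqP/negPn/negP => /imin; rewrite leqNgt ji.
have [neg|pos|/eqP] := ltgtP (a 0 i) 0; last by rewrite (negPf ai).
  by left; exists i.
by right; exists i; [rewrite mxE oppr_lt0|move=> j ji; rewrite mxE a0' ?oppr0].
Qed.

(** One of a relation and its opposite is lexicographically negative. *)
Lemma lex_minimal_independent S : lex_minimal S -> independent S.
Proof.
move=> Smin a aW aS; apply/eqP/negPn/negP => /lexneg_total[] neg.
  by apply: (Smin a aW _ neg) => i /aS ->.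
apply: (Smin (- a) _ _ neg); first by rewrite mulNmx aW oppr0.
by move=> i /aS; rewrite mxE => ->; rewrite oppr0.
Qed.

(** The difference of two minimal solutions or its opposite would be a
    lexicographically negative relation allowed by one of the two supports. *)
Lemma lex_minimal_inj a b : nonneg a -> nonneg b -> a *m W = b *m W ->
  lex_minimal (supp a) -> lex_minimal (supp b) -> a = b.
Proof.
move=> a0 b0 ab amin bmin; apply/eqP/negPn/negP; rewrite -subr_eq0 => /lexneg_total[] neg.
  apply: (bmin (a - b) _ _ neg); first by rewrite mulmxBl ab subrr.
  by move=> i; rewrite inE negbK !mxE => /eqP ->; rewrite subr0.
apply: (amin (- (a - b)) _ _ neg); first by rewrite mulNmx mulmxBl ab subrr oppr0.
by move=> i; rewrite inE negbK !mxE => /eqP ->; rewrite sub0r opprK.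
Qed.

(** Moving along a lexicographically negative relation until a coordinate vanishes. *)
Lemma lex_descent a b : nonneg a -> lexneg b ->
    (forall i, i \notin supp a -> 0 <= b 0 i) ->
  exists t, [/\ 0 < t, nonneg (a + t *: b) &
    exists2 i, i \in supp a & (a + t *: b) 0 i = 0].
Proof.
move=> a0 bneg bS; have [i0 bi0 _] := bneg.
have bsupp i : b 0 i < 0 -> 0 < a 0 i.
  move=> bi; rewrite lt_neqAle a0 andbT eq_sym.
  by have := bS i; rewrite inE negbK; case: eqP => // _ /(_ isT); rewrite leNgt bi.
case: (@Order.TotalTheory.arg_minP _ _ _ i0 (fun i => b 0 i < 0) (fun i => a 0 i / - b 0 i) bi0) => i bi imin.
pose t := a 0 i / - b 0 i.
have t0 : 0 < t by rewrite divr_gt0 ?bsupp ?oppr_gt0.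
exists t; split=> //.
- move=> j; rewrite !mxE; have [bj|bj] := ltP (b 0 j) 0; last first.
    by rewrite addr_ge0 ?a0// mulr_ge0// ltW.
  by have := imin j bj; rewrite ler_pdivlMr ?oppr_gt0// -/t mulrN; lra.
- exists i; first by rewrite inE gt_eqF ?bsupp.
  by rewrite !mxE /t invrN mulrN mulNr divfK ?subrr// lt_eqF.
Qed.

(** While the support carries a relation, one descends along it, which loses an element
    of the support. *)
Lemma lex_caratheodory a : nonneg a -> exists c, [/\ nonneg c, c *m W = a *m W,
  independent (supp c) & c = a \/ lexneg (c - a)].
Proof.
have [N] := ubnP #|supp a|; elim: N => // N IHN in a *; rewrite ltnS => aN a0.
have [ind|] := pselect (independent (supp a)); first by exists a; split=> //; left.
move=> /existsNP[b0 /not_implyP[b0W /not_implyP[b0S /eqP b0n]]].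
have [b [bW bS bneg]] : exists b, [/\ b *m W = 0, forall i, i \notin supp a -> b 0 i = 0 & lexneg b].
  case: (lexneg_total b0n) => neg; first by exists b0.
  exists (- b0); split=> //; first by rewrite mulNmx b0W oppr0.
  by move=> i /b0S; rewrite mxE => ->; rewrite oppr0.
have bS' i : i \notin supp a -> 0 <= b 0 i by move=> /bS ->.
have [t [t0 c0 [i ia ci]]] := lex_descent a0 bneg bS'.
have cW : (a + t *: b) *m W = a *m W by rewrite mulmxDl -scalemxAl bW scaler0 addr0.
have cneg : lexneg (a + t *: b - a) by rewrite addrC addKr; exact: lexnegZ.
have csub : supp (a + t *: b) \proper supp a.
  apply/properP; split; last by exists i; rewrite // inE ci eqxx.
  apply/fintype.subsetP => j; rewrite inE; apply: contraNT => ja.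
  by rewrite !mxE bS// mulr0 addr0; move: ja; rewrite inE negbK.
have [c [c'0 cW' cind cle]] := IHN (a + t *: b) (leq_trans (proper_card csub) aN) c0.
exists c; split=> //; first by rewrite cW'.
right; case: cle => [->//|cneg'].
by have := lexnegD cneg' cneg; rewrite addrA subrK.
Qed.

(** The lexicographic minimum exists: only finitely many solutions have independent
    support, and any other solution can be improved to one of them. *)
Lemma lex_minimal_exists a : nonneg a ->
  exists c, [/\ nonneg c, c *m W = a *m W & lex_minimal (supp c)].
Proof.
move=> a0; have [c [c0 cW cind _]] := lex_caratheodory a0.
rewrite -cW; move: c0 cind => {a a0 cW}; pose smaller c : {set {set 'I_k}} :=
  [set S | `[< exists b, [/\ nonneg b, b *m W = c *m W, independent (supp b),
     lexneg (b - c) & supp b = S] >]]%SET.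
(* The number of independent supports of smaller solutions decreases at each step. *)
have [N] := ubnP #|smaller c|; elim: N => // N IHN in c *; rewrite ltnS => cN c0 cind.
have [cmin|] := pselect (lex_minimal (supp c)); first by exists c.
move=> /existsNP[b /not_implyP[bW /not_implyP[bS /contrapT bneg]]].
have [t [t0 ct0 _]] := lex_descent c0 bneg bS.
have ctW : (c + t *: b) *m W = c *m W by rewrite mulmxDl -scalemxAl bW scaler0 addr0.
have ctneg : lexneg (c + t *: b - c) by rewrite addrC addKr; exact: lexnegZ.
have [e [e0 eW eind ele]] := lex_caratheodory ct0.
have eneg : lexneg (e - c).
  by case: ele => [->//|h]; have := lexnegD h ctneg; rewrite addrA subrK.
have [|f [f0 fW fmin]] := IHN e _ e0 eind; last by exists f; rewrite fW eW ctW.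
apply: leq_trans cN; apply: proper_card; apply/properP; split.
  apply/fintype.subsetP => S; rewrite !inE => -[g [g0 gW gind gneg gS]].
  exists g; split=> //; first by rewrite gW eW ctW.
  by have := lexnegD gneg eneg; rewrite addrA subrK.
exists (supp e); rewrite inE; first by apply/asboolP; exists e; split=> //; rewrite eW ctW.
apply/asboolPn => -[g [g0 gW gind gneg gS]].
suff ge : g - e = 0 by move: gneg; rewrite ge; exact: lexneg0.
apply: eind; first by rewrite mulmxBl gW subrr.
move=> i ie; have := ie; rewrite -gS; move: ie.
by rewrite !inE !negbK !mxE => /eqP -> /eqP ->; rewrite subrr.
Qed.

Lemma independent_card S : independent S -> (#|S| <= D)%N.
Proof.
move=> Sind; pose A : 'M[R]_(#|S|, D) := \matrix_i row (enum_val i) W.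
suff : row_free A by rewrite /row_free => /eqP <-; exact: rank_leq_col.
rewrite -kermx_eq0; apply/rowV0P => u /sub_kermxP uA.
pose a : rv := \sum_i u 0 i *: delta_mx 0 (enum_val i).
have aE (i : 'I_#|S|) : a 0 (enum_val i) = u 0 i.
  rewrite /a summxE (bigD1 i)//= !mxE !eqxx mulr1 big1 ?addr0// => j ji.
  by rewrite !mxE eqxx/= (inj_eq enum_val_inj) eq_sym (negPf ji) mulr0.
have a0 : a = 0.
  apply: Sind => [|i iS].
    rewrite -[RHS]uA [in RHS]mulmx_sum_row mulmx_suml; apply: eq_bigr => i _.
    by rewrite -scalemxAl -rowE rowK.
  rewrite /a summxE big1// => j _; rewrite !mxE eqxx/=.
  case: eqP => [iE|_]; last by rewrite mulr0.
  by move: iS; rewrite iE enum_valP.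
by apply/rowP => i; rewrite -aE a0 !mxE.
Qed.
End LexMin.

Section Ehrhart.
Variables (R : realType) (d k : nat) (v : 'I_k -> 'rV[R]_d).
Local Notation rv := 'rV[R]_k.
Implicit Types (a b f : rv) (x : 'rV[R]_d).

Let P : set 'rV[R]_d := convex_hull (range v).

Definition comb a : 'rV[R]_d := \sum_i a 0 i *: v i.
Definition height a : R := \sum_i a 0 i.

Let W : 'M[R]_(k, d + 1) := row_mx (\matrix_i v i) (const_mx 1).

Let mulW a : a *m W = row_mx (comb a) (height a)%:M.
Proof.
rewrite mul_mx_row; congr row_mx.
  by rewrite mulmx_sum_row; apply: eq_bigr => i _; rewrite rowK.
apply/matrixP => i j; rewrite !ord1 !mxE eqxx mulr1n.
by apply: eq_bigr => l _; rewrite mxE mulr1.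
Qed.

Let eqW a b : a *m W = b *m W <-> comb a = comb b /\ height a = height b.
Proof.
rewrite !mulW; split=> [/eq_row_mx[-> /matrixP/(_ 0 0)]|[-> ->]//].
by rewrite !mxE eqxx !mulr1n.
Qed.

Lemma combD a b : comb (a + b) = comb a + comb b.
Proof. by rewrite /comb -big_split/=; apply: eq_bigr => i _; rewrite mxE scalerDl. Qed.
Lemma heightD a b : height (a + b) = height a + height b.
Proof. by rewrite /height -big_split/=; apply: eq_bigr => i _; rewrite mxE. Qed.
Lemma combZ t a : comb (t *: a) = t *: comb a.
Proof. by rewrite /comb scaler_sumr; apply: eq_bigr => i _; rewrite mxE scalerA. Qed.
Lemma heightZ t a : height (t *: a) = t * height a.
Proof. by rewrite /height mulr_sumr; apply: eq_bigr => i _; rewrite mxE. Qed.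
Lemma comb_sum (I : Type) (r : seq I) (F : I -> rv) :
  comb (\sum_(i <- r) F i) = \sum_(i <- r) comb (F i).
Proof.
apply: (big_morph comb combD); rewrite /comb big1// => i _.
by rewrite mxE scale0r.
Qed.
Lemma height_sum (I : Type) (r : seq I) (F : I -> rv) :
  height (\sum_(i <- r) F i) = \sum_(i <- r) height (F i).
Proof. by apply: (big_morph height heightD); rewrite /height big1// => i _; rewrite mxE. Qed.
Lemma comb_delta i : comb (delta_mx 0 i) = v i.
Proof.
rewrite /comb (bigD1 i)//= mxE !eqxx scale1r big1 ?addr0// => j ji.
by rewrite mxE eqxx (negPf ji) scale0r.
Qed.
Lemma height_delta i : height (delta_mx 0 i) = 1.
Proof.
rewrite /height (bigD1 i)//= mxE !eqxx big1 ?addr0// => j ji.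
by rewrite mxE eqxx (negPf ji).
Qed.

Lemma dilate_convex_hull (m : nat) x : (0 < m)%N ->
  [set m%:R *: y | y in P] x <-> exists a, [/\ nonneg a, comb a = x & height a = m%:R].
Proof.
move=> m0; have m0' : m%:R != 0 :> R by rewrite pnatr_eq0 -lt0n.
split=> [[y [q [c [u [c0 c1 uV ->]]]] <-]|[a [a0 <- am]]].
  have /choice[w wE] j : exists i, v i = u j by have [i _ <-] := uV j; exists i.
  exists (m%:R *: \sum_j c j *: delta_mx 0 (w j)); split.
  - move=> i; rewrite mxE mulr_ge0// summxE sumr_ge0// => j _.
    by rewrite !mxE mulr_ge0.
  - rewrite combZ comb_sum; congr (_ *: _); apply: eq_bigr => j _.
    by rewrite combZ comb_delta wE.
  - rewrite heightZ height_sum (eq_bigr c) ?c1 ?mulr1// => j _.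
    by rewrite heightZ height_delta mulr1.
exists (m%:R^-1 *: comb a); last by rewrite scalerA mulfV// scale1r.
exists k, (fun i => m%:R^-1 * a 0 i), v; split.
- by move=> i; rewrite mulr_ge0// invr_ge0.
- by rewrite -mulr_sumr -/(height a) am mulVf.
- by move=> i; exists i.
- by rewrite scaler_sumr; apply: eq_bigr => i _; rewrite scalerA.
Qed.

(** The integer j with r - j in (0, 1]; it is 0 for r <= 0. *)
Fact pred_ceil_subproof (r : R) : exists j : nat, r <= j.+1%:R.
Proof.
have [r0|r0] := leP r 0; first by exists 0%N; apply: le_trans r0 _.
by exists (Num.bound r); rewrite ltW// (lt_trans (archi_boundP (ltW r0)))// ltr_nat.
Qed.
Definition pred_ceil (r : R) : nat := ex_minn (pred_ceil_subproof r).

Lemma pred_ceilP (r : R) : 0 < r -> 0 < r - (pred_ceil r)%:R <= 1.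
Proof.
move=> r0; rewrite /pred_ceil; case: ex_minnP => -[|j] rj jmin.
  by rewrite subr0 r0.
rewrite subr_gt0 lerBlDr nat1r rj andbT ltNge; apply/negP => /jmin.
by rewrite ltnn.
Qed.

Lemma pred_ceilE (r : R) j : 0 < r - j%:R <= 1 -> pred_ceil r = j.
Proof.
move=> /andP[rj rj1]; have r0 : 0 < r by apply: le_lt_trans (ler0n _ j) _; lra.
have /andP[rp rp1] := pred_ceilP r0.
have h1 : (pred_ceil r < j.+1)%N by rewrite -(ltr_nat R) -natr1; lra.
have h2 : (j < (pred_ceil r).+1)%N by rewrite -(ltr_nat R) -natr1; lra.
by apply/eqP; rewrite eqn_leq -ltnS h1 -ltnS h2.
Qed.

Lemma pred_ceil0 : pred_ceil 0 = 0%N.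
Proof.
rewrite /pred_ceil; case: ex_minnP => j _ /(_ 0%N (ler0n _ _)).
by rewrite leqn0 => /eqP.
Qed.

Definition npart a (i : 'I_k) : nat := pred_ceil (a 0 i).
Definition fpart a : rv := \row_i (a 0 i - (npart a i)%:R).

Lemma fpart_supp a : nonneg a -> supp (fpart a) = supp a.
Proof.
move=> a0; apply/setP => i; rewrite !inE mxE /npart.
have [->|ai] := eqVneq (a 0 i) 0; first by rewrite pred_ceil0 subr0 eqxx.
have : 0 < a 0 i by rewrite lt_neqAle eq_sym ai a0.
by move=> /pred_ceilP/andP[/lt0r_neq0 ->].
Qed.

Lemma fpart_bound a i : nonneg a -> 0 <= fpart a 0 i <= 1.
Proof.
move=> a0; rewrite mxE /npart; have [->|ai] := eqVneq (a 0 i) 0.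
  by rewrite pred_ceil0 subr0 lexx ler01.
have : 0 < a 0 i by rewrite lt_neqAle eq_sym ai a0.
by move=> /pred_ceilP/andP[/ltW -> ->].
Qed.

Lemma fpart_add a (c : 'I_k -> nat) : nonneg a -> (forall i, a 0 i <= 1) ->
  (forall i, a 0 i = 0 -> c i = 0%N) -> fpart (a + \row_i (c i)%:R) = a.
Proof.
move=> a0 a1 ac; apply/rowP => i; rewrite mxE /npart !mxE.
have [ai|ai] := eqVneq (a 0 i) 0; first by rewrite ac// ai addr0 pred_ceil0 subr0.
have ai0 : 0 < a 0 i by rewrite lt_neqAle eq_sym ai a0.
by rewrite (@pred_ceilE _ (c i)) ?addrK// ai0 a1.
Qed.

(** The count of the solutions of k_0 + ... + k_s = m - h in natural numbers, as a
    polynomial in m. *)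
Definition simplex_poly (s h : nat) : {poly R} :=
  (s`!%:R)^-1 *: \prod_(i < s) ('X + (i.+1%:R - h%:R)%:P).

Lemma size_simplex_poly s h : (size (simplex_poly s h) <= s.+1)%N.
Proof.
rewrite (leq_trans (size_scale_leq _ _))// (leq_trans (size_prod_leq _ _))//.
by under eq_bigr do rewrite size_XaddC; rewrite sum_nat_const card_ord; lia.
Qed.

Lemma rising_prod s j : (\prod_(i < s) (j + i.+1) = (j + s) ^_ s)%N.
Proof.
elim: s => [|s IHs]; first by rewrite big_ord0.
by rewrite big_ord_recr/= IHs addnS ffactSS mulnC.
Qed.

(** For m < h <= s + 1 one of the linear factors vanishes at m. *)
Lemma simplex_polyE s h m : (h <= s.+1)%N -> (0 < m)%N ->
  (simplex_poly s h).[m%:R] = (if (h <= m)%N then 'C(m - h + s, s) else 0%N)%:R.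
Proof.
move=> hs m0; rewrite hornerZ horner_prod; case: leqP => hm.
  rewrite (eq_bigr (fun i : 'I_s => ((m - h) + i.+1)%N%:R)); last first.
    by move=> i _; rewrite hornerD hornerX hornerC natrD natrB//; ring.
  rewrite -natr_prod rising_prod -bin_ffact natrM mulrCA mulVf ?mulr1//.
  by rewrite pnatr_eq0 -lt0n fact_gt0.
have lt_s : (h - m.+1 < s)%N by lia.
rewrite (bigD1 (Ordinal lt_s))//= hornerD hornerX hornerC; suff -> : m%:R + ((h - m.+1).+1%:R - h%:R) = 0 :> R.
  by rewrite mul0r mulr0.
have -> : (h - m.+1).+1 = (h - m)%N by lia.
by rewrite natrB 1?ltnW//; ring.
Qed.

Variable L : set 'rV[R]_d.
Hypothesis L0 : L 0.
Hypothesis LB : forall x y, L x -> L y -> L (x - y).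
Hypothesis Lv : forall i, L (v i).
Hypothesis Lfin : forall B : R, finite_set (L `&` [set x | forall j, `|x 0 j| <= B]).

Let LD x y : L x -> L y -> L (x + y).
Proof. by move=> Lx Ly; rewrite -[y]opprK -[- y]sub0r; do 2?apply: LB. Qed.

Let L_comb (c : 'I_k -> nat) : L (comb (\row_i (c i)%:R)).
Proof.
rewrite /comb; elim/big_ind: _ => // i _; rewrite mxE scaler_nat.
by elim: (c i) => [|j IHj]; rewrite ?mulr0n// mulrS; apply: LD.
Qed.

Let bnd : R := \sum_i \sum_j `|v i 0 j|.

Let comb_bound a (m : R) j : nonneg a -> height a <= m -> `|comb a 0 j| <= m * bnd.
Proof.
move=> a0 am; rewrite /comb summxE; apply: le_trans (ler_norm_sum _ _ _) _.
apply: (@le_trans _ _ (\sum_i a 0 i * bnd)).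
  apply: ler_sum => i _; rewrite mxE normrM ger0_norm// ler_wpM2l//.
  rewrite /bnd (bigD1 i)//= (bigD1 j)//= -addrA lerDl addr_ge0// sumr_ge0// => *.
  by rewrite sumr_ge0.
rewrite -mulr_suml ler_wpM2r// /bnd sumr_ge0// => i _; exact: sumr_ge0.
Qed.

Definition dilate_points (m : nat) : set 'rV[R]_d := [set m%:R *: y | y in P] `&` L.

Lemma dilate_points_finite m : (0 < m)%N -> finite_set (dilate_points m).
Proof.
move=> m0; apply: sub_finite_set (Lfin (m%:R * bnd)) => x [/(dilate_convex_hull x m0)[a [a0 <- am]] Lx].
by split=> // j; rewrite comb_bound// am.
Qed.

(** The lattice points of the half-open fundamental parallelepipeds of the cones over
    the simplices of the lexicographic triangulation. *)
Definition box : set rv := [set f | [/\ nonneg f, forall i, f 0 i <= 1,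
  lex_minimal W (supp f), L (comb f) & exists h : nat, height f = h%:R]].

(** A point of the box is recovered from its combination and its height, for which
    finitely many values are possible. *)
Lemma box_finite : finite_set box.
Proof.
pose B : set ('rV[R]_d * nat) := (L `&` [set x | forall j, `|x 0 j| <= k%:R * bnd]) `*` `I_k.+1.
pose g (y : 'rV[R]_d * nat) : rv := xget 0 (box `&` [set f | comb f = y.1 /\ height f = y.2%:R]).
apply: (@sub_finite_set _ _ (g @` B)); last first.
  by apply: finite_image; apply: finite_setX; [exact: Lfin|exact: finite_II].
move=> f fB; have [f0 f1 fmin Lf [h hE]] := fB.
have hk : height f <= k%:R.
  rewrite -[k in k%:R]card_ord -sum1_card natr_sum; exact: ler_sum.
exists (comb f, h).
  split=> /=; first by split=> // j; exact: comb_bound.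
  by rewrite ltnS -(ler_nat R) -hE.
rewrite /g; case: xgetP => [e _ [[e0 e1 emin Le _] /= [ec eh]]|/(_ f)[]//].
by apply: (@lex_minimal_inj _ _ _ W _ _ e0 f0) => //; apply/(eqW _ _); rewrite ec eh hE.
Qed.

Definition box_height f : nat := Num.truncn (height f).

Lemma box_heightE f : box f -> height f = (box_height f)%:R.
Proof. by move=> [_ _ _ _ [h hE]]; rewrite /box_height hE natrK. Qed.

Definition lex_rep (m : nat) x : rv :=
  xget 0 [set a | [/\ nonneg a, comb a = x, height a = m%:R & lex_minimal W (supp a)]].

Lemma lex_repP m x : (0 < m)%N -> dilate_points m x ->
  [/\ nonneg (lex_rep m x), comb (lex_rep m x) = x, height (lex_rep m x) = m%:R &
      lex_minimal W (supp (lex_rep m x))].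
Proof.
move=> m0 [/(dilate_convex_hull x m0)[a [a0 ax am]] _].
rewrite /lex_rep; case: xgetP => [c _ []//|].
have [c [c0 cW cmin]] := lex_minimal_exists W a0.
have [cx cm] := (eqW _ _).1 cW.
by move=> /(_ c)[]; split; rewrite ?cx ?cm.
Qed.

Lemma lex_repE m a : nonneg a -> height a = m%:R -> lex_minimal W (supp a) ->
  lex_rep m (comb a) = a.
Proof.
move=> a0 am amin; rewrite /lex_rep; case: xgetP => [c _ [c0 cx cm cmin]|/(_ a)[]//].
by apply: (@lex_minimal_inj _ _ _ W _ _ c0 a0) => //; apply/(eqW _ _); rewrite cx cm am.
Qed.

Lemma lex_rep_box m x : (0 < m)%N -> dilate_points m x -> box (fpart (lex_rep m x)).
Proof.
move=> m0 xm; have [a0 ax am amin] := lex_repP m0 xm.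
set a := lex_rep m x in a0 ax am amin *.
have aE : a = fpart a + \row_i (npart a i)%:R.
  by apply/rowP => i; rewrite !mxE subrK.
split.
- by move=> i; have /andP[] := fpart_bound i a0.
- by move=> i; have /andP[] := fpart_bound i a0.
- by rewrite fpart_supp.
- have -> : comb (fpart a) = comb a - comb (\row_i (npart a i)%:R).
    by apply/eqP; rewrite eq_sym subr_eq -combD -aE.
  by apply: LB; [rewrite ax; case: xm|exact: L_comb].
exists (m - \sum_i npart a i)%N.
have hE : height (\row_i (npart a i)%:R) = (\sum_i npart a i)%N%:R.
  by rewrite /height natr_sum; apply: eq_bigr => i _; rewrite mxE.
have e : height (fpart a) + (\sum_i npart a i)%N%:R = m%:R.
  by rewrite -hE -heightD -aE.
rewrite natrB; first by rewrite -e addrK.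
rewrite -(ler_nat R) -e lerDr sumr_ge0// => i _.
by have /andP[] := fpart_bound i a0.
Qed.

Let row_height (c : 'I_k -> nat) : height (\row_i (c i)%:R) = (\sum_i c i)%N%:R.
Proof. by rewrite /height natr_sum; apply: eq_bigr => i _; rewrite mxE. Qed.

(** The points with fractional part f are the combinations of f plus natural multiples
    of the vertices in the support of f, of total height m. *)
Lemma dilate_fibre_count m f : (0 < m)%N -> box f ->
  \sum_(x \in dilate_points m `&` [set x | fpart (lex_rep m x) = f]) (1 : R) =
  (if (0 < #|supp f|)%N && (box_height f <= m)%N
   then 'C(m - box_height f + #|supp f|.-1, #|supp f|.-1) else 0)%N%:R :> R.
Proof.
move=> m0 fB; have [f0 f1 fmin Lf _] := fB; have hE := box_heightE fB.
set h := box_height f in hE *.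
have repE x : dilate_points m x -> fpart (lex_rep m x) = f ->
    lex_rep m x = f + \row_i (npart (lex_rep m x) i)%:R /\
    (h + \sum_i npart (lex_rep m x) i)%N = m.
  move=> xm fx; have [a0 ax am amin] := lex_repP m0 xm.
  have aE : lex_rep m x = f + \row_i (npart (lex_rep m x) i)%:R.
    by rewrite -fx; apply/rowP => i; rewrite !mxE subrK.
  split=> //; apply/eqP; rewrite -(eqr_nat R) natrD -hE -row_height -heightD -aE.
  exact/eqP.
case: ifPn => [/andP[s0 hm]|]; last first.
  rewrite negb_and -eqn0Ngt -ltnNge => sh; rewrite fsbig1// => x [xm /= fx].
  have [aE am] := repE x xm fx; exfalso.
  case/orP: sh => [|mh]; last by move: mh; rewrite -am ltnNge leq_addr.
  have [a0 ax am' amin] := lex_repP m0 xm.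
  rewrite -fx fpart_supp// cards_eq0 => /eqP a_supp.
  move: am'; rewrite /height big1 => [/eqP|i _].
    by rewrite eq_sym pnatr_eq0 -leqn0 leqNgt m0.
  apply/eqP; rewrite -[_ == 0]negbK; apply/negP => ai.
  suff : i \in supp (lex_rep m x) by rewrite a_supp inE.
  by rewrite inE.
have [s' sE] : exists s', #|supp f| = s'.+1 by exists #|supp f|.-1; rewrite prednK.
pose e (i : 'I_s'.+1) : 'I_k := enum_val (cast_ord (esym sE) i).
have e_inj : injective e by move=> i j /enum_val_inj/cast_ord_inj.
have e_supp i : f 0 (e i) != 0 by have := enum_valP (cast_ord (esym sE) i); rewrite inE.
have e_surj l : f 0 l != 0 -> exists i, e i = l.
  move=> fl; have lf : l \in supp f by rewrite inE.
  exists (cast_ord sE (enum_rank_in lf l)); rewrite /e cast_ordK.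
  exact: enum_rankK_in.
rewrite sE/=; set j := (m - h)%N.
(* The coefficients added to f are the compositions of m - h into #|supp f| parts. *)
pose T : finType := {t : s'.+1.-tuple 'I_j.+1 | \sum_(i <- t) i == j :> nat}%N.
pose c (t : T) (l : 'I_k) : nat := (\sum_(i < s'.+1) (e i == l) * tnth (val t) i)%N.
have ce t i : c t (e i) = tnth (val t) i.
  rewrite /c (bigD1 i)//= eqxx mul1n big1 ?addn0// => i' i'i.
  by rewrite (inj_eq e_inj) (negPf i'i).
have c0 t l : f 0 l = 0 -> c t l = 0%N.
  move=> fl; rewrite /c big1// => i _; case: eqP => // il.
  by have := e_supp i; rewrite il fl eqxx.
have sum_e (F : 'I_k -> nat) : (forall l, f 0 l = 0 -> F l = 0%N) ->
    (\sum_l F l = \sum_i F (e i))%N.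
  move=> F0; rewrite (bigID (mem (e @: 'I_s'.+1)%SET))/= [X in (_ + X)%N]big1 ?addn0.
    by rewrite big_imset//= => ? ? _ _; exact: e_inj.
  move=> l; apply: contraNeq => Fl; have /e_surj[i <-] : f 0 l != 0 by apply: contra_neq Fl; exact: F0.
  by apply/imsetP; exists i.
have c_sum t : (\sum_l c t l = j)%N.
  rewrite sum_e; last exact: c0; under eq_bigr do rewrite ce.
  by have /eqP := valP t; rewrite big_tuple.
pose a t : rv := f + \row_l (c t l)%:R.
have a0 t : nonneg (a t) by move=> l; rewrite !mxE addr_ge0.
have am t : height (a t) = m%:R by rewrite heightD row_height c_sum hE -natrD subnKC.
have afp t : fpart (a t) = f by apply: fpart_add => // l; exact: c0.
have amin t : lex_minimal W (supp (a t)) by rewrite -fpart_supp// afp.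
have arep t : lex_rep m (comb (a t)) = a t by exact: lex_repE.
pose g t : 'rV[R]_d := comb (a t).
have gbij : set_bij [set: T] (dilate_points m `&` [set x | fpart (lex_rep m x) = f]) g.
  split.
  - move=> t _; split; last by rewrite /= arep.
    split; first by apply/dilate_convex_hull => //; exists (a t).
    by rewrite /g /a combD; apply: LD => //; exact: L_comb.
  - move=> t t' _ _ gtt'; have att' : a t = a t' by rewrite -(arep t) -/(g t) gtt' arep.
    apply/val_inj/eq_from_tnth => i; apply/val_inj; rewrite /= -!ce.
    have := congr1 (fun b : rv => b 0 (e i)) att'; rewrite !mxE => /addrI/eqP.
    by rewrite eqr_nat => /eqP.
  - move=> x [xm /= fx]; have [xE xs] := repE x xm fx.
    pose q l := npart (lex_rep m x) l.
    have q0 l : f 0 l = 0 -> q l = 0%N.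
      move=> fl; have [a0' _ _ _] := lex_repP m0 xm.
      have : l \notin supp (lex_rep m x) by rewrite -fpart_supp// fx inE fl eqxx.
      by rewrite inE negbK /q /npart => /eqP ->; exact: pred_ceil0.
    have qs : (\sum_i q (e i) = j)%N by rewrite -sum_e// /j -xs addKn.
    have qj i : (q (e i) < j.+1)%N by rewrite ltnS -qs (bigD1 i)//= leq_addr.
    pose t0 : s'.+1.-tuple 'I_j.+1 := [tuple Ordinal (qj i) | i < s'.+1].
    have t0P : (\sum_(i <- t0) i == j :> nat)%N.
      by rewrite big_tuple -[X in _ == X]qs; apply/eqP/eq_bigr => i _; rewrite tnth_mktuple.
    exists (exist _ t0 t0P) => //.
    have [_ <- _ _] := lex_repP m0 xm; rewrite /g; congr comb; rewrite xE /a; congr (_ + _).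
    apply/rowP => l; rewrite !mxE; congr _%:R.
    have [fl|/e_surj[i <-]] := eqVneq (f 0 l) 0; first by rewrite c0// [RHS]q0.
    by rewrite ce tnth_mktuple.
rewrite (fsbig_const_bij _ gbij) card_sig addnC -card_ord_partitions.
by congr _%:R; apply: eq_card => t; rewrite !inE.
Qed.

(** Ehrhart's theorem, for dilations by positive integers.  A point of the dilated
    polytope has one representation with lexicographically minimal support; sorting
    the points by the fractional part of this representation gives a finite sum of
    binomial coefficients. *)
Theorem ehrhart_exists : exists E : {poly R}, (size E <= d.+1)%N /\
  forall m : nat, (0 < m)%N -> E.[m%:R] = #|` fset_set (dilate_points m)|%:R.
Proof.
pose Q f : {poly R} := if (0 < #|supp f|)%N then simplex_poly #|supp f|.-1 (box_height f) else 0.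
exists (\sum_(f <- fset_set box) Q f); split.
  apply: (leq_trans (size_sum _ _ _)); rewrite big_seq; elim/big_ind: _ => //.
    by move=> i j id jd; rewrite geq_max id.
  move=> f; rewrite in_fset_set ?inE; last exact: box_finite.
  move=> [_ _ fmin _ _]; rewrite /Q; case: ifP => [s0|_]; last by rewrite size_poly0.
  apply: (leq_trans (size_simplex_poly _ _)); rewrite prednK//.
  by have := independent_card (lex_minimal_independent fmin); rewrite addn1.
move=> m m0.
have -> : #|` fset_set (dilate_points m)|%:R = \sum_(x \in dilate_points m) (1 : R).
  rewrite fsbig_finite; last exact: dilate_points_finite.
  by rewrite big_const_seq count_predT iter_addr_0.
rewrite (@fsbig_partition _ _ _ _ _ (fun x => fpart (lex_rep m x)) _ box); last first.
- by move=> x; exact: lex_rep_box.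
- exact: box_finite.
- exact: dilate_points_finite.
rewrite fsbig_finite; last exact: box_finite.
rewrite horner_sum; apply: eq_big_seq => f.
rewrite in_fset_set ?inE; last exact: box_finite.
move=> fB; rewrite dilate_fibre_count// /Q; case: ifP => s0 /=; last by rewrite horner0.
rewrite simplex_polyE// prednK//.
have [f0 f1 _ _ _] := fB; rewrite -(ler_nat R) -box_heightE// /height.
rewrite (bigID (mem (supp f)))/= [X in _ + X]big1 ?addr0; last first.
  by move=> i; rewrite inE negbK => /eqP.
by rewrite -sum1_card natr_sum; exact: ler_sum.
Qed.

End Ehrhart.

(** * Ehrhart coefficients for lattices between Z^d and Q^d *)

Section RationalLattices.
Variables (R : realType) (d : nat).
Implicit Types (L : set 'rV[rat]_d) (P : set 'rV[R]_d).

(** The lattices between Z^d and N^-1 Z^d, for some N. *)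
Definition overlattice L := [/\ forall x y, L x -> L y -> L (x - y),
  forall z : 'rV[int]_d, L (map_mx intr z) &
  exists2 N : nat, (0 < N)%N & forall x, L x -> exists z : 'rV[int]_d, N%:R *: x = map_mx intr z].

Lemma bounded_int_finite (c : nat) :
  finite_set [set z : 'rV[int]_d | forall j, `|z 0 j| <= c%:Z].
Proof.
pose g (t : {ffun 'I_d -> 'I_(c + c).+1}) : 'rV[int]_d := \row_j ((t j)%:Z - c%:Z).
apply: (@sub_finite_set _ _ (g @` setT)); last exact/finite_image/finite_finset.
move=> z zc; exists [ffun j => inord `|(z 0 j + c%:Z)%R|%N] => //.
apply/rowP => j; rewrite mxE ffunE; have := zc j; rewrite ler_norml => /andP[z1 z2].
have zc0 : 0 <= z 0 j + c%:Z by lia.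
rewrite inordK; last by lia.
by rewrite gez0_abs// addrK.
Qed.

Lemma overlattice_bounded_finite L (B : R) : overlattice L ->
  finite_set ([set map_mx ratr x | x in L] `&` [set x : 'rV[R]_d | forall j, `|x 0 j| <= B]).
Proof.
move=> [_ _ [N N0 NL]]; have N0' : N%:R != 0 :> R by rewrite pnatr_eq0 -lt0n.
pose c := Num.bound (N%:R * `|B|).
apply: (@sub_finite_set _ _ ((fun z : 'rV[int]_d => N%:R^-1 *: map_mx intr z) @`
    [set z : 'rV[int]_d | forall j, `|z 0 j| <= c%:Z])).
  move=> _ [[y Ly <-] yB]; have [z zE] := NL y Ly.
  have zR : map_mx intr z = N%:R *: map_mx ratr y :> 'rV[R]_d.
    apply/rowP => j; have := congr1 (fun u : 'rV[rat]_d => ratr (u 0 j) : R) zE.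
    by rewrite !mxE rmorphM/= ratr_nat ratr_int.
  exists z; last by rewrite zR scalerA mulVf// scale1r.
  move=> j; rewrite -(ler_int R); have := congr1 (fun u : 'rV[R]_d => u 0 j) zR.
  rewrite !mxE intr_norm => ->; rewrite normrM ger0_norm// -[c%:~R]/(c%:R).
  apply: (@le_trans _ _ (N%:R * `|B|)); last by apply/ltW/archi_boundP; rewrite mulr_ge0.
  rewrite ler_wpM2l//; apply: le_trans (ler_norm B).
  by have := yB j; rewrite mxE.
exact/finite_image/bounded_int_finite.
Qed.

Lemma ehrhart_polyP L P : lattice_polytope P -> overlattice L ->
  (size (ehrhart_poly L P) <= d.+1)%N /\ forall m : nat, (0 < m)%N ->
  (ehrhart_poly L P).[m%:R] = (lattice_point_count [set m%:R *: x | x in P] L)%:R.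
Proof.
move=> [V PE] Lover; have [LB LZ _] := Lover.
pose v (i : 'I_(size V)) : 'rV[R]_d := map_mx intr (nth 0 V i).
have PvE : P = convex_hull (range v).
  rewrite PE; congr convex_hull; apply/seteqP; split=> [_ [u uV <-]|_ [i _ <-]].
    have iV : (index u V < size V)%N by rewrite index_mem.
    by exists (Ordinal iV) => //; rewrite /v nth_index.
  by exists (nth 0 V i) => //; exact: mem_nth.
pose LR : set 'rV[R]_d := [set map_mx ratr x | x in L].
have LRB x y : LR x -> LR y -> LR (x - y).
  move=> [x' Lx <-] [y' Ly <-]; exists (x' - y'); first exact: LB.
  by apply/rowP => j; rewrite !mxE rmorphB.
have LRZ (z : 'rV[int]_d) : LR (map_mx intr z).
  by exists (map_mx intr z) => //; apply/rowP => j; rewrite !mxE ratr_int.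
have LR0 : LR 0 by have := LRZ 0; rewrite map_mx0.
have [E [sE EE]] := ehrhart_exists (v := v) LR0 LRB (fun i => LRZ _)
  (fun B => overlattice_bounded_finite B Lover).
rewrite /ehrhart_poly; case: xgetP => [F _ //|/(_ E)[]].
by split=> // m m0; rewrite EE// /dilate_points -PvE.
Qed.

Lemma poly_nat_inj (E F : {poly R}) :
  (forall m : nat, (0 < m)%N -> E.[m%:R] = F.[m%:R]) -> E = F.
Proof.
move=> EF; apply/eqP; rewrite -subr_eq0; apply/negPn/negP => EF0.
pose rs : seq R := [seq i.+1%:R | i <- iota 0 (size (E - F))].
have := max_poly_roots EF0 (rs := rs); rewrite size_map size_iota ltnn => h.
suff : false by []. apply: h.
  apply/allP => _ /mapP[i _ ->]; rewrite rootE hornerD hornerN EF// subrr//.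
rewrite map_inj_uniq ?iota_uniq// => i j /eqP; rewrite eqr_nat => /eqP[].
by [].
Qed.

End RationalLattices.

(** * Transitivity on primitive vectors *)

Section Transvections.
Variables (p : nat) (p_pr : prime p) (n : nat).
Local Notation Zp := (padic_int p_pr).
Local Notation J := (Jmx n Zp).
Local Notation rv := 'rV[Zp]_(n + n).
Implicit Types (x y w : rv).

Definition pairing x y : Zp := (x *m J *m y^T) 0 0.

Lemma pairingD x y w : pairing x (y + w) = pairing x y + pairing x w.
Proof. by rewrite /pairing linearD/= mulmxDr mxE. Qed.

Lemma pairingC x y : pairing x y = - pairing y x.
Proof.
rewrite /pairing; have -> : y *m J *m x^T = - (x *m J *m y^T)^T.
  by rewrite !trmx_mul trmxK Jmx_tr mulNmx mulmxN opprK mulmxA.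
by rewrite !mxE opprK.
Qed.

Lemma transvection_similitude w c : similitude (1%:M + c *: (J *m w^T *m w)) 1.
Proof.
pose N := J *m w^T *m w.
have NT : N^T = - (w^T *m w *m J).
  by rewrite /N !trmx_mul trmxK Jmx_tr mulmxN mulmxN mulmxA.
have e1 : J *m N^T = - (N *m J) by rewrite NT mulmxN /N !mulmxA.
have e2 : N *m J *m N^T = 0.
  rewrite -mulmxA e1 mulmxN /N -!mulmxA (mulmxA w J) (mulmxA (w *m J)).
  by rewrite Jmx_alt mul0mx !mulmx0 oppr0.
rewrite /similitude scale1r -/N linearD/= linearZ/= trmx1 mulmxDl mul1mx -scalemxAl.
rewrite mulmxDl !mulmxDr !mulmx1 -!scalemxAr e1 -scalemxAl e2 !scaler0 addr0.
by rewrite scalerN subrK.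
Qed.

(** Take the transvection along w = y - x, using that the pairing of x with w is its
    pairing with y. *)
Lemma transvection_move x y : pairing x y \is a GRing.unit ->
  exists2 g, similitude g 1 & x *m g = y.
Proof.
move=> xyU; pose w := y - x.
exists (1%:M + (pairing x y)^-1 *: (J *m w^T *m w)).
  exact: transvection_similitude.
have xw : x *m J *m w^T = (pairing x y)%:M.
  by rewrite linearB/= mulmxBr Jmx_alt subr0; exact: mx11_scalar.
rewrite mulmxDr mulmx1 -scalemxAr !mulmxA xw mul_scalar_mx scalerA mulVr// scale1r.
by rewrite addrC subrK.
Qed.

Definition primitive_vector x := exists i, x 0 i \is a GRing.unit.

Lemma primitive_dual x : primitive_vector x -> exists y, pairing x y \is a GRing.unit.
Proof.
move=> [i xi]; exists (delta_mx 0 i *m J); rewrite /pairing trmx_mul Jmx_tr mulNmx mulmxN.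
rewrite mulmxA -(mulmxA x) Jmx_sqr mulmxN mulmx1 mulNmx opprK trmx_delta -colE mxE.
exact: xi.
Qed.

(** Some w pairs invertibly with both x and y; one transvection moves x to w and
    another one w to y. *)
Lemma symplectic_transitive x y : primitive_vector x -> primitive_vector y ->
  exists2 g, similitude g 1 & x *m g = y.
Proof.
move=> /primitive_dual[a xa] /primitive_dual[b yb].
suff [w xw yw] : exists2 w, pairing x w \is a GRing.unit & pairing y w \is a GRing.unit.
  have wy : pairing w y \is a GRing.unit by rewrite pairingC unitrN.
  have [g g1 xg] := transvection_move xw; have [h h1 wh] := transvection_move wy.
  exists (g *m h); first by rewrite -[1]mulr1; exact: similitudeM.
  by rewrite mulmxA xg.
have [ya|ya] := boolP (pairing y a \is a GRing.unit); first by exists a.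
have [xb|xb] := boolP (pairing x b \is a GRing.unit); first by exists b.
exists (a + b); rewrite pairingD; first exact: padic_unitD.
by rewrite addrC; exact: padic_unitD.
Qed.

End Transvections.

(** * Rational lattices attached to left cosets *)

Lemma invmx_mul (K : comUnitRingType) m (A B : 'M[K]_m) : A \in unitmx -> B \in unitmx ->
  invmx (A *m B) = invmx B *m invmx A.
Proof.
move=> AU BU; apply: (can_inj (mulKmx (_ : A *m B \in unitmx))); first by rewrite unitmx_mul AU.
by rewrite mulmxV ?unitmx_mul ?AU// -mulmxA (mulmxA B) mulmxV// mul1mx mulmxV.
Qed.

Lemma scale_invmx (F : fieldType) m (c : F) (A : 'M[F]_m) : c != 0 -> A \in unitmx ->
  invmx (c *: invmx A) = c^-1 *: A.
Proof.
move=> c0 AU; have cU : c *: invmx A \in unitmx by rewrite unitmxZ ?unitmx_inv// unitfE.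
by rewrite (invmxZ cU) invmxK.
Qed.

Section CosetLattices.
Variables (p : nat) (p_pr : prime p) (n : nat).
Hypothesis n_gt0 : (0 < n)%N.
Local Notation Zp := (padic_int p_pr).
Local Notation Qp := (padic p_pr).
Local Notation iota := (@padic_of_int p p_pr).
Local Notation pp := (p%:R : Zp).
Local Notation M := 'M[Qp]_(n + n).
Local Notation "A ^i" := (map_mx iota A) (at level 2, format "A ^i").
Local Notation Gam := (@Gamma p p_pr n).
Local Notation zrow z := (map_mx (intr : int -> Zp) z).
Implicit Types (A : 'M[Zp]_(n + n)) (g h : M) (X Y : set M) (x : 'rV[rat]_(n + n)).

Lemma Qp_int_eq0 (a : int) : ((a%:~R : Qp) == 0) = (a == 0).
Proof. by rewrite -(rmorph_int iota) padic_of_int_eq0 padic_int_eq0. Qed.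

Lemma ratr_frac (y : rat) (a b : int) : y * b%:~R = a%:~R -> (ratr y : Qp) * b%:~R = a%:~R.
Proof.
move=> yb; have den0 : (denq y)%:~R != 0 :> Qp by rewrite Qp_int_eq0 denq_neq0.
have e : numq y * b = a * denq y.
  apply/eqP; rewrite -(eqr_int rat) !intrM -yb mulrAC; apply/eqP; congr (_ * _).
  by rewrite -{2}[y]divq_num_den divfK// intr_eq0 denq_neq0.
apply: (mulIf den0); rewrite /ratr mulrAC divfK// -!intrM e.
by [].
Qed.

(** x lies in the lattice of A^-1 when x A is integral, that is when p^j divides z A. *)
Lemma mem_rational_lattice A x j (z : 'rV[int]_(n + n)) : A^i \in unitmx ->
    p%:R ^+ j *: x = map_mx intr z ->
  rational_lattice (row_lattice (invmx A^i)) x <-> exists u, zrow z *m A = pp ^+ j *: u.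
Proof.
move=> AU xz; have pQ := padic_p_pow_neq0 p_pr j.
have xj i : (ratr (x 0 i) : Qp) * p%:R ^+ j = (z 0 i)%:~R.
  have -> : p%:R ^+ j = ((p ^ j)%N%:Z)%:~R :> Qp by rewrite -[RHS]/((p ^ j)%:R) natrX.
  apply: ratr_frac; have := congr1 (fun y : 'rV[rat]_(n + n) => y 0 i) xz.
  by rewrite !mxE => <-; rewrite -[_%:~R]/((p ^ j)%:R) natrX mulrC.
have xE : p%:R ^+ j *: (map_mx ratr x : 'rV[Qp]_(n + n)) = (zrow z)^i.
  by apply/rowP => i; rewrite !mxE mulrC xj rmorph_int.
have pE : p%:R ^+ j = iota (pp ^+ j) by rewrite rmorphXn rmorph_nat.
split=> [[_ [u _ ux]]|[u zA]].
  exists u; apply: map_padic_inj; rewrite map_mxM -xE map_mxZ/= -pE -scalemxAl.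
  congr (_ *: _); rewrite -ux; exact: (mulmxKV AU).
split.
  move=> i; exists (z 0 i), j; have := congr1 (fun y : 'rV[rat]_(n + n) => y 0 i) xz.
  rewrite !mxE => <-; rewrite mulrC mulKf//.
  by rewrite expf_neq0// pnatr_eq0 -lt0n prime_gt0.
exists u; first exact: I.
apply: (can_inj (mulmxK AU)); rewrite (mulmxKV AU).
have -> : map_mx ratr x = p%:R ^- j *: (zrow z)^i :> 'rV[Qp]_(n + n).
  rewrite -xE scalerA (mulVf pQ) scale1r; reflexivity.
rewrite -scalemxAl -map_mxM zA map_mxZ/= -pE scalerA (mulVf pQ) scale1r; reflexivity.
Qed.

Lemma rational_lattice_denom (L : set 'rV[Qp]_(n + n)) x : rational_lattice L x ->
  exists j (z : 'rV[int]_(n + n)), p%:R ^+ j *: x = map_mx intr z.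
Proof.
have pQ j : p%:R ^+ j != 0 :> rat by rewrite expf_neq0// pnatr_eq0 -lt0n prime_gt0.
move=> [/choice[a /choice[k xE]] _].
exists (\max_i k i)%N, (\row_i (a i * p%:Z ^+ (\max_i k i - k i))).
apply/rowP => i; rewrite !mxE xE intrM rmorphXn/= -[p%:~R]/(p%:R).
rewrite -[in LHS](subnK (leq_bigmax i)) exprD mulrC -mulrA [X in _ * X](_ : _ = p%:R ^+ (\max_i0 k i0 - k i)) //.
by rewrite mulrCA mulVf// mulr1.
Qed.

Lemma sim_unit A u a : u \is a GRing.unit -> similitude A (u * pp ^+ a) -> A^i \in unitmx.
Proof.
move=> uU Au; apply: (@similitude_unit _ _ _ (iota (u * pp ^+ a))); first exact/similitude_map.
by rewrite unitfE padic_of_int_eq0 padic_unit_pk_neq0.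
Qed.

Lemma p_scale_inj (m j : nat) (u v : 'rV[Zp]_m) : pp ^+ j *: u = pp ^+ j *: v -> u = v.
Proof.
move=> /rowP uv; apply/rowP => i; have := uv i; rewrite !mxE.
exact: (mulfI (padic_pk_neq0 p_pr j)).
Qed.

(** The symplectic adjoint of A is integral and equals p^a A^-1 up to a unit, so the
    lattice is contained in p^-a Z^2n. *)
Lemma coset_overlattice A u a : u \is a GRing.unit -> similitude A (u * pp ^+ a) ->
  let L := rational_lattice (row_lattice (invmx A^i)) in
  overlattice L /\ forall x, L x -> exists z, p%:R ^+ a *: x = map_mx intr z.
Proof.
move=> uU Au L; have AU := sim_unit uU Au.
have Lp x : L x -> exists z : 'rV[int]_(n + n), p%:R ^+ a *: x = map_mx intr z.
  move=> Lx; have [j [z xz]] := rational_lattice_denom Lx.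
  have [w zA] := (mem_rational_lattice AU xz).1 Lx.
  have h : pp ^+ a *: zrow z = pp ^+ j *: (u^-1 *: w *m symp_adj A).
    have := congr1 (fun y => u^-1 *: (y *m symp_adj A)) zA.
    rewrite -mulmxA (symp_adjP Au) mul_mx_scalar scalerA mulKr// => ->.
    by rewrite -!scalemxAl !scalerA mulrC.
  have /choice[b bE] i : exists b : int, (p ^ a)%N%:Z * z 0 i = b * p%:Z ^+ j.
    apply/dvdzP/(padic_int_dvd p_pr).
    exists ((u^-1 *: w *m symp_adj A) 0 i); have := congr1 (fun y : 'rV[Zp]_(n + n) => y 0 i) h.
    rewrite !mxE intrM mulrC [RHS]mulrC => <-; rewrite mulrC; congr (_ * _).
    by rewrite -[LHS]/((p ^ a)%:R) natrX.
  exists (\row_i b i); apply/rowP => i; rewrite !mxE.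
  have pQ : p%:R ^+ j != 0 :> rat by rewrite expf_neq0// pnatr_eq0 -lt0n prime_gt0.
  apply: (mulfI pQ); have := congr1 (fun y : 'rV[rat]_(n + n) => y 0 i) xz; rewrite !mxE.
  rewrite mulrCA => ->; have := congr1 (fun c : int => c%:~R : rat) (bE i).
  rewrite !intrM => e; transitivity ((p ^ a)%N%:R * (z 0 i)%:~R : rat); first by rewrite natrX.
  by rewrite [RHS]mulrC -[p%:R ^+ j]/((p%:Z)%:~R ^+ j) -rmorphXn/= -e.
split=> //; split.
- move=> x y Lx Ly; have [z xz] := Lp x Lx; have [z' yz] := Lp y Ly.
  have xyz : p%:R ^+ a *: (x - y) = map_mx intr (z - z').
    by rewrite scalerBr xz yz; apply/rowP => i; rewrite !mxE rmorphB.
  have [w wE] := (mem_rational_lattice AU xz).1 Lx.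
  have [w' wE'] := (mem_rational_lattice AU yz).1 Ly.
  apply/(mem_rational_lattice AU xyz); exists (w - w').
  have -> : zrow (z - z') = zrow z - zrow z' by apply/rowP => i; rewrite !mxE rmorphB.
  by rewrite mulmxBl wE wE' scalerBr.
- move=> z; have zz : p%:R ^+ 0 *: map_mx intr z = map_mx intr z :> 'rV[rat]_(n + n).
    by rewrite scale1r.
  by apply/(mem_rational_lattice AU zz); exists (zrow z *m A); rewrite scale1r.
exists (p ^ a)%N; first by rewrite expn_gt0 prime_gt0.
by move=> x /Lp[z zE]; exists z; rewrite natrX.
Qed.

Definition left_cosets a : set (set M) := [set left_coset g | g in sim_set a].

Lemma left_coset_refl g : left_coset g g.
Proof. by exists 1%:M; [exact: Gamma1|rewrite mulmx1]. Qed.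

(** Any representative serves, because Gamma on the right does not change the lattice
    of g^-1. *)
Definition coset_rational X : set 'rV[rat]_(n + n) :=
  rational_lattice (row_lattice (invmx (xget 1%:M X))).

Lemma row_lattice_coset g : g \in unitmx ->
  row_lattice (invmx (xget 1%:M (left_coset g))) = row_lattice (invmx g).
Proof.
move=> gU; have := xgetPex 1%:M (ex_intro _ g (left_coset_refl g)).
move: (xget _ _) => h [b bG <-].
have bU := Gamma_unit bG.
rewrite (invmx_mul gU bU).
have /GammaP[B [c [cU Bc binvE]]] := GammaV bG.
have BU := similitude_unit Bc cU.
rewrite binvE; apply/seteqP; split=> _ [v _ <-].
  by exists (v *m B) => //; rewrite map_mxM mulmxA.
by exists (v *m invmx B) => //; rewrite mulmxA -map_mxM mulmxKV.
Qed.

Lemma coset_rationalE g : g \in unitmx ->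
  coset_rational (left_coset g) = rational_lattice (row_lattice (invmx g)).
Proof.
move=> gU; exact: congr1 _ (row_lattice_coset gU).
Qed.

(** The correspondence g |-> p^a g^-1 between left and right cosets. *)
Definition coset_inv a X : set M := [set p%:R ^+ a *: invmx x | x in X].

Lemma sim_set_unit a g : sim_set a g -> g \in unitmx.
Proof.
move=> [A [u [uU Au ->]]]; exact: sim_unit uU Au.
Qed.

Lemma coset_inv_left a g : sim_set a g ->
  coset_inv a (left_coset g) = right_coset (p%:R ^+ a *: invmx g).
Proof.
move=> ga; have gU := sim_set_unit ga.
have invM b : Gam b -> invmx (g *m b) = invmx b *m invmx g.
  move=> bG; exact: invmx_mul gU (Gamma_unit bG).
apply/seteqP; split=> [_ [_ [b bG <-] <-]|_ [b bG <-]].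
  by exists (invmx b); [exact: GammaV|rewrite invM// -scalemxAr].
exists (g *m invmx b); first by exists (invmx b) => //; exact: GammaV.
by rewrite invM ?invmxK -?scalemxAr//; exact: GammaV.
Qed.

Lemma coset_inv_int A u a : u \is a GRing.unit -> similitude A (u * pp ^+ a) ->
  p%:R ^+ a *: invmx A^i = (u^-1 *: symp_adj A)^i /\
  similitude (u^-1 *: symp_adj A) (u^-1 * pp ^+ a).
Proof.
move=> uU Au; have AU := sim_unit uU Au.
have uQ : iota u != 0.
  by rewrite padic_of_int_eq0; apply: contraTneq uU => ->; rewrite unitr0.
have pE : p%:R ^+ a = iota (pp ^+ a) by rewrite rmorphXn rmorph_nat.
have e : p%:R ^+ a *: invmx A^i = (u^-1 *: symp_adj A)^i.
  apply: (can_inj (mulKmx AU)); rewrite -[LHS]scalemxAr (mulmxV AU) -map_mxM -scalemxAr.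
  rewrite (symp_adjP Au) !scale_scalar_mx (mulKr uU) map_scalar_mx/= -pE mulr1; reflexivity.
split; first exact: e.
apply/similitude_map; rewrite -e.
have h := similitude_inv ((similitude_map _ _).2 Au).
have cU : iota (u * pp ^+ a) \is a GRing.unit.
  by rewrite unitfE padic_of_int_eq0 padic_unit_pk_neq0.
have := h cU; rewrite /similitude linearZ/= -!scalemxAl -!scalemxAr !scalerA => ->.
rewrite scalerA; congr (_ *: _); rewrite !rmorphM/= pE rmorphV// invfM.
have := padic_p_pow_neq0 p_pr a; rewrite pE => p0.
rewrite [LHS]mulrCA; congr (_ * _); exact: (mulfK p0).
Qed.

Lemma coset_inv_sim a g : sim_set a g -> sim_set a (p%:R ^+ a *: invmx g).
Proof.
move=> [A [u [uU Au ->]]]; have [-> h] := coset_inv_int uU Au.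
by exists (u^-1 *: symp_adj A), u^-1; rewrite unitrV.
Qed.

Lemma coset_inv_bij a : set_bij (left_cosets a) (right_cosets a) (coset_inv a).
Proof.
have p0 := padic_p_pow_neq0 p_pr a.
have gK g : sim_set a g -> p%:R ^+ a *: invmx (p%:R ^+ a *: invmx g) = g.
  move=> ga; rewrite (scale_invmx p0 (sim_set_unit ga)) scalerA (mulfV p0) scale1r; reflexivity.
have LU X (x : M) : left_cosets a X -> X x -> sim_set a x.
  by move=> [g ga <-] [b bG <-]; exact: sim_set_mulr.
split.
- move=> _ [g ga <-]; rewrite coset_inv_left//.
  by exists (p%:R ^+ a *: invmx g) => //; exact: coset_inv_sim.
- move=> X Y; rewrite !inE => Xa Ya XY.
  suff sub S T : left_cosets a S -> left_cosets a T -> coset_inv a S = coset_inv a T -> S `<=` T.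
    by apply/seteqP; split; apply: sub.
  move=> Sa Ta ST x Sx; have : coset_inv a S (p%:R ^+ a *: invmx x) by exists x.
  rewrite ST => -[y Ty yx].
  have yx' : p%:R ^+ a *: invmx (p%:R ^+ a *: invmx y) = p%:R ^+ a *: invmx (p%:R ^+ a *: invmx x).
    by apply: congr1; apply: congr1; exact: yx.
  rewrite -(etrans (esym (gK y (LU _ _ Ta Ty))) (etrans yx' (gK x (LU _ _ Sa Sx)))).
  exact: Ty.
- move=> _ [g ga <-]; exists (left_coset (p%:R ^+ a *: invmx g)).
    by exists (p%:R ^+ a *: invmx g) => //; exact: coset_inv_sim.
  rewrite (coset_inv_left (coset_inv_sim ga)) (gK _ ga); reflexivity.
Qed.

Lemma left_cosets_finite a : finite_set (left_cosets a).
Proof.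
have [_ inj _] := coset_inv_bij a.
pose back (Y : set M) : set M := xget set0 (left_cosets a `&` [set X | coset_inv a X = Y]).
apply: (@sub_finite_set _ _ (back @` right_cosets a)); last first.
  exact/finite_image/right_cosets_finite.
move=> X Xa; exists (coset_inv a X); first by have [f _ _] := coset_inv_bij a; exact: f.
rewrite /back; case: xgetP => [Y _ [Ya /= YX]|/(_ X)[]//].
by apply: inj; rewrite ?inE.
Qed.

End CosetLattices.

(** * Averaging lattice point counts over cosets *)

Section Counting.
Variables (R : realType) (d : nat).
Implicit Types (L : set 'rV[rat]_d) (P : set 'rV[R]_d) (x : 'rV[rat]_d).
Local Notation rr := (map_mx ratr : 'rV[rat]_d -> 'rV[R]_d).

Lemma card_fset_set_sum (T : choiceType) (A : set T) : finite_set A ->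
  #|` fset_set A|%fset = (\sum_(x \in A) 1)%N.
Proof. by move=> Afin; rewrite fsbig_finite// card_fset_sum1 big_seq_fsetE. Qed.

Lemma ratr_mx_inj : injective rr.
Proof.
move=> x y /rowP xy; apply/rowP => i; have := xy i; rewrite !mxE.
exact: fmorph_inj.
Qed.

(** Counts for several lattices become sums over a common index set, which can be
    exchanged with a sum over the lattices. *)
Lemma lattice_point_count_sum P L (U : set 'rV[rat]_d) : finite_set U ->
    (forall x, P (rr x) -> L x -> U x) ->
  lattice_point_count P L = (\sum_(x \in U) (`[< P (rr x) /\ L x >] : nat))%N.
Proof.
move=> Ufin PLU; pose S := [set x | P (rr x) /\ L x].
have SE : P `&` [set rr x | x in L] = rr @` S.
  apply/seteqP; split=> [y [Px [x Lx xE]]|_ [x [Px Lx] <-]].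
    by exists x => //; split=> //; rewrite xE.
  by split=> //; exists x.
have SU : S `<=` U by move=> x [Px Lx]; exact: PLU.
have Sfin := sub_finite_set SU Ufin.
rewrite /lattice_point_count SE card_fset_set_sum; last exact: finite_image.
rewrite (reindex_fsbig rr S)/=; last first.
  by split=> [x Sx|x y _ _|_ [x Sx <-]]; [exists x|exact: ratr_mx_inj|exists x].
rewrite -[RHS](fsbig_widen S)//; last first.
  by move=> x [_ Sx] /=; rewrite asboolF.
by apply: eq_fsbigr => x; rewrite inE => Sx; rewrite asboolT.
Qed.

Lemma lattice_point_count_scale (c : nat) P L : (0 < c)%N ->
    finite_set [set x | P (rr x) /\ L (c%:R *: x)] ->
  lattice_point_count [set c%:R *: y | y in P] L =
  lattice_point_count P [set x | L (c%:R *: x)].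
Proof.
move=> c0; pose U := [set x | P (rr x) /\ L (c%:R *: x)] => Ufin.
have cQ : c%:R != 0 :> rat by rewrite pnatr_eq0 -lt0n.
have cR : c%:R != 0 :> R by rewrite pnatr_eq0 -lt0n.
have rrZ x : rr (c%:R *: x) = c%:R *: rr x.
  by apply/rowP => i; rewrite !mxE rmorphM/= ratr_nat.
rewrite (@lattice_point_count_sum _ _ ((fun x => c%:R *: x) @` U)).
- rewrite (@lattice_point_count_sum _ _ U)//.
  rewrite (reindex_fsbig (fun x : 'rV[rat]_d => c%:R *: x) U)/=; last first.
    split=> [x Ux|x y _ _|_ [x Ux <-]]; [by exists x|exact: scalerI|by exists x].
  apply: eq_fsbigr => x; rewrite inE => -[Px Lx]; rewrite !asboolT//; split=> //.
  by rewrite rrZ; exists (rr x).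
- exact: finite_image.
- move=> x [y Py yx] Lx; exists (c%:R^-1 *: x); last by rewrite scalerA mulfV// scale1r.
  split; last by rewrite scalerA mulfV// scale1r.
  suff -> : rr (c%:R^-1 *: x) = y by [].
  apply: (scalerI cR); rewrite -rrZ scalerA mulfV// scale1r yx//.
Qed.
End Counting.

Section LastEntry.
Variables (p : nat) (p_pr : prime p) (n : nat).
Hypothesis n_gt0 : (0 < n)%N.
Local Notation Zp := (padic_int p_pr).
Local Notation Qp := (padic p_pr).
Local Notation iota := (@padic_of_int p p_pr).
Local Notation pp := (p%:R : Zp).
Local Notation M := 'M[Qp]_(n + n).
Local Notation "A ^i" := (map_mx iota A) (at level 2, format "A ^i").
Local Notation Gam := (@Gamma p p_pr n).
Local Notation LC := (@left_cosets p p_pr n).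
Local Notation zrow z := (map_mx (intr : int -> Zp) z).
Implicit Types (A : 'M[Zp]_(n + n)) (g h : M) (X Y : set M) (x : 'rV[rat]_(n + n)).

Definition last_ord : 'I_n := Ordinal (etrans (ltn_predL n) n_gt0).

Lemma ltn_last_ord (j : 'I_n) : j != last_ord -> (j.+1 < n)%N.
Proof.
move=> jl; have := ltn_ord j; rewrite leq_eqVlt => /orP[/eqP jn|//].
have jp := congr1 predn jn.
by case/eqP: jl; apply/val_inj; exact: jp.
Qed.

(** The last row of a triangular matrix has its pivot as only nonzero entry. *)
Lemma row_span_last (D : 'M[Zp]_n) (e : {ffun 'I_n -> nat}) m :
    upper_triangular D -> (forall i, D i i = pp ^+ e i) ->
  row_span D (pp ^+ m *: delta_mx 0 last_ord) <-> (e last_ord <= m)%N.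
Proof.
move=> Dt De; split=> [Dm|em].
  have [j jl|c] := triangular_leading (i := last_ord) Dt De Dm.
    have /negPf jl' : j != last_ord by rewrite -val_eqE neq_ltn jl.
    by rewrite !mxE jl' andbF mulr0.
  rewrite !mxE !eqxx mulr1 => cE.
  apply: (@padic_pk_dvd_unit _ p_pr 1); first exact: unitr1.
  by exists c; rewrite mul1r.
exists (pp ^+ (m - e last_ord) *: delta_mx 0 last_ord) => //.
rewrite -scalemxAl -rowE; apply/rowP => j; rewrite !mxE eqxx/=.
have [->|jl] := eqVneq j last_ord; first by rewrite De -exprD subnK// mulr1.
rewrite Dt ?mulr0//=; have := ltn_last_ord jl; lia.
Qed.

Lemma coset_last_le a X : right_cosets a X ->
  (hermite_delta (coset_lattice X) last_ord <= a)%N.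
Proof.
move=> Xa; have [Lfin Lp] := coset_lattice_finite Xa.
have [D [e [Dt De LD]]] := triangular_basis (finite_index_submodule Lfin) (ex_intro _ a Lp).
by rewrite LD (hermite_deltaE Dt De); apply/(row_span_last _ Dt De); rewrite -LD.
Qed.

(** The largest j for which p^-j times the last basis vector lies in the lattice of
    the coset; [coset_last_le] shows that the subtraction is not truncated. *)
Definition coset_depth a X : nat := (a - hermite_delta (coset_lattice (coset_inv a X)) last_ord)%N.

(** Multiplying by p^a A^-1 turns the condition into membership of p^(a - j) e_n in
    the lower lattice of the corresponding right coset, which the last pivot of a
    triangular basis decides. *)
Lemma coset_depthP A u a j : u \is a GRing.unit -> similitude A (u * pp ^+ a) ->
  (exists w : 'rV[Zp]_(n + n), row_mx 0 (delta_mx 0 last_ord) *m A = pp ^+ j *: w) <->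
  (j <= coset_depth a (left_coset A^i))%N.
Proof.
move=> uU Au; have Aa : sim_set a A^i by exists A, u.
rewrite /coset_depth (coset_inv_left Aa).
have [-> A'sim] := coset_inv_int uU Au; set A' := u^-1 *: symp_adj A in A'sim *.
have A'a : right_cosets a (right_coset A'^i).
  by exists A'^i => //; exists A', u^-1; rewrite unitrV.
have [Lfin Lp] := coset_lattice_finite A'a.
have [D [e [Dt De LD]]] := triangular_basis (finite_index_submodule Lfin) (ex_intro _ a Lp).
rewrite LD (hermite_deltaE Dt De).
have ea : (e last_ord <= a)%N by apply/(row_span_last _ Dt De); rewrite -LD.
have AA' : A *m A' = (pp ^+ a)%:M.
  by rewrite /A' -scalemxAr (symp_adjP Au) scale_scalar_mx mulKr.
have A'A : A' *m A = (pp ^+ a)%:M by apply: mulmx_scalarC AA'; exact: padic_pk_neq0.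
set E : 'rV[Zp]_(n + n) := row_mx 0 _.
have LE m : row_span D (pp ^+ m *: delta_mx 0 last_ord) <-> exists w, w *m A' = pp ^+ m *: E.
  rewrite -LD coset_lattice_right; split=> -[w wE]; exists w; rewrite wE.
    by rewrite scale_row_mx scaler0.
  by rewrite scale_row_mx scaler0.
split=> [[w EA]|jK].
  have pE : pp ^+ a *: E = pp ^+ j *: (w *m A').
    have := congr1 (mulmxr A') EA; rewrite /= -mulmxA AA' mul_mx_scalar => ->.
    by rewrite scalemxAl.
  have [ja|aj] := leqP j a.
    suff : (e last_ord <= a - j)%N by lia.
    apply/(row_span_last _ Dt De)/LE; exists w; apply: (@p_scale_inj _ _ _ j).
    by rewrite -pE scalerA -exprD subnKC.
  exfalso; have := congr1 (fun y : 'rV[Zp]_(n + n) => y 0 (rshift n last_ord)) pE.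
  rewrite !mxE (unsplitK (inr _)) mxE !eqxx mulr1 => h.
  have : (j <= a)%N.
    apply: (@padic_pk_dvd_unit _ p_pr 1); first exact: unitr1.
    by exists ((w *m A') 0 (rshift n last_ord)); rewrite mul1r h mxE mulrC.
  by rewrite leqNgt aj.
have /(row_span_last _ Dt De)/LE[w wE] : (e last_ord <= a - j)%N by lia.
exists w; apply: (@p_scale_inj _ _ _ (a - j)).
have := congr1 (mulmxr A) wE; rewrite /= -mulmxA A'A mul_mx_scalar -scalemxAl => <-.
rewrite scalerA -exprD; congr (_ ^+ _ *: _); lia.
Qed.

Lemma coset_depth_le a X : (coset_depth a X <= a)%N.
Proof. exact: leq_subr. Qed.

Lemma left_coset_act (h k : M) : [set h *m x | x in left_coset k] = left_coset (h *m k).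
Proof.
apply/seteqP; split=> [_ [_ [b bG <-] <-]|_ [b bG <-]].
  by exists b; rewrite ?mulmxA.
by exists (k *m b); [exists b|rewrite mulmxA].
Qed.

Lemma left_coset_act_bij a (g : 'M[Zp]_(n + n)) : similitude g 1 ->
  set_bij (LC a) (LC a) (fun X => [set g^i *m x | x in X]).
Proof.
move=> g1; have gU := similitude_unit g1 (unitr1 _).
have act_sim (h : 'M[Zp]_(n + n)) k : similitude h 1 -> sim_set a k -> sim_set a (h^i *m k).
  move=> h1 [A [u [uU Au ->]]]; exists (h *m A), u; split=> //; last by rewrite map_mxM.
  by rewrite -[u * _]mul1r; exact: similitudeM.
have ginv := similitude_inv g1 (unitr1 _); rewrite invr1 in ginv.
have gi : (invmx g)^i *m g^i = 1%:M by rewrite -map_mxM mulVmx// map_mx1.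
have ig : g^i *m (invmx g)^i = 1%:M by rewrite -map_mxM mulmxV// map_mx1.
split.
- move=> _ [k ka <-]; rewrite left_coset_act; exists (g^i *m k) => //; exact: act_sim.
- move=> X Y _ _ XY; have := congr1 (fun S => [set (invmx g)^i *m x | x in S]) XY.
  have K (S : set M) : [set (invmx g)^i *m x | x in [set g^i *m x | x in S]] = S.
    rewrite image_comp; apply/seteqP; split=> [_ [x Sx <-]|x Sx].
      by rewrite /= mulmxA gi mul1mx.
    by exists x => //; rewrite /= mulmxA gi mul1mx.
  by rewrite !K.
- move=> _ [k ka <-]; exists (left_coset ((invmx g)^i *m k)).
    by exists ((invmx g)^i *m k) => //; exact: act_sim.
  by rewrite left_coset_act mulmxA ig mul1mx.
Qed.

(** If p^j is the denominator of x, then x = p^-j z with z primitive; the symplectic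
    group moves z to the last basis vector and permutes the left cosets. *)
Lemma left_cosets_average a x : exists2 f,
  set_bij (LC a) (LC a) f &
  forall X, LC a X ->
    (coset_rational (f X) x <-> integer_lattice _ (p%:R ^+ coset_depth a X *: x)).
Proof.
have ratp0 k : p%:R ^+ k != 0 :> rat by rewrite expf_neq0// pnatr_eq0 -lt0n prime_gt0.
have id_bij : set_bij (LC a) (LC a) id.
  by split=> // X Xa; exists X.
have [[j0 jz0]|nj] := pselect (exists j, integer_lattice _ (p%:R ^+ j *: x)); last first.
  exists id => // X [g [A [u [uU Au ->]]] <-]; split=> [|h]; last by case: nj; eexists; exact: h.
  rewrite (coset_rationalE (sim_unit uU Au)) => /rational_lattice_denom[j [z xz]].
  by case: nj; exists j, z.
have exj : exists j, `[< integer_lattice _ (p%:R ^+ j *: x) >] by exists j0; exact/asboolP.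
case: (ex_minnP exj) => j /asboolP[z _ xz] jmin.
have jle k : integer_lattice _ (p%:R ^+ k *: x) <-> (j <= k)%N.
  split=> [h|jk]; first by apply: jmin; exact/asboolP.
  exists ((p ^ (k - j))%N%:Z *: z) => //.
  rewrite -(subnK jk) exprD -scalerA -xz; apply/rowP => i; rewrite !mxE intrM.
  by congr (_ * _); rewrite -natrX addnK.
have [j_0|j_gt0] := posnP j.
  exists id => // X [g [A [u [uU Au ->]]] <-]; rewrite (coset_rationalE (sim_unit uU Au)) jle j_0.
  split=> // _; have [[_ LZ _] _] := coset_overlattice uU Au.
  suff -> : x = map_mx intr z by exact: LZ.
  by rewrite xz j_0 scale1r.
(* By minimality of j, the entries of z are not all divisible by p. *)
have zprim : primitive_vector (zrow z).
  apply: contrapT => zN; suff : (j <= j.-1)%N by lia.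
  apply/jle; have /choice[b bE] i : exists b : int, z 0 i = b * p%:Z.
    apply/dvdzP; rewrite -[p%:Z]expr1; apply/(padic_int_dvd p_pr)/padic_pk_dvd.
    apply/eqP; rewrite -[_ == _]negbK -padic_unitE; apply/negP => iU.
    by apply: zN; exists i; rewrite mxE.
  exists (\row_i b i) => //; apply/rowP => i; rewrite mxE.
  have pQ : p%:R != 0 :> rat by rewrite -[p%:R]expr1.
  apply: (mulIf pQ); have := congr1 (fun y : 'rV[rat]_(n + n) => y 0 i) xz.
  rewrite /= !mxE bE intrM => ->; rewrite mulrAC -exprSr prednK//.
have eprim : primitive_vector (row_mx 0 (delta_mx 0 last_ord) : 'rV[Zp]_(n + n)).
  by exists (rshift n last_ord); rewrite row_mxEr mxE !eqxx unitr1.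
have [g g1 zg] := symplectic_transitive zprim eprim.
exists (fun X => [set g^i *m y | y in X]); first exact: left_coset_act_bij.
move=> X [_ [A [u [uU Au ->]]] <-].
have gAu : similitude (g *m A) (u * pp ^+ a) by rewrite -[u * _]mul1r; exact: similitudeM.
rewrite left_coset_act -map_mxM.
rewrite (coset_rationalE (sim_unit uU gAu)) (mem_rational_lattice (sim_unit uU gAu) (esym xz)).
rewrite jle -(coset_depthP j uU Au) mulmxA zg.
by [].
Qed.
End LastEntry.

(** * Averages of Ehrhart coefficients *)

Section EhrhartAverage.
Variables (p : nat) (p_pr : prime p) (n : nat) (R : realType).
Hypothesis n_gt0 : (0 < n)%N.
Local Notation Zp := (padic_int p_pr).
Local Notation Qp := (padic p_pr).
Local Notation M := 'M[Qp]_(n + n).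
Local Notation LC := (@left_cosets p p_pr n).
Local Notation RC := (@right_cosets p p_pr n).
Local Notation rr := (map_mx ratr : 'rV[rat]_(n + n) -> 'rV[R]_(n + n)).
Implicit Types (X Y : set M) (P : set 'rV[R]_(n + n)).
Local Notation last := (last_ord n_gt0).
Local Notation depth := (coset_depth n_gt0).

Lemma polytope_bounded P : lattice_polytope P ->
  exists B, forall y, P y -> forall j, `|y 0 j| <= B.
Proof.
move=> [V ->]; pose B : R := \sum_(u <- V) \sum_j `|(u 0 j)%:~R|.
exists B => _ [k [a [v [a0 a1 vV ->]]]] j; rewrite summxE.
apply: le_trans (ler_norm_sum _ _ _) _; rewrite -[B]mul1r -a1 mulr_suml.
apply: ler_sum => i _; rewrite mxE normrM ger0_norm// ler_wpM2l//.
have [u uV <-] := vV i; rewrite mxE /B (big_rem u)//= (bigD1 j)//= -addrA lerDl.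
by rewrite addr_ge0// ?sumr_ge0// => w _; rewrite sumr_ge0.
Qed.

Lemma integer_overlattice : overlattice (integer_lattice (n + n)).
Proof.
split.
- move=> _ _ [z _ <-] [w _ <-]; exists (z - w) => //.
  by apply/rowP => i; rewrite !mxE rmorphB.
- by move=> z; exists z.
- by exists 1%N => // _ [z _ <-]; exists z; rewrite scale1r.
Qed.

Lemma left_coset_overlattice a X : LC a X -> overlattice (coset_rational X) /\
  forall x, coset_rational X x -> integer_lattice _ (p%:R ^+ a *: x).
Proof.
move=> [_ [A [u [uU Au ->]]] <-]; rewrite (coset_rationalE (sim_unit uU Au)).
have [Lover Lp] := coset_overlattice uU Au; split=> // x /Lp[z zE].
by exists z.
Qed.

Lemma scaled_integer_overlattice a :
  overlattice [set x : 'rV[rat]_(n + n) | integer_lattice _ (p%:R ^+ a *: x)].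
Proof.
split=> /=.
- by move=> x y xZ yZ; rewrite scalerBr; case: integer_overlattice => + _ _; apply.
- move=> z; exists ((p ^ a)%N%:Z *: z) => //.
  by apply/rowP => i; rewrite !mxE intrM -natrX.
- exists (p ^ a)%N; first by rewrite expn_gt0 prime_gt0.
  by move=> x [z _ zE]; exists z; rewrite natrX.
Qed.

(** All the lattices lie in p^-a Z^2n, so both sides are sums over finitely many points
    and the sums over the cosets can be compared point by point. *)
Lemma left_cosets_count a P (B : R) : (forall y, P y -> forall j, `|y 0 j| <= B) ->
  (\sum_(X \in LC a) lattice_point_count P (coset_rational X) =
   \sum_(X \in LC a) lattice_point_count [set (p ^ depth a X)%:R *: y | y in P]
      (integer_lattice _))%N.
Proof.
move=> PB; pose U : set 'rV[rat]_(n + n) :=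
  [set x | P (rr x) /\ integer_lattice _ (p%:R ^+ a *: x)].
have Ufin : finite_set U.
  pose W := [set rr x | x in [set x | integer_lattice _ (p%:R ^+ a *: x)]] `&`
    [set y : 'rV[R]_(n + n) | forall j, `|y 0 j| <= B].
  apply: (@sub_finite_set _ _ (rr @^-1` W)).
    by move=> x [Px xZ]; split; [exists x|exact: PB].
  apply: finite_preimage; first by move=> x y _ _; exact: ratr_mx_inj.
  exact: overlattice_bounded_finite (scaled_integer_overlattice a).
have LCfin : finite_set (LC a) by exact: left_cosets_finite.
have depthU X x : P (rr x) -> integer_lattice _ ((p ^ depth a X)%:R *: x) -> U x.
  move=> Px [z _ zx]; split=> //; exists ((p ^ (a - depth a X))%N%:Z *: z) => //.
  have -> : p%:R ^+ a = (p ^ (a - depth a X))%:R * (p ^ depth a X)%:R :> rat.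
    by rewrite -natrM -expnD subnK ?coset_depth_le// natrX.
  by rewrite -scalerA -zx; apply/rowP => i; rewrite !mxE intrM.
transitivity (\sum_(X \in LC a) \sum_(x \in U) (`[< P (rr x) /\ coset_rational X x >] : nat))%N.
  apply: eq_fsbigr => X; rewrite inE => /left_coset_overlattice[_ Xp].
  by apply: lattice_point_count_sum => // x Px /Xp; split.
rewrite exchange_fsbig//.
transitivity (\sum_(x \in U) \sum_(X \in LC a)
   (`[< P (rr x) /\ integer_lattice _ ((p ^ depth a X)%:R *: x) >] : nat))%N.
  apply: eq_fsbigr => x; rewrite inE => -[Px _].
  have [f fbij fE] := left_cosets_average p_pr n_gt0 a x.
  rewrite (reindex_fsbig f (LC a))//; apply: eq_fsbigr => X; rewrite inE => Xa.
  congr (nat_of_bool _); apply: asbool_equiv_eq; rewrite natrX.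
  by split=> -[_ h]; split=> //; exact/fE.
rewrite exchange_fsbig//; apply: eq_fsbigr => X _.
rewrite lattice_point_count_scale ?expn_gt0 ?prime_gt0//; last first.
  by apply: sub_finite_set Ufin => x [Px]; exact: depthU.
by rewrite (@lattice_point_count_sum _ _ _ _ U)// => x; exact: depthU.
Qed.

(** Both sides are coefficients of polynomials whose values at m are the sums of
    [left_cosets_count] for m P. *)
Lemma ehrhart_average a P l : lattice_polytope P ->
  \sum_(X \in LC a) ehrhart_coef (coset_rational X) P l =
  (\sum_(X \in LC a) (p%:R : R) ^+ (l * depth a X)) * ehrhart_coef (integer_lattice _) P l.
Proof.
move=> Plat; have LCfin : finite_set (LC a) by exact: left_cosets_finite.
have [B PB] := polytope_bounded Plat.
pose E := ehrhart_poly (integer_lattice _) P.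
have [_ EE] := ehrhart_polyP Plat integer_overlattice.
pose sE (c : R) : {poly R} := \poly_(i < size E) (E`_i * c ^+ i).
have sEE c x : (sE c).[x] = E.[c * x].
  by rewrite horner_poly horner_coef; apply: eq_bigr => i _; rewrite exprMn mulrA.
have sEl c : (sE c)`_l = E`_l * c ^+ l.
  by rewrite coef_poly; case: ltnP => // /leq_sizeP ->//; rewrite mul0r.
have key : \sum_(X <- fset_set (LC a)) ehrhart_poly (coset_rational X) P =
    \sum_(X <- fset_set (LC a)) sE (p ^ depth a X)%:R.
  apply: poly_nat_inj => m m0; rewrite !horner_sum.
  have mPB y : [set m%:R *: x | x in P] y -> forall j, `|y 0 j| <= m%:R * B.
    by move=> [x Px <-] j; rewrite mxE normrM ger0_norm// ler_wpM2l// PB.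
  have := congr1 (fun k : nat => k%:R : R) (left_cosets_count a mPB).
  rewrite /= !fsbig_finite// !natr_sum big_seq_cond => h.
  transitivity (\sum_(X <- fset_set (LC a))
     (lattice_point_count [set m%:R *: x | x in P] (coset_rational X))%:R : R).
    rewrite big_seq_cond [RHS]big_seq_cond; apply: eq_bigr => X /andP[+ _].
    rewrite in_fset_set// inE => /left_coset_overlattice[Xover _].
    by have [_ ->] := ehrhart_polyP Plat Xover.
  rewrite big_seq_cond [LHS]h; apply: eq_bigr => X _.
  rewrite sEE -natrM EE; last by rewrite muln_gt0 expn_gt0 (prime_gt0 p_pr) m0.
  congr (_ *+ lattice_point_count _ _); rewrite image_comp; apply: eq_imagel => x _ /=.
  by rewrite scalerA natrM.
have := congr1 (fun F : {poly R} => F`_l) key; rewrite /= !coef_sum => h.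
rewrite !fsbig_finite// [LHS]h mulr_suml; apply: eq_bigr => X _.
by rewrite sEl mulrC natrX -exprM mulnC.
Qed.

Lemma depth_sum (F : comNzRingType) (q : F) a l :
  \sum_(X \in LC a) q ^+ (l * depth a X) =
  \sum_(Y \in RC a) q ^+ (l * (a - hermite_delta (coset_lattice Y) last)).
Proof.
rewrite [RHS](reindex_fsbig (coset_inv a) (LC a)); first reflexivity.
exact: coset_inv_bij.
Qed.

Local Notation C := R[i].
Local Notation ev l := (laurent_eval (@psi_point p n R l)).

(** At this point p^-j x_j takes the value 1 for j < n and p^-l for j = n. *)
Lemma satake_coset_eval l a Y : RC a Y ->
  ev l (satake_coset R Y) =
  p%:R ^+ (l * (a - hermite_delta (coset_lattice Y) last)).
Proof.
move=> Ya; rewrite (satake_cosetE n_gt0 R Ya).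
have ne i := psi_point_neq0 (prime_gt0 p_pr) R l (i : 'I_n.+1).
have pC : p%:R != 0 :> C by rewrite pnatr_eq0 -lt0n prime_gt0.
have pC' k : p%:R ^+ k != 0 :> C by rewrite expf_neq0.
rewrite (laurent_evalM ne) (laurent_evalX ne) laurent_eval_var.
rewrite /delta_weight (laurent_eval_prod ne).
have evE (j : 'I_n) : ev l ((laurent_const n.+1 (p%:R ^- j.+1) * laurent_var C (lift ord0 j)) ^+
      hermite_delta (coset_lattice Y) j) =
    if j == last then p%:R ^- (l * hermite_delta (coset_lattice Y) last) else 1.
  rewrite (laurent_evalX ne) (laurent_evalM ne) laurent_eval_const laurent_eval_var.
  rewrite /psi_point /= /bump/= add1n; have [->|jl] := eqVneq j last.
    rewrite /= prednK// ltnn expfzDr// -exprnN -exprnP.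
    by rewrite mulKf// -exprVn -exprM exprVn.
  rewrite (ltn_last_ord jl).
  by rewrite mulVf// expr1n.
rewrite (eq_bigr _ (fun j _ => evE j)) (bigD1 last)//= eqxx.
rewrite big1 ?mulr1 => [|j /negPf ->//].
rewrite /psi_point eqxx -exprM mulnBr expfB_cond//.
by rewrite (negPf pC) add0n leq_mul2l coset_last_le ?orbT// eqxx.
Qed.

Lemma hecke_series_eval l a : ev l (hecke_series p_pr n R (deg1 a)) =
  \sum_(X \in LC a) (p%:R : C) ^+ (l * depth a X).
Proof.
have ne i := psi_point_neq0 (prime_gt0 p_pr) R l (i : 'I_n.+1).
have RCfin : finite_set (RC a) by exact: right_cosets_finite.
rewrite (hecke_series_coef p_pr) (satake_hecke_T p_pr n_gt0) depth_sum.
rewrite [X in ev l X](fsbig_finite _ _ RCfin) (fsbig_finite _ _ RCfin)/=.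
rewrite laurent_eval_sum big_seq_cond [RHS]big_seq_cond.
apply: eq_bigr => Y /andP[+ _]; rewrite in_fset_set// inE => Ya.
exact: satake_coset_eval.
Qed.

End EhrhartAverage.

(** * The Ehrhart-Hecke zeta function *)

Section Zeta.
Variables (p : nat) (p_pr : prime p) (n : nat) (R : realType).
Hypothesis n_gt0 : (0 < n)%N.
Local Notation Zp := (padic_int p_pr).
Local Notation Qp := (padic p_pr).
Local Notation iota := (@padic_of_int p p_pr).
Local Notation pp := (p%:R : Zp).
Local Notation M := 'M[Qp]_(n + n).
Local Notation "A ^i" := (map_mx iota A) (at level 2, format "A ^i").
Local Notation LC := (@left_cosets p p_pr n).
Local Notation C := R[i].
Local Notation SL := (@std_lattice p p_pr (n + n)).
Implicit Types (A : 'M[Zp]_(n + n)) (X Y : set M).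

Lemma similitude_det A c : similitude A c -> \det A ^+ 2 = c ^+ (n + n).
Proof.
move=> /(congr1 determinant); rewrite !det_mulmx det_tr detZ mulrAC => h.
by apply: (mulIr (_ : \det (Jmx n Zp) \is a GRing.unit)); rewrite -?unitmxE ?Jmx_unit.
Qed.

(** v |-> v A^-1 identifies the quotient with the quotient of Z_p^2n by the rows of A. *)
Lemma row_lattice_index (nu : (n + n).-tuple nat) A : A^i \in unitmx ->
    quotient_type (row_span A) nu ->
  lattice_index (row_lattice (invmx A^i)) SL =
  (p ^ \sum_(k <- nu) k)%N.
Proof.
move=> AU [_ [phi [phiL phis]]].
pose Q := {dffun forall i : 'I_(n + n), 'I_(p ^ tnth nu i).-1.+1}.
have [r rE] := choice (fun c : Q => phis c).
pose K (v : 'rV[Zp]_(n + n)) : set 'rV[Qp]_(n + n) :=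
  [set v^i *m invmx A^i + w | w in SL].
have Keq v v' : K v = K v' <-> row_span A (v - v').
  have sub u u' : row_span A (u - u') -> K u `<=` K u'.
    move=> [z _ zE] _ [_ [w _ <-] <-]; exists (z + w)^i; first by exists (z + w).
    have -> : u = z *m A + u' by rewrite zE subrK.
    rewrite !map_mxD map_mxM mulmxDl (mulmxK AU) addrCA addrA; reflexivity.
  split=> [KK|vv'].
    have : K v (v^i *m invmx A^i + (0 : 'rV[Zp]_(n + n))^i) by exists 0^i => //; exists 0.
    rewrite KK map_mx0 addr0 => -[_ [w _ <-] h]; exists w => //.
    apply: map_padic_inj; have := congr1 (mulmxr A^i) h.
    rewrite /= mulmxDl !(mulmxKV AU) -map_mxM map_mxB => <-.
    rewrite addrC addKr; reflexivity.
  apply/seteqP; split; apply: sub => //.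
  rewrite -opprB -scaleN1r; exact: submoduleZ (row_span_submodule A) vv'.
have Kbij : set_bij setT (cosets (row_lattice (invmx A^i)) SL)
    (fun c : Q => K (r c)).
  split.
  - by move=> c _; exists ((r c)^i *m invmx A^i) => //; exists (r c).
  - move=> c c' _ _ /Keq/phiL h; apply/ffunP => i.
    by have := h i; rewrite raddfB !rE => /subr0_eq.
  - move=> _ [_ [v _ <-] <-]; exists [ffun i => phi i v]; first exact: I.
    by apply/Keq/phiL => i; rewrite raddfB rE ffunE subrr.
have Cfin : finite_set (cosets (row_lattice (invmx A^i)) SL).
  have [_ _ surj] := Kbij; apply: sub_finite_set surj _.
  exact/finite_image/finite_finset.
rewrite /lattice_index (card_fset_set_sum Cfin).
rewrite [LHS](fsbig_const_bij (1%N : nat) Kbij) [LHS]natn.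
rewrite card_dep_ffun foldrE big_map big_enum/= expn_sum big_tuple.
by apply: eq_bigr => i _; rewrite card_ord prednK// expn_gt0 prime_gt0.
Qed.

(** The square of det A is the 2n-th power of the multiplier, and the elementary
    divisors of A multiply to det A up to a unit. *)
Lemma left_coset_index a X : LC a X ->
  lattice_index (row_lattice (invmx (xget 1%:M X))) SL = (p ^ (n * a))%N.
Proof.
move=> [_ [A [u [uU Au ->]]] <-]; have AU := sim_unit uU Au.
have dA2 := similitude_det Au.
have c0 := padic_unit_pk_neq0 a uU.
have dA0 : \det A != 0.
  by have := expf_neq0 (n + n) c0; rewrite -dA2 expf_eq0.
have [U [V [nu [uU' uV snu AE]]]] := padic_smith_square dA0.
have Anu : quotient_type (row_span A) nu by rewrite AE; exact: quotient_type_smith.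
transitivity (lattice_index (row_lattice (invmx A^i)) SL).
  by have := congr1 (fun L : set 'rV[Qp]_(n + n) => lattice_index L SL) (row_lattice_coset AU).
rewrite (row_lattice_index AU Anu); congr (_ ^ _)%N.
have detA : \det A = (\det U * \det V) * pp ^+ (\sum_(k <- nu) k).
  rewrite AE !det_mulmx det_diag mulrAC; congr (_ * _).
  rewrite big_tuple -prodrXr; apply: eq_bigr => i _; rewrite mxE//.
have e : (\det U * \det V) ^+ 2 * pp ^+ ((\sum_(k <- nu) k) * 2) =
    u ^+ (n + n) * pp ^+ (a * (n + n)).
  by rewrite [in LHS]exprM -[LHS]exprMn -detA dA2 exprMn -exprM.
have w2U : (\det U * \det V) ^+ 2 \is a GRing.unit by rewrite unitrX// unitrM -!unitmxE uU'.
have := padic_unit_pk_inj w2U (unitrX _ uU) e.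
lia.
Qed.

Lemma zeta_coef l P k : ehrhart_hecke_zeta p_pr l P (deg1 k) =
  \sum_(X \in [set left_coset g | g in @Gplus p p_pr n])
    (ehrhart_coef (coset_rational X) P l / ehrhart_coef (integer_lattice _) P l)%:C%C *+
    (k == logn p (lattice_index (row_lattice (invmx (xget 1%:M X))) SL))
    :> C.
Proof.
rewrite /ehrhart_hecke_zeta /formal_sum; apply: eq_fsbigr => X _.
by rewrite series1_exp series1_mono.
Qed.

Lemma Gplus_left_cosets X : [set left_coset g | g in @Gplus p p_pr n] X <-> exists a, LC a X.
Proof.
split=> [[g /(GplusP n_gt0)[a ga] <-]|[a [g ga <-]]]; first by exists a, g.
by exists g => //; apply/(GplusP n_gt0); exists a.
Qed.

Lemma zeta_coefE l (P : set 'rV[R]_(n + n)) a : lattice_polytope P ->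
    ehrhart_coef (integer_lattice (n + n)) P l != 0 ->
  ehrhart_hecke_zeta p_pr l P (deg1 (n * a)%N) =
  \sum_(X \in LC a) (p%:R : C) ^+ (l * coset_depth n_gt0 a X).
Proof.
move=> Plat c0; have LCfin : finite_set (LC a) by exact: left_cosets_finite.
have logE b X : LC b X -> logn p (lattice_index (row_lattice (invmx (xget 1%:M X)))
    SL) = (n * b)%N.
  by move=> /left_coset_index ->; rewrite pfactorK.
rewrite zeta_coef -(@fsbig_widen _ _ _ _ (LC a)).
- rewrite (eq_fsbigr (fun X => (ehrhart_coef (coset_rational X) P l /
    ehrhart_coef (integer_lattice _) P l)%:C%C)); last first.
    by move=> X; rewrite inE => Xa; rewrite (logE a X Xa) eqxx.
  have := ehrhart_average p_pr n_gt0 a l Plat; rewrite !fsbig_finite// => h.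
  transitivity ((\sum_(X <- fset_set (LC a)) (p%:R : R) ^+ (l * coset_depth n_gt0 a X))%:C%C).
    by rewrite -[X in X%:C%C](mulfK c0) -h mulr_suml rmorph_sum.
  by rewrite rmorph_sum; apply: eq_bigr => X _; rewrite rmorphXn rmorph_nat.
- by move=> X Xa; apply/Gplus_left_cosets; exists a.
- move=> X /= [/Gplus_left_cosets[b Xb] Xa]; rewrite (logE b X Xb) eqn_pmul2l//.
  by case: eqP => // ab; case: Xa; rewrite ab.
Qed.

Lemma zeta_coef0 l (P : set 'rV[R]_(n + n)) k : ~~ (n %| k)%N ->
  ehrhart_hecke_zeta p_pr l P (deg1 k) = 0.
Proof.
move=> nk; rewrite zeta_coef fsbig1// => X /Gplus_left_cosets[b Xb].
rewrite (left_coset_index Xb) pfactorK//; case: eqP => // kE.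
by rewrite kE dvdn_mulr in nk.
Qed.

Lemma psi_hecke_series l (P : set 'rV[R]_(n + n)) : lattice_polytope P ->
    ehrhart_coef (integer_lattice (n + n)) P l != 0 ->
  psi p l (hecke_series p_pr n R) = ehrhart_hecke_zeta p_pr l P.
Proof.
move=> Plat c0; apply: series1P => k.
have [/dvdnP[a ->]|nk] := boolP (n %| k)%N; last first.
  by rewrite zeta_coef0//; exact: psi_coef0.
rewrite mulnC zeta_coefE// psi_coef//; exact: hecke_series_eval.
Qed.

Lemma psi_linear_mul l c (f : series unit (laurent n.+1 C)) :
  psi p l ((1 - series_const c * series_var _ tt) * f) =
  (1 - series_const (laurent_eval (@psi_point p n R l) c) * series_var C tt ^+ n) * psi p l f.
Proof.
rewrite -[series_var (laurent n.+1 C) tt]expr1 !series1_exp mulrBl mul1r.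
rewrite (psiD p l n_gt0) (psiN p l n_gt0) (psi_mono_mul (prime_gt0 p_pr) l n_gt0) muln1.
rewrite [RHS]mulrBl mul1r.
reflexivity.
Qed.

Lemma psi_point_prod l : \prod_(i < n.+1) psi_point p R l i = p%:R ^+ 'C(n.+1, 2).
Proof.
have pC : p%:R != 0 :> C by rewrite pnatr_eq0 -lt0n prime_gt0.
rewrite big_ord_recl (bigD1 (last_ord n_gt0))//=.
rewrite /psi_point /= /bump/= add1n prednK// ltnn mulrA [p%:R ^+ l]exprnP -expfzDr//.
rewrite addrC subrK -exprnP.
rewrite (eq_bigr (fun i : 'I_n => p%:R ^+ i.+1)); last first.
  by move=> i il; rewrite add1n (ltn_last_ord il).
transitivity (\prod_(i < n) (p%:R : C) ^+ i.+1).
  by rewrite [RHS](bigD1 (last_ord n_gt0))//= prednK.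
rewrite prodrXr; congr (_ ^+ _); rewrite -triangular_sum big_mkord big_ord_recl add0n//.
Qed.
End Zeta.

Theorem corollary2 (R : realType) (n l p : nat) (n_gt0 : (0 < n)%N)
    (l_le : (l <= 2 * n)%N) (p_pr : prime p) (P : set 'rV[R]_(n + n))
    (P_lattice : lattice_polytope P) (P_full : full_dimensional P)
    (cl_neq0 : ehrhart_coef (integer_lattice (n + n)) P l != 0) :
  let t := series_var R[i] tt in
  let q (k : nat) : series unit R[i] := series_const (p%:R ^+ k) in
  psi p l (Phi p (HSpr p_pr n R)) = psi p l (hecke_series_pr p_pr n R) /\
  psi p l (hecke_series_pr p_pr n R) =
    ehrhart_hecke_zeta p_pr l P *
      (1 - q l * t ^+ n) * (1 - q 'C(n.+1, 2) * t ^+ n).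
Proof.
move=> t q; split; first by rewrite Phi_HSpr.
have ne i := psi_point_neq0 (prime_gt0 p_pr) R l (i : 'I_n.+1).
rewrite -(psi_hecke_series p_pr n_gt0 P_lattice cl_neq0).
rewrite [X in psi p l X]series1_linear_mul2 !(psi_linear_mul p_pr n_gt0).
rewrite (laurent_evalM ne) laurent_eval_var (laurent_eval_prod ne).
have := psi_point_prod p_pr R n_gt0 l; rewrite big_ord_recl => prodE.
under eq_bigr do rewrite laurent_eval_var.
have x0E : psi_point p R l (ord0 : 'I_n.+1) = p%:R ^+ l by [].
rewrite prodE x0E [RHS]mulrC; apply: congr1; exact: mulrC.
Qed.
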